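(* Let $\Theta$ be a free holomorphic function on $[B(\mathcal H)^n]_1$ with coefficients in $B(\mathcal E,\mathcal Y)$. Then $\Theta$ is in $H^2_{\bf ball}$ if and only if the map $\varphi$ defined by $$\varphi(r):=\Theta(rR_1,\dots,rR_n)^*\Theta(rR_1,\dots,rR_n),\qquad r\in[0,1),$$ has a pluriharmonic majorant. In this case, the least pluriharmonic majorant $\psi$ for $\varphi$ is given by $$\psi(r):=\mathrm{Re}\,W(rR_1,\dots,rR_n),\qquad r\in[0,1),$$ where $W$ is the free holomorphic function having the Herglotz–Riesz type representation $$W(X_1,\dots,X_n)=(\mu_\theta\otimes\mathrm{id})\left[\Big(I+\sum_{i=1}^nR_i^*\otimes X_i\Big)\Big(I-\sum_{i=1}^nR_i^*\otimes X_i\Big)^{-1}\right]$$ for $(X_1,\dots,X_n)\in[B(\mathcal H)^n]_1$, where $\mu_\theta:\mathcal R_n^*+\mathcal R_n\to B(\mathcal E)$ is the completely positive linear map uniquely determined by the equation $$\langle\mu_\theta(R_{\tilde\alpha}^* )x,y\rangle:=\lim_{r\to1}\langle\Theta(rR_1,\dots,rR_n)^*(I_{\mathcal Y}\otimes S_{\tilde\alpha}^* )\Theta(rR_1,\dots,rR_n)(x\otimes1),y\otimes1\rangle$$ for $\alpha\in\mathbb F_n^+$ and $x,y\in\mathcal E$.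
   Context: Let $n\ge 1$; $\mathcal E,\mathcal Y$ are Hilbert spaces ($\mathcal E$ separable) and $\mathcal H$ is an infinite dimensional Hilbert space. $\mathbb F_n^+$ is the free unital semigroup on $g_1,\dots,g_n$ with identity $g_0$, $|\alpha|$ is word length, and $\tilde\alpha=g_{i_k}\cdots g_{i_1}$ is the reverse of $\alpha=g_{i_1}\cdots g_{i_k}$. For operators $X_1,\dots,X_n$, $X_\alpha=X_{i_1}\cdots X_{i_k}$, $X_{g_0}=I$. $H_n$ is an $n$-dimensional complex Hilbert space with orthonormal basis $e_1,\dots,e_n$, $F^2(H_n)=\mathbb C1\oplus\bigoplus_{k\ge1}H_n^{\otimes k}$, with orthonormal basis $e_\alpha=e_{i_1}\otimes\cdots\otimes e_{i_k}$, $e_{g_0}=1$; $S_i\varphi=e_i\otimes\varphi$ and $R_i\varphi=\varphi\otimes e_i$ are the left and right creation operators, $R=(R_1,\dots,R_n)$. $\mathcal R_n$ is the norm closed algebra generated by $R_1,\dots,R_n$ and $I$. For any Hilbert space $\mathcal H$, $[B(\mathcal H)^n]_1=\{(X_1,\dots,X_n)\in B(\mathcal H)^n:\|\sum_iX_iX_i^*\|^{1/2}<1\}$. A free holomorphic function on $[B(\mathcal H)^n]_1$ with coefficients in $B(\mathcal E,\mathcal Y)$ is a map $\Theta(X)=\sum_{k=0}^\infty\sum_{|\alpha|=k}A_{(\alpha)}\otimes X_\alpha$ with $A_{(\alpha)}\in B(\mathcal E,\mathcal Y)$ and $\limsup_k\|\sum_{|\alpha|=k}A_{(\alpha)}^*A_{(\alpha)}\|^{1/2k}\le1$;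 it is evaluated at $(rR_1,\dots,rR_n)$ by the same series. It is in $H^2_{\bf ball}$ if $\sum_{\alpha}A_{(\alpha)}^*A_{(\alpha)}\le cI_{\mathcal E}$ for some $c>0$. Pluriharmonic curves with respect to the right creation operators: for $X\in[B(\mathcal H)^n]_1$ let $\Delta_X=(I-\sum_iX_iX_i^* )^{1/2}$, $K_Xh=\sum_{\alpha}e_{\tilde\alpha}\otimes\Delta_XX_\alpha^*h$ for $h\in\mathcal H$, and $\mathbf P_X[u]=(I_{\mathcal E}\otimes K_X^* )(u\otimes I_{\mathcal H})(I_{\mathcal E}\otimes K_X)$ for $u\in B(\mathcal E\otimes F^2(H_n))$. Let $\mathcal S$ be the operator norm closure in $B(\mathcal E\otimes F^2(H_n))$ of $\boldsymbol{\mathcal P}^*+\boldsymbol{\mathcal P}$, where $\boldsymbol{\mathcal P}=B(\mathcal E)\otimes\{\text{polynomials in }R_1,\dots,R_n,I\}$. A pluriharmonic curve on $[0,1)$ is a map $h:[0,1)\to\mathcal S$ with $h(r)=\mathbf P_{\frac rtR}[h(t)]$ for all $0\le r<t<1$. A pluriharmonic majorant of $\varphi$ is a pluriharmonic curve $h$ on $[0,1)$ with $\varphi(r)\le h(r)$ for all $r\in[0,1)$; it is least if it is $\le$ every other pluriharmonic majorant pointwise on $[0,1)$. *)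

(* Defs.v *)
From HB Require Import structures.
From mathcomp Require Import all_boot all_order all_algebra sesquilinear.
From mathcomp Require Import complex.
From mathcomp Require Import all_classical all_reals all_analysis.

Set Implicit Arguments.
Unset Strict Implicit.
Unset Printing Implicit Defensive.

Import Order.TTheory GRing.Theory Num.Theory numFieldNormedType.Exports.

Local Open Scope classical_set_scope.
Local Open Scope complex_scope.
Local Open Scope ring_scope.

(** * Complex Hilbert spaces *)

(* The inner product is linear in the first argument and antilinear in the
   second one.  The norm of a normed module over R[i] takes its values in
   R[i]. *)
HB.mixin Record isHilbert (R : realType) V of CompleteNormedModule R[i] V := {
  hdot : {dot V for (@Num.conj R[i])} ;
  hdot_norm : forall x : V, `|x| ^+ 2 = hdot x x
}.

#[short(type="hilbertType")]
HB.structure Definition Hilbert (R : realType) :=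
  { V of isHilbert R V & CompleteNormedModule R[i] V }.

Definition inner (R : realType) (V : hilbertType R) (x y : V) : R[i] :=
  (@hdot R V : {dot V for (@Num.conj R[i])}) x y.

Notation "'<< x , y >>" := (inner x y)
  (at level 0, x at level 99, y at level 99,
   format "''<<' x ,  y  '>>'") : ring_scope.

Definition hilbert_separable (R : realType) (V : hilbertType R) : Prop :=
  exists2 D : set V, countable D & dense D.

Definition infinite_dimensional (R : realType) (V : hilbertType R) : Prop :=
  ~ exists m (v : 'I_m -> V),
      forall x, exists c : 'I_m -> R[i], x = \sum_(i < m) c i *: v i.

(** * Bounded operators *)

(* An operator is a plain function V -> W, so that sums and scalar multiples
   are the pointwise ones of the library; membership in B(V, W) is [bop].
   Objects that are unique when they exist (adjoint, inverse, square root,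
   limit, tensor product of operators) are selected by [xget], with the junk
   value 0 when there is none. *)
Section Operators.
Variable R : realType.
Implicit Types V W : hilbertType R.

Definition bop V W (A : V -> W) : Prop := linear A /\ continuous A.

Definition opnorm V W (A : V -> W) : R :=
  sup [set complex.Re `|A x| | x in [set x : V | `|x| <= 1]].

Definition adj V W (A : V -> W) : W -> V :=
  xget 0 [set B | bop B /\ forall x y, '<< A x, y >> = '<< x, B y >>].

(* Over R[i], 0 <= z says that z is real and nonnegative. *)
Definition ople V (A B : V -> V) : Prop :=
  forall x, 0 <= '<< (B - A) x, x >>.

Definition opinv V (A : V -> V) : V -> V :=
  xget 0 [set B | [/\ bop B, A \o B = idfun & B \o A = idfun]].

Definition opsqrt V (A : V -> V) : V -> V :=
  xget 0 [set D | [/\ bop D, ople 0 D & D \o D = A]].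

Definition opre V (A : V -> V) : V -> V := 2^-1 *: (A + adj A).

(* limit in the operator norm *)
Definition oplim V W (u : nat -> V -> W) : V -> W :=
  xget 0 [set L | bop L /\ opnorm (u N - L) @[N --> \oo] --> (0 : R)].

Definition opclosure V W (A : set (V -> W)) : set (V -> W) :=
  [set u | bop u /\
    forall e : R, 0 < e -> exists2 a, A a & opnorm (u - a) < e].

Definition opadjs V W (A : set (V -> W)) : set (W -> V) :=
  [set adj a | a in A].

Definition opsums V W (A B : set (V -> W)) : set (V -> W) :=
  [set u | exists2 a, A a & exists2 b, B b & u = a + b].

End Operators.

(** * Hilbert tensor products *)

(* A choice of the Hilbert tensor product of any two Hilbert spaces; by the
   three properties below it is determined up to a unique unitary that
   preserves elementary tensors. *)
Record hilbert_tensor (R : realType) := HilbertTensor {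
  tprod : hilbertType R -> hilbertType R -> hilbertType R ;
  tens : forall V W : hilbertType R, {bilinear V -> W -> tprod V W} ;
  tens_inner : forall (V W : hilbertType R) (x x' : V) (y y' : W),
    '<< tens V W x y, tens V W x' y' >> = '<< x, x' >> * '<< y, y' >> ;
  tens_total : forall V W : hilbertType R, dense [set z : tprod V W |
    exists s : seq (V * W), z = \sum_(p <- s) tens V W p.1 p.2]
}.

Section TensorOperators.
Variables (R : realType) (T : hilbert_tensor R).
Implicit Types U V W : hilbertType R.

Definition optens V V' W W' (A : V -> V') (B : W -> W') :
    tprod T V W -> tprod T V' W' :=
  xget 0 [set C | bop C /\
    forall x y, C (tens T V W x y) = tens T V' W' (A x) (B y)].

(* the identification of V (x) (U (x) W) with (V (x) U) (x) W *)
Definition tassoc V U W :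
    tprod T V (tprod T U W) -> tprod T (tprod T V U) W :=
  xget 0 [set C | bop C /\ forall x f h,
    C (tens T V (tprod T U W) x (tens T U W f h)) =
    tens T (tprod T V U) W (tens T V U x f) h].

(* the algebraic tensor product of two spaces of operators *)
Definition opspan V V' W W' (A : set (V -> V')) (B : set (W -> W')) :
    set (tprod T V W -> tprod T V' W') :=
  [set u | exists m (a : 'I_m -> V -> V') (b : 'I_m -> W -> W'),
    [/\ forall j, A (a j), forall j, B (b j) &
        u = \sum_(j < m) optens (a j) (b j)]].

End TensorOperators.

Arguments optens {R} T {V V' W W'} A B.
Arguments tassoc {R} T V U W.
Arguments opspan {R} T {V V' W W'} A B.

(** * Words, row contractions, free holomorphic functions *)

(* The free semigroup on n generators is seq 'I_n; reversal is rev, and the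
   words of length k are the k.-tuple 'I_n. *)
Section FreeHolomorphic.
Variables (R : realType) (n : nat).
Implicit Types E Y H : hilbertType R.

Definition monom H (X : 'I_n -> H -> H) (w : seq 'I_n) : H -> H :=
  foldr (fun i A => X i \o A) idfun w.

Definition row_ball H : set ('I_n -> H -> H) :=
  [set X | (forall i, bop (X i)) /\
           Num.sqrt (opnorm (\sum_(i < n) (X i \o adj (X i)))) < 1].

Record free_hol E Y := FreeHol {
  coef :> seq 'I_n -> E -> Y ;
  coef_bop : forall w, bop (coef w) ;
  coef_limsup :
    (limn_esup (fun k : nat =>
      (opnorm (\sum_(w : k.-tuple 'I_n) (adj (coef w) \o coef w))
         `^ (2 * k)%:R^-1)%:E) <= 1)%E
}.

Definition fh_eval (T : hilbert_tensor R) E Y H (A : free_hol E Y)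
    (X : 'I_n -> H -> H) : tprod T E H -> tprod T Y H :=
  oplim (fun N : nat =>
    \sum_(k < N) \sum_(w : k.-tuple 'I_n) optens T (A w) (monom X w)).

(* A series of positive operators is <= c I iff all its partial sums are. *)
Definition H2_ball E Y (A : free_hol E Y) : Prop :=
  exists2 c : R, 0 < c & forall N : nat,
    ople (\sum_(k < N) \sum_(w : k.-tuple 'I_n) (adj (A w) \o A w))
         (c%:C *: (idfun : E -> E)).

End FreeHolomorphic.

Arguments fh_eval {R n} T {E Y H} A X.

(** * The full Fock space *)

(* F^2(H_n) through its orthonormal basis (e_w) indexed by the words, where
   e_(w ++ w') is e_w (x) e_w' and e_[::] is the vacuum vector 1. *)
Record fock_space (R : realType) (n : nat) := FockSpace {
  fock :> hilbertType R ;
  fock_e : seq 'I_n -> fock ;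
  fock_orthonormal : forall w w', '<< fock_e w, fock_e w' >> = (w == w')%:R ;
  fock_total : dense [set f : fock | exists s : seq (R[i] * seq 'I_n),
    f = \sum_(p <- s) p.1 *: fock_e p.2]
}.

Section Fock.
Variables (R : realType) (n : nat) (F : fock_space R n).

Definition creL (i : 'I_n) : F -> F :=
  xget 0 [set A | bop A /\ forall w, A (fock_e F w) = fock_e F (i :: w)].

Definition creR (i : 'I_n) : F -> F :=
  xget 0 [set A | bop A /\ forall w, A (fock_e F w) = fock_e F (rcons w i)].

Definition scaled_creR (r : R) : 'I_n -> F -> F := fun i => r%:C *: creR i.

Definition polyR : set (F -> F) :=
  [set p | exists N (c : seq 'I_n -> R[i]),
    p = \sum_(k < N) \sum_(w : k.-tuple 'I_n) c w *: monom creR w].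

(* the norm closed algebra R_n, and R_n^* + R_n *)
Definition algR : set (F -> F) := opclosure polyR.
Definition sysR : set (F -> F) := opsums (opadjs algR) algR.

Variable T : hilbert_tensor R.
Implicit Types E H : hilbertType R.

(** ** Poisson transform and pluriharmonic curves *)

Definition defect H (X : 'I_n -> H -> H) : H -> H :=
  opsqrt ((idfun : H -> H) - \sum_(i < n) (X i \o adj (X i))).

Definition poisson_kernel H (X : 'I_n -> H -> H) : H -> tprod T F H :=
  fun h => limn (fun N : nat => \sum_(k < N) \sum_(w : k.-tuple 'I_n)
    tens T F H (fock_e F (rev w)) (defect X (adj (monom X w) h))).

Definition poisson E H (X : 'I_n -> H -> H)
    (u : tprod T E F -> tprod T E F) : tprod T E H -> tprod T E H :=
  let K := tassoc T E F H \o optens T (idfun : E -> E) (poisson_kernel X) in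
  adj K \o optens T u (idfun : H -> H) \o K.

Definition polyE E : set (tprod T E F -> tprod T E F) :=
  opspan T (@bop R E E) polyR.

Definition spaceS E : set (tprod T E F -> tprod T E F) :=
  opclosure (opsums (opadjs (@polyE E)) (@polyE E)).

Definition pluriharmonic_curve E (h : R -> tprod T E F -> tprod T E F) :=
  (forall r, 0 <= r < 1 -> spaceS (h r)) /\
  (forall r t, 0 <= r -> r < t -> t < 1 ->
     h r = poisson (scaled_creR (r / t)) (h t)).

Definition pluriharmonic_majorant E (phi h : R -> tprod T E F -> tprod T E F) :=
  pluriharmonic_curve h /\ forall r, 0 <= r < 1 -> ople (phi r) (h r).

Definition least_pluriharmonic_majorant E
    (phi h : R -> tprod T E F -> tprod T E F) :=
  pluriharmonic_majorant phi h /\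
  forall h', pluriharmonic_majorant phi h' ->
    forall r, 0 <= r < 1 -> ople (h r) (h' r).

(** ** Completely positive maps on R_n^* + R_n *)

(* Maps on sysR are total functions; their values outside are irrelevant. *)

Definition op_positive (V : hilbertType R) m (u : 'I_m -> 'I_m -> V -> V) : Prop :=
  forall v : 'I_m -> V,
    0 <= \sum_(i < m) \sum_(j < m) '<< u i j (v j), v i >>.

Definition cp_linear E (mu : (F -> F) -> E -> E) : Prop :=
  [/\ forall f, sysR f -> bop (mu f),
      forall (c : R[i]) f g, sysR f -> sysR g ->
        mu (c *: f + g) = c *: mu f + mu g &
      forall m (u : 'I_m -> 'I_m -> F -> F),
        (forall i j, sysR (u i j)) -> op_positive u ->
        op_positive (fun i j => mu (u i j))].

(* mu (x) id is the bounded linear extension of f (x) A |-> mu(f) (x) A from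
   the algebraic tensor product of R_n^* + R_n and B(H) to its norm closure. *)
Definition is_ampliation E H (mu : (F -> F) -> E -> E)
    (M : (tprod T F H -> tprod T F H) -> tprod T E H -> tprod T E H) : Prop :=
  let D := opclosure (opspan T sysR (@bop R H H)) in
  [/\ forall u, D u -> bop (M u),
      forall (c : R[i]) u v, D u -> D v -> M (c *: u + v) = c *: M u + M v,
      exists k : R, forall u, D u -> opnorm (M u) <= k * opnorm u &
      forall f A, sysR f -> bop A -> M (optens T f A) = optens T (mu f) A].

Definition ampliation E H (mu : (F -> F) -> E -> E) :
    (tprod T F H -> tprod T F H) -> tprod T E H -> tprod T E H :=
  xget 0 (is_ampliation mu).

(* (mu (x) id)[(I + sum R_i^* (x) X_i) (I - sum R_i^* (x) X_i)^-1] *)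
Definition herglotz E H (mu : (F -> F) -> E -> E) (X : 'I_n -> H -> H) :
    tprod T E H -> tprod T E H :=
  let I := idfun : tprod T F H -> tprod T F H in
  let Z := \sum_(i < n) optens T (adj (creR i)) (X i) in
  ampliation mu ((I + Z) \o opinv (I - Z)).

End Fock.

Arguments creL {R n} F i.
Arguments creR {R n} F i.
Arguments scaled_creR {R n} F r i.
Arguments sysR {R n} F.
Arguments herglotz {R n F} T {E H} mu X.

(* Main.v *)
Require Import Defs.
From HB Require Import structures.
From mathcomp Require Import all_boot all_order all_algebra sesquilinear.
From mathcomp Require Import complex.
From mathcomp Require Import all_classical all_reals all_analysis.
From mathcomp Require Import ring lra.

Set Implicit Arguments.
Unset Strict Implicit.
Unset Printing Implicit Defensive.

Import Order.TTheory GRing.Theory Num.Theory numFieldNormedType.Exports.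

Local Open Scope classical_set_scope.
Local Open Scope complex_scope.
Local Open Scope ring_scope.

(* If the coefficients of Theta are square summable, Gamma x is the vector
   sum_w A_w x (x) e_w, the radial limit of Theta(rR)(x (x) 1), and
   mu_theta f = Gamma^* (I (x) f) Gamma.  By Abel summation, the entries of
   phi(t) at x (x) e_v and y (x) e_w converge, as t -> 1, to
   <(I (x) S_v U) Gamma x, (I (x) S_w U) Gamma y>, where U reverses words.
   The Poisson transform P_s multiplies the entries at e_v, e_w of every
   operator in the norm closed span of the A (x) R_w and their adjoints by
   s^||v|-|w||, and the entries of psi(r) = Re W(rR) are the limits above
   multiplied by r^||v|-|w||.  Hence psi is pluriharmonic and psi(r) is the
   limit of P_{r/t}[phi(t)] as t -> 1; the Schwarz inequality for P_{r/t}
   gives phi <= psi, and its positivity gives psi <= h for every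
   pluriharmonic majorant h.  Conversely, a majorant h bounds
   |Theta(rR)(x (x) 1)|^2 by <h(r)(x (x) 1), x (x) 1>, which does not depend
   on r.  A free holomorphic function is determined by its values on [B(H)^n]_1
   through weighted shifts along a word, which are nilpotent. *)

(** * Hilbert spaces and bounded operators *)

(** Under square summability [Theta(rR)] need not stay bounded as r tends to 1: its radial limit
    exists only vector by vector, on x ⊗ e_v. Limits are therefore taken in matrix entries and
    extended to finite sums of such vectors; the resulting inequalities reach the whole space
    because at a fixed r both sides are bounded operators. U appears because R_w appends the
    reversal of w: formally Theta(R) sends x ⊗ e_v to the sum of A_w x ⊗ e_(v rev w), which is (I ⊗
    S_v U) Gamma x. The limit entries form a multi-Toeplitz kernel: equal first letters of v and w
    cancel and distinct ones give 0, since left creation operators are isometries with orthogonal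
    ranges. They are thus determined by the pairs in which one word is empty, and these are the
    moments of mu_theta. The coefficients of W are the moments, doubled away from degree 0 since (I
    + Z)(I - Z)^-1 = I + 2 Z + 2 Z^2 + ..., and the factor 1/2 of the real part undoes the
    doubling. *)

Section ComplexNumbers.
Variable R : realType.
Implicit Types (r : R) (z : R[i]).

(** The library norm of [R[i]], and of a space over it, takes values in [R[i]]. Estimates are made
    in the totally ordered field [R], hence the real-valued [cab] and, for vectors, [nrm]. *)
Definition cab z : R := complex.Re `|z|.

Lemma ge0_ReK z : 0 <= z -> (complex.Re z)%:C = z.
Proof. by move=> z0; rewrite RRe_real // ger0_real. Qed.

Lemma cabE z : `|z| = (cab z)%:C.
Proof. by rewrite /cab ge0_ReK. Qed.

Lemma cab_ge0 z : 0 <= cab z.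
Proof. by rewrite -ler0c -cabE. Qed.

Lemma cabR r : cab r%:C = `|r|.
Proof. by rewrite /cab normc_def /= expr0n addr0 sqrtr_sqr. Qed.

Lemma cabM z z' : cab (z * z') = cab z * cab z'.
Proof. by apply: complexI; rewrite rmorphM /= -!cabE normrM. Qed.

Lemma cabD z z' : cab (z + z') <= cab z + cab z'.
Proof. by rewrite -lecR rmorphD /= -!cabE ler_normD. Qed.

Lemma cab0 : cab 0 = 0.
Proof. by rewrite -[0]/(0%:C) cabR normr0. Qed.

Lemma cabN z : cab (- z) = cab z.
Proof. by rewrite /cab normrN. Qed.

Lemma cab_conj z : cab (Num.conj z) = cab z.
Proof. by rewrite /cab norm_conjC. Qed.

Lemma cab_sq z : z * Num.conj z = (cab z ^+ 2)%:C.
Proof. by rewrite rmorphXn /= -cabE normCK. Qed.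

Lemma cab_eq0 z : cab z = 0 -> z = 0.
Proof. by move=> z0; apply/eqP; rewrite -normr_eq0 cabE z0. Qed.

Lemma Re_le_cab z : complex.Re z <= cab z.
Proof.
rewrite -lecR -cabE; apply: le_trans (normc_ge_Re z).
by rewrite lecR ler_norm.
Qed.

Lemma conjR r : Num.conj (r%:C) = r%:C.
Proof. by rewrite conj_Creal //; apply/complex_realP; exists r. Qed.

Lemma Re_conj z : complex.Re (Num.conj z) = complex.Re z.
Proof.
have := complexRe (Num.conj z); rewrite Re_conj -complexRe.
by move=> /complexI.
Qed.

Lemma gtC0_Re z : 0 < z -> exists2 r : R, 0 < r & z = r%:C.
Proof.
move=> z0; exists (complex.Re z); last by rewrite ge0_ReK // ltW.
by rewrite -ltcR ge0_ReK // ltW.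
Qed.
End ComplexNumbers.

Section HilbertSpaces.
Variable R : realType.
Implicit Types U V W : hilbertType R.

Definition nrm V (x : V) : R := complex.Re `|x|.

Section OneSpace.
Variable V : hilbertType R.
Implicit Types x y z : V.

Lemma nrmE x : `|x| = (nrm x)%:C.
Proof. by rewrite /nrm ge0_ReK. Qed.

Lemma nrm_ge0 x : 0 <= nrm x.
Proof. by rewrite -ler0c -nrmE. Qed.

Lemma nrmD x y : nrm (x + y) <= nrm x + nrm y.
Proof. by rewrite -lecR rmorphD /= -!nrmE ler_normD. Qed.

Lemma nrmN x : nrm (- x) = nrm x.
Proof. by rewrite /nrm normrN. Qed.

Lemma nrmB x y : nrm (x - y) <= nrm x + nrm y.
Proof. by rewrite -(nrmN y) nrmD. Qed.

Lemma nrmBC x y : nrm (x - y) = nrm (y - x).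
Proof. by rewrite -nrmN opprB. Qed.

Lemma nrm_triangle x y z : nrm (x - z) <= nrm (x - y) + nrm (y - z).
Proof. by apply: le_trans (nrmD _ _); rewrite subrKA. Qed.

Lemma nrmZ a x : nrm (a *: x) = cab a * nrm x.
Proof. by apply: complexI; rewrite rmorphM /= -!nrmE -cabE normrZ. Qed.

Lemma nrm0 : nrm (0 : V) = 0.
Proof. by apply: complexI; rewrite -nrmE normr0. Qed.

Lemma nrm_eq0 x : nrm x = 0 -> x = 0.
Proof. by move=> x0; apply/eqP; rewrite -normr_eq0 nrmE x0. Qed.

Lemma nrm_small x : (forall e : R, 0 < e -> nrm x <= e) -> x = 0.
Proof.
move=> xe; apply: nrm_eq0; apply/eqP; rewrite eq_le nrm_ge0 andbT.
by apply/ler_addgt0Pl => e e0; rewrite addr0; apply: xe.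
Qed.

Lemma innerDl x y z : '<< x + y, z >> = '<< x, z >> + '<< y, z >>.
Proof. exact: linearDl. Qed.

Lemma innerDr x y z : '<< z, x + y >> = '<< z, x >> + '<< z, y >>.
Proof. exact: linearDr. Qed.

Lemma innerZl a x z : '<< a *: x, z >> = a * '<< x, z >>.
Proof. exact: linearZl_LR. Qed.

Lemma innerZr a x z : '<< z, a *: x >> = Num.conj a * '<< z, x >>.
Proof. exact: linearZr_LR. Qed.

Lemma innerNl x z : '<< - x, z >> = - '<< x, z >>.
Proof. exact: linearNl. Qed.
Lemma innerBl x y z : '<< x - y, z >> = '<< x, z >> - '<< y, z >>.
Proof. exact: linearBl. Qed.

Lemma innerBr x y z : '<< z, x - y >> = '<< z, x >> - '<< z, y >>.
Proof. exact: linearBr. Qed.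

Lemma inner0l z : '<< 0, z >> = 0.
Proof. exact: linear0l. Qed.

Lemma inner0r z : '<< z, 0 >> = 0.
Proof. exact: linear0r. Qed.

Lemma inner_suml I (s : seq I) (P : pred I) (F : I -> V) z :
  '<< \sum_(i <- s | P i) F i, z >> = \sum_(i <- s | P i) '<< F i, z >>.
Proof. exact: linear_sumlz. Qed.

Lemma inner_sumr I (s : seq I) (P : pred I) (F : I -> V) z :
  '<< z, \sum_(i <- s | P i) F i >> = \sum_(i <- s | P i) '<< z, F i >>.
Proof. exact: linear_sumr. Qed.

Lemma innerC x y : '<< x, y >> = Num.conj '<< y, x >>.
Proof. by rewrite /inner hermC /= expr0 mul1r. Qed.

Lemma inner_nrm x : '<< x, x >> = (nrm x ^+ 2)%:C.
Proof. by rewrite rmorphXn /= -nrmE hdot_norm. Qed.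

Lemma inner_ge0 x : 0 <= '<< x, x >>.
Proof. by rewrite inner_nrm ler0c sqr_ge0. Qed.

Lemma nrm_sqE x : nrm x ^+ 2 = complex.Re '<< x, x >>.
Proof. by rewrite inner_nrm. Qed.

Lemma nrm_sum I (s : seq I) (P : pred I) (F : I -> V) :
  nrm (\sum_(i <- s | P i) F i) <= \sum_(i <- s | P i) nrm (F i).
Proof.
elim/big_rec2: _ => [|i r x _ h]; first by rewrite nrm0.
by apply: le_trans (nrmD _ _) _; rewrite lerD2l.
Qed.

Lemma cauchy_schwarz x y : cab '<< x, y >> <= nrm x * nrm y.
Proof.
have [y0|y0] := eqVneq (nrm y) 0.
  by rewrite (nrm_eq0 y0) inner0r nrm0 cab0 mulr0.
have yp : 0 < nrm y by rewrite lt_def y0 nrm_ge0.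
set d := '<< x, y >>.
(* The component of [x] orthogonal to [y], multiplied by |y|^2 to avoid a division; its squared norm
   is |y|^2 times the gap in the squared inequality. *)
pose z := ((nrm y ^+ 2)%:C *: x - d *: y).
have : 0 <= '<< z, z >> by exact: inner_ge0.
have -> : '<< z, z >> =
  (nrm y ^+ 2 * (nrm y ^+ 2 * nrm x ^+ 2 - cab d ^+ 2))%:C.
  rewrite /z innerBl !innerBr !innerZl !innerZr !inner_nrm conjR -/d.
  rewrite [ '<< y, x >> ]innerC -/d.
  rewrite [RHS]rmorphM rmorphB /= -cab_sq rmorphM /=.
  ring.
rewrite ler0c pmulr_rge0 ?exprn_gt0 // subr_ge0 -exprMn [nrm y * _]mulrC.
by rewrite ler_pXn2r ?nnegrE ?mulr_ge0 ?nrm_ge0 ?cab_ge0.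
Qed.

Lemma inner_eq0 x : (forall y, '<< x, y >> = 0) -> x = 0.
Proof.
move=> /(_ x); rewrite inner_nrm => /complexI /eqP.
by rewrite sqrf_eq0 => /eqP /nrm_eq0.
Qed.

Lemma inner_inj x x' : (forall y, '<< x, y >> = '<< x', y >>) -> x = x'.
Proof.
by move=> h; apply/subr0_eq/inner_eq0 => y; rewrite innerBl h subrr.
Qed.

Lemma cvg_nrm T (F : set_system T) {FF : Filter F} (u : T -> V) (l : V) :
  u @ F --> l <-> (fun t => nrm (u t - l)) @ F --> (0 : R).
Proof.
split=> [/cvgrPdist_lt h|/cvgrPdist_lt h]; apply/cvgrPdist_lt => e e0.
  have e0' : (0 : R[i]) < e%:C by rewrite ltcR.
  near=> t; rewrite sub0r normrN ger0_norm ?nrm_ge0 // nrmBC -ltcR -nrmE.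
  by near: t; apply: h.
have [r r0 ->] := gtC0_Re e0.
near=> t; rewrite nrmE ltcR nrmBC -[nrm _]subr0 -(ger0_norm (nrm_ge0 _)).
have -> : `|nrm (u t - l)| - 0 = `|0 - nrm (u t - l)|.
  by rewrite sub0r normrN subr0.
by near: t; apply: h.
Unshelve. all: by end_near.
Qed.

Lemma cvg_nrmP (u : nat -> V) (l : V) :
  u @ \oo --> l <->
  forall e : R, 0 < e -> exists N, forall k, (N <= k)%N -> nrm (u k - l) < e.
Proof.
rewrite cvg_nrm; split=> [/cvgrPdist_lt h e /h[N _ hN]|h].
  exists N => k /hN /=.
  by rewrite sub0r normrN ger0_norm ?nrm_ge0.
apply/cvgrPdist_lt => e /h[N hN]; exists N => // k /hN /=.
by rewrite sub0r normrN ger0_norm ?nrm_ge0.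
Qed.

Lemma nrm_cauchy_cvg (u : nat -> V) :
  (forall e : R, 0 < e -> exists N, forall m k, (N <= m)%N -> (N <= k)%N ->
     nrm (u m - u k) < e) -> exists l : V, u @ \oo --> l.
Proof.
move=> h; apply/cvg_ex/cauchy_cvgP/cauchy_exP => e e0.
have [r r0 ->] := gtC0_Re e0; have [N hN] := h _ r0.
exists (u N), N => // k Nk /=.
by rewrite -ball_normE /= nrmE ltcR hN.
Qed.

Lemma dense_nrm (D : set V) x (e : R) :
  dense D -> 0 < e -> exists2 d, D d & nrm (x - d) < e.
Proof.
move=> dD e0; have e0' : (0 : R[i]) < e%:C by rewrite ltcR.
have [|d [/= xd Dd]] := dD (ball x e%:C) _ (ball_open x _).
  by exists x; exact: ballxx.
by exists d => //; move: xd; rewrite -ball_normE /= nrmE ltcR.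
Qed.

Lemma cvg_uniq T (F : set_system T) {FF : ProperFilter F} (u : T -> V)
  (l l' : V) : u @ F --> l -> u @ F --> l' -> l = l'.
Proof. exact: (cvg_unique (@norm_hausdorff _ _)). Qed.

End OneSpace.

Lemma cvg_inner V T (F : set_system T) {FF : Filter F} (u v : T -> V)
  (a b : V) : u @ F --> a -> v @ F --> b ->
  '<< u t, v t >> @[t --> F] --> ('<< a, b >> : R[i]^o).
Proof.
move=> /cvg_nrm ua /cvg_nrm vb; apply/(@cvgrPdist_lt _ (R[i]^o)) => e e0.
have [r r0 ->] := gtC0_Re e0.
have c0 : 0 < nrm a + nrm b + 1.
  by rewrite ltr_wpDl // addr_ge0 ?nrm_ge0.
(* The bound 1 makes the product of the two errors linear in [d]; the total error is then at most
   [d * (nrm a + nrm b + 1)], hence at most [r / 2]. *)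
pose d := Num.min 1 (r / (nrm a + nrm b + 1) / 2).
have d0 : 0 < d by rewrite lt_min ltr01 /= !divr_gt0.
move: ua vb => /cvgrPdist_lt/(_ d d0) ua /cvgrPdist_lt/(_ d d0) vb.
near=> t.
have ut : nrm (u t - a) < d.
  have : `|0 - nrm (u t - a)| < d by near: t.
  by rewrite sub0r normrN ger0_norm ?nrm_ge0.
have vt : nrm (v t - b) < d.
  have : `|0 - nrm (v t - b)| < d by near: t.
  by rewrite sub0r normrN ger0_norm ?nrm_ge0.
rewrite cabE ltcR -cabN opprB.
have -> : '<< u t, v t >> - '<< a, b >> =
  '<< u t - a, v t - b >> + '<< u t - a, b >> + '<< a, v t - b >>.
  rewrite !innerBl !innerBr. ring.
apply: le_lt_trans (cabD _ _) _; apply: le_lt_trans (lerD (cabD _ _) (lexx _)) _.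
have h1 := cauchy_schwarz (u t - a) (v t - b).
have h2 := cauchy_schwarz (u t - a) b.
have h3 := cauchy_schwarz a (v t - b).
have d1 : d <= 1 by rewrite ge_min lexx.
have d2 : d <= r / (nrm a + nrm b + 1) / 2 by rewrite ge_min lexx orbT.
have d3 : d * (nrm a + nrm b + 1) <= r / 2.
  by rewrite -ler_pdivlMr // mulrAC.
have h4 : nrm (u t - a) * nrm (v t - b) <= d * 1.
  by rewrite ler_pM ?nrm_ge0 // ltW // (lt_le_trans vt).
have h5 : nrm (u t - a) * nrm b <= d * nrm b.
  by rewrite ler_wpM2r ?nrm_ge0 // ltW.
have h6 : nrm a * nrm (v t - b) <= nrm a * d.
  by rewrite ler_wpM2l ?nrm_ge0 // ltW.
nra.
Unshelve. all: by end_near.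
Qed.

Section Bop.
Variables V W : hilbertType R.
Implicit Type A B : V -> W.

Lemma bop0 A : bop A -> A 0 = 0.
Proof. by case=> /(_ (-1) 0 0); rewrite scaler0 addr0 scaleN1r addNr. Qed.

Lemma bopD A x y : bop A -> A (x + y) = A x + A y.
Proof. by case=> /(_ 1 x y); rewrite !scale1r. Qed.

Lemma bopZ A a x : bop A -> A (a *: x) = a *: A x.
Proof. by move=> bA; have [/(_ a x 0)] := bA; rewrite bop0 // !addr0. Qed.

Lemma bopN A x : bop A -> A (- x) = - A x.
Proof. by move=> bA; rewrite -scaleN1r bopZ // scaleN1r. Qed.

Lemma bopB A x y : bop A -> A (x - y) = A x - A y.
Proof. by move=> bA; rewrite bopD // bopN. Qed.

Lemma bop_sum A I (s : seq I) (P : pred I) (F : I -> V) : bop A ->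
  A (\sum_(i <- s | P i) F i) = \sum_(i <- s | P i) A (F i).
Proof. by move=> bA; elim/big_rec2: _ => [|i y x _ <-]; rewrite ?bop0 ?bopD. Qed.

Lemma bopP A : bop A <->
  linear A /\ exists2 c : R, 0 <= c & forall x, nrm (A x) <= c * nrm x.
Proof.
split=> [bA|[lA [c c0 Ac]]]; last first.
  split=> // x; apply/cvg_nrm.
  apply: (@squeeze_cvgr _ _ _ _ (fun=> 0) (fun t => c * nrm (t - x))).
  - near=> t; rewrite nrm_ge0 /=.
    have -> : A t - A x = A (t - x).
      by have /(_ (-1) x t) := lA; rewrite !scaleN1r addrC => <-; rewrite addrC.
    exact: Ac.
  - exact: cvg_cst.
  - rewrite -[X in _ --> X](mulr0 c); apply: cvgM; first exact: cvg_cst.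
    have : (fun t => t) @ x --> x by [].
    by move=> /cvg_nrm.
split; first by case: bA.
have [_ /(_ 0)] := bA.
rewrite /continuous_at bop0 // => /cvgrPdist_lt /(_ 1 ltr01) /nbhs_ballP.
move=> [e /= e0 He]; have [r r0 er] := gtC0_Re e0; rewrite er in He.
exists (2 / r); first by rewrite divr_ge0 // ltW.
move=> x; have [->|x0] := eqVneq x 0; first by rewrite bop0 // !nrm0 mulr0.
have nx : 0 < nrm x.
  by rewrite lt_def nrm_ge0 andbT; apply: contraNN x0 => /eqP /nrm_eq0 ->.
(* Rescaling [x] to norm [r / 2] puts it in the ball on which [A] stays below 1; this yields the
   bound [2 / r]. *)
pose a := r / 2 / nrm x.
have a0 : 0 < a by rewrite !divr_gt0.
have := He (a%:C *: x); rewrite -ball_normE /= !sub0r !normrN.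
rewrite bopZ // !nrmE !nrmZ cabR !ltcR (gtr0_norm a0).
have -> : a * nrm x = r / 2 by rewrite /a mulfVK // gt_eqF.
rewrite ltr_pdivrMr // ltr_pMr // ltrDl ltr01 => /(_ isT).
rewrite -[a]invrK ltr_pdivrMl ?invr_gt0 // mulr1 => /ltW.
by rewrite /a !invf_div mulrC.
Unshelve. all: by end_near.
Qed.

Lemma bop_opnorm_sup A : bop A ->
  has_sup [set complex.Re `|A x| | x in [set x : V | `|x| <= 1]].
Proof.
move=> /bopP[lA [c c0 Ac]]; split.
  by exists (nrm (A 0)), 0 => //=; rewrite normr0 ler01.
exists c => _ [x /= x1 <-]; apply: le_trans (Ac x) _.
by rewrite ler_piMr // -lecR -nrmE.
Qed.

Lemma opnorm_ge0 A : bop A -> 0 <= opnorm A.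
Proof.
move=> bA; apply: le_trans (nrm_ge0 (A 0)) _.
apply: ub_le_sup; first by have [] := bop_opnorm_sup bA.
by exists 0 => //=; rewrite normr0 ler01.
Qed.

Lemma opnorm_nrm A x : bop A -> nrm (A x) <= opnorm A * nrm x.
Proof.
move=> bA; have [->|x0] := eqVneq x 0; first by rewrite bop0 // !nrm0 mulr0.
have nx : 0 < nrm x.
  by rewrite lt_def nrm_ge0 andbT; apply: contraNN x0 => /eqP /nrm_eq0 ->.
rewrite -ler_pdivrMr //; apply: ub_le_sup; first by have [] := bop_opnorm_sup bA.
exists ((nrm x)^-1%:C *: x) => /=.
  by rewrite nrmE nrmZ cabR ger0_norm ?invr_ge0 ?nrm_ge0 // mulVf ?gt_eqF.
rewrite -/(nrm _) bopZ // nrmZ cabR ger0_norm ?invr_ge0 ?nrm_ge0 //.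
by rewrite mulrC.
Qed.

Lemma opnorm_le A c : bop A -> (forall x, nrm (A x) <= c * nrm x) -> 0 <= c ->
  opnorm A <= c.
Proof.
move=> bA Ac c0; apply: ge_sup; first by have [] := bop_opnorm_sup bA.
move=> _ [x /= x1 <-]; apply: le_trans (Ac x) _.
by rewrite ler_piMr // -lecR -nrmE.
Qed.

Lemma bop_bound A c : linear A -> 0 <= c ->
  (forall x, nrm (A x) <= c * nrm x) -> bop A.
Proof. by move=> lA c0 Ac; apply/bopP; split => //; exists c. Qed.

Lemma cvg_bop A T (F : set_system T) {FF : Filter F} (u : T -> V) l : bop A ->
  u @ F --> l -> A (u t) @[t --> F] --> A l.
Proof. by move=> [_ cA]; apply: continuous_cvg; apply: cA. Qed.

Lemma bop_zero : bop (0 : V -> W).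
Proof.
apply: (@bop_bound _ 0) => // [a x y|x]; first by rewrite scaler0 addr0.
by rewrite mul0r nrm0.
Qed.

Lemma bop_add A B : bop A -> bop B -> bop (A + B).
Proof.
move=> bA bB; apply: (@bop_bound _ (opnorm A + opnorm B)) => [a x y||x].
- rewrite !fctE !bopD // !bopZ // scalerDr addrACA. by [].
- by rewrite addr_ge0 ?opnorm_ge0.
- rewrite mulrDl; apply: le_trans (nrmD _ _) _.
  by rewrite lerD // opnorm_nrm.
Qed.

Lemma bop_scale a A : bop A -> bop (a *: A).
Proof.
move=> bA; apply: (@bop_bound _ (cab a * opnorm A)) => [b x y||x].
- by rewrite !fctE bopD // bopZ // scalerDr !scalerA [a * b]mulrC.
- by rewrite mulr_ge0 ?opnorm_ge0 ?cab_ge0.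
- by rewrite nrmZ -mulrA ler_wpM2l ?cab_ge0 // opnorm_nrm.
Qed.

Lemma bop_opp A : bop A -> bop (- A).
Proof. by move=> /(bop_scale (-1)); rewrite scaleN1r. Qed.

Lemma bop_sub A B : bop A -> bop B -> bop (A - B).
Proof. by move=> bA bB; apply: bop_add => //; apply: bop_opp. Qed.

Lemma bop_bigsum I (s : seq I) (P : pred I) (G : I -> V -> W) :
  (forall i, P i -> bop (G i)) -> bop (\sum_(i <- s | P i) G i).
Proof.
by move=> bG; elim/big_ind: _ => //; [exact: bop_zero|exact: bop_add].
Qed.

Lemma opnorm_add A B : bop A -> bop B -> opnorm (A + B) <= opnorm A + opnorm B.
Proof.
move=> bA bB; apply: opnorm_le; first exact: bop_add.
  move=> x; rewrite mulrDl; apply: le_trans (nrmD _ _) _.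
  by rewrite lerD // opnorm_nrm.
by rewrite addr_ge0 ?opnorm_ge0.
Qed.

Lemma opnorm_scale a A : bop A -> opnorm (a *: A) <= cab a * opnorm A.
Proof.
move=> bA; apply: opnorm_le; first exact: bop_scale.
  by move=> x; rewrite nrmZ -mulrA ler_wpM2l ?cab_ge0 // opnorm_nrm.
by rewrite mulr_ge0 ?opnorm_ge0 ?cab_ge0.
Qed.

Lemma opnorm0 : opnorm (0 : V -> W) = 0.
Proof.
apply/eqP; rewrite eq_le opnorm_ge0 ?andbT; last exact: bop_zero.
by apply: opnorm_le => //; [exact: bop_zero|move=> x; rewrite mul0r nrm0].
Qed.

Lemma bop_eq_dense A B (D : set V) : bop A -> bop B -> dense D ->
  (forall x, D x -> A x = B x) -> A = B.
Proof.
move=> bA bB dD AB; apply/funext => x; apply/subr0_eq/nrm_small => e e0.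
have c0 : 0 < opnorm A + opnorm B + 1.
  by rewrite ltr_wpDl // addr_ge0 ?opnorm_ge0.
have [d Dd xd] := dense_nrm x dD (divr_gt0 e0 c0).
have -> : A x - B x = A (x - d) - B (x - d).
  by rewrite !bopB // (AB d Dd) opprB subrKA.
apply: le_trans (nrmB _ _) _.
apply: le_trans (lerD (opnorm_nrm _ bA) (opnorm_nrm _ bB)) _.
rewrite -mulrDl; move: xd; rewrite ltr_pdivlMr // => /ltW xd.
apply: le_trans xd; rewrite mulrC ler_wpM2l ?nrm_ge0 //.
by rewrite lerDl ler01.
Qed.

End Bop.

Lemma bop_id V : bop (idfun : V -> V).
Proof. by apply: (@bop_bound _ _ _ 1) => // x; rewrite mul1r. Qed.

Lemma bop_comp U V W (A : V -> W) (B : U -> V) : bop A -> bop B -> bop (A \o B).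
Proof.
move=> bA bB; apply: (@bop_bound _ _ _ (opnorm A * opnorm B)) => [a x y||x] /=.
- by rewrite !bopD // !bopZ.
- by rewrite mulr_ge0 ?opnorm_ge0.
- apply: le_trans (opnorm_nrm _ bA) _.
  by rewrite -mulrA ler_wpM2l ?opnorm_ge0 // opnorm_nrm.
Qed.

Lemma opnorm_comp U V W (A : V -> W) (B : U -> V) : bop A -> bop B ->
  opnorm (A \o B) <= opnorm A * opnorm B.
Proof.
move=> bA bB; apply: opnorm_le; first exact: bop_comp.
  move=> x; apply: le_trans (opnorm_nrm _ bA) _.
  by rewrite -mulrA ler_wpM2l ?opnorm_ge0 // opnorm_nrm.
by rewrite mulr_ge0 ?opnorm_ge0.
Qed.

End HilbertSpaces.

(** * Adjoints *)

Section RieszAdjoint.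
Variable R : realType.
Implicit Types U V W : hilbertType R.

Lemma inv_nat_small (e : R) : 0 < e -> exists N, forall k, (N <= k)%N ->
  k.+1%:R^-1 < e.
Proof.
move=> e0; have [N _ hN] := @near_infty_natSinv_lt R (PosNum e0).
by exists N => k /hN.
Qed.

Lemma Re_inner_expand V (x w : V) :
  nrm (x + w) ^+ 2 = nrm x ^+ 2 + 2 * complex.Re '<< w, x >> + nrm w ^+ 2.
Proof.
rewrite !nrm_sqE innerDl !innerDr !raddfD /= [ '<< x, w >> ]innerC Re_conj.
ring.
Qed.

(** When f = <., z>, the functional [J] is |x - z|^2 - |z|^2, so the representing vector is its
    minimiser. A minimising sequence is Cauchy by the parallelogram law, and the first-order
    condition at the limit identifies [f]. *)
Lemma riesz V (f : V -> R[i]) (c : R) :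
  (forall a x y, f (a *: x + y) = a * f x + f y) ->
  (forall x, cab (f x) <= c * nrm x) ->
  exists z, forall x, f x = '<< x, z >>.
Proof.
move=> lf fc.
have f0 : f 0 = 0 by have := lf (-1) 0 0; rewrite scaler0 addr0 mulN1r addNr.
have fD x y : f (x + y) = f x + f y by have := lf 1 x y; rewrite scale1r mul1r.
have fZ a x : f (a *: x) = a * f x by have := lf a x 0; rewrite !addr0 f0 addr0.
pose J x := nrm x ^+ 2 - 2 * complex.Re (f x).
have Jlb x : - c ^+ 2 <= J x.
  have h1 := Re_le_cab (f x); have h2 := fc x.
  have : 0 <= (nrm x - c) ^+ 2 by exact: sqr_ge0.
  rewrite /J; nra.
pose S := [set J x | x in [set: V]].
have hS : has_inf S.
  by split; [exists (J 0), 0|exists (- c ^+ 2) => _ [x _ <-]].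
have Jm x : inf S <= J x by apply: ge_inf; [case: hS|exists x].
have /choice[u hu] : forall k : nat, exists x, J x < inf S + k.+1%:R^-1.
  move=> k; have [|_ [x _ <-] hx] := @inf_adherent _ S k.+1%:R^-1 _ hS.
    by rewrite invr_gt0 ltr0n.
  by exists x.
(* Parallelogram law: the parts of [J] that are linear in the vectors cancel. *)
have par x y : nrm (x - y) ^+ 2 =
    2 * J x + 2 * J y - 4 * J (2^-1%:C *: (x + y)).
  have i2 : 0 <= (2^-1 : R) by rewrite invr_ge0 ler0n.
  rewrite /J nrmZ cabR (ger0_norm i2) fZ fD.
  rewrite exprMn !Re_inner_expand nrmN innerNl raddfN /=.
  have -> : complex.Re (2^-1%:C * (f x + f y)) =
      2^-1 * (complex.Re (f x) + complex.Re (f y)).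
    by case: (f x) (f y) => [a b] [a' b'] /=; rewrite mul0r subr0.
  by field.
have uC : forall e : R, 0 < e -> exists N, forall m k, (N <= m)%N ->
    (N <= k)%N -> nrm (u m - u k) < e.
  move=> e e0; have e20 : 0 < e ^+ 2 / 4 by rewrite divr_gt0 ?exprn_gt0.
  have [N hN] := inv_nat_small e20; exists N => m k Nm Nk.
  rewrite -(@ltr_pXn2r _ 2) // ?nnegrE ?nrm_ge0 ?ltW //.
  have h1 := hu m; have h2 := hu k; have h3 := hN _ Nm; have h4 := hN _ Nk.
  have h5 := Jm (2^-1%:C *: (u m + u k)).
  rewrite par; move: (m.+1%:R^-1) (k.+1%:R^-1) h1 h2 h3 h4 => p q; lra.
have [z /cvg_nrmP uz] := nrm_cauchy_cvg uC; exists z.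
(* Limit of the inequalities [inf S <= J (u k + w)]: the increment of [J] at the minimiser in the
   direction [w] is nonnegative. *)
have key w : 0 <= 2 * complex.Re ('<< w, z >> - f w) + nrm w ^+ 2.
  apply/ler_addgt0Pr => e e0.
  have e1 : 0 < e / 2 by rewrite divr_gt0.
  have d0 : 0 < e / 4 / (nrm w + 1).
    by rewrite !divr_gt0 // ltr_wpDl ?nrm_ge0.
  have [N hN] := inv_nat_small e1; have [M hM] := uz _ d0.
  pose k := maxn N M.
  have h1 := hN k (leq_maxl _ _); have h2 := hM k (leq_maxr _ _).
  have h3 := hu k; have h4 := Jm (u k + w).
  have h5 : complex.Re '<< w, u k >> - complex.Re '<< w, z >> <= e / 4.
    rewrite -raddfB /= -innerBr; apply: le_trans (Re_le_cab _) _.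
    apply: le_trans (cauchy_schwarz _ _) _.
    apply: le_trans (_ : (nrm w + 1) * (e / 4 / (nrm w + 1)) <= _).
      by rewrite ler_pM ?nrm_ge0 ?lerDl // ltW.
    by rewrite mulrC divfK // gt_eqF // ltr_wpDl ?nrm_ge0.
  have h6 : J (u k) < inf S + e / 2 by apply: lt_trans h3 _; rewrite ltrD2l.
  clear h1 h2 h3 d0; move: h4 h6.
  rewrite /J Re_inner_expand fD raddfB raddfD /=.
  lra.
move=> x; set g := '<< x, z >> - f x.
suff g0 : cab g = 0 by apply/esym/subr0_eq/cab_eq0.
(* In the direction - s conj(g) x the linear term of [key] is - 2 s |g|^2, against a quadratic term
   of order s^2. *)
have h s : 0 < s -> 2 * cab g ^+ 2 <= s * (cab g ^+ 2 * nrm x ^+ 2).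
  move=> s0; have := key ((- s%:C * Num.conj g) *: x).
  rewrite innerZl fZ -mulrBr -/g nrmZ cabM cabN cabR gtr0_norm // cab_conj.
  have -> : - s%:C * Num.conj g * g = (- (s * cab g ^+ 2))%:C.
    by rewrite rmorphN rmorphM /= -cab_sq; ring.
  rewrite !exprMn /= => hs; rewrite -(ler_pM2l s0); nra.
apply/eqP; rewrite -sqrf_eq0 eq_le sqr_ge0 andbT.
have c0 : 0 < nrm x ^+ 2 + 1 by rewrite ltr_wpDl ?sqr_ge0.
(* At this value of [s] the right-hand side is at most |g|^2, which forces g = 0. *)
have := h (nrm x ^+ 2 + 1)^-1; rewrite invr_gt0 => /(_ c0).
have h2 : 0 <= cab g ^+ 2 by rewrite sqr_ge0.
have h3 : 0 <= nrm x ^+ 2 by rewrite sqr_ge0.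
move: (cab g ^+ 2) (nrm x ^+ 2) c0 h2 h3 => a b c0 h2 h3 h4.
have : (b + 1)^-1 * (a * b) <= a.
  by rewrite mulrC ler_pdivrMr // ler_wpM2l // lerDl.
by move=> h5; lra.
Qed.

Section Adj.
Variables V W : hilbertType R.
Implicit Types (A : V -> W) (B : W -> V).

Lemma adj_exists A : bop A ->
  exists B, bop B /\ forall x y, '<< A x, y >> = '<< x, B y >>.
Proof.
move=> bA.
have /choice[B hB] : forall y, exists z, forall x, '<< A x, y >> = '<< x, z >>.
  move=> y; apply: (@riesz _ _ (opnorm A * nrm y)) => [a x x'|x].
    by rewrite bopD // bopZ // innerDl innerZl.
  apply: le_trans (cauchy_schwarz _ _) _.
  by rewrite mulrAC ler_wpM2r ?nrm_ge0 // opnorm_nrm.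
exists B; split=> [|x y]; last exact: hB.
apply: (@bop_bound _ _ _ _ (opnorm A)) => [a x y||y].
- apply: inner_inj => z; rewrite innerDl innerZl innerC -hB innerDr innerZr.
  by rewrite rmorphD rmorphM /= !hB -!innerC conjCK.
- exact: opnorm_ge0.
- have [->|n0] := eqVneq (nrm (B y)) 0.
    by rewrite mulr_ge0 ?opnorm_ge0 ?nrm_ge0.
  have np : 0 < nrm (B y) by rewrite lt_def n0 nrm_ge0.
  rewrite -(ler_pM2l np) -expr2 nrm_sqE -hB.
  apply: le_trans (Re_le_cab _) _; apply: le_trans (cauchy_schwarz _ _) _.
  rewrite mulrA ler_wpM2r ?nrm_ge0 // mulrC.
  exact: opnorm_nrm.
Qed.

Lemma adj_spec A : bop A ->
  bop (adj A) /\ forall x y, '<< A x, y >> = '<< x, adj A y >>.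
Proof. by move=> /adj_exists /xgetPex; apply. Qed.

Lemma adj_bop A : bop A -> bop (adj A).
Proof. by move=> /adj_spec[]. Qed.

Lemma adjE A x y : bop A -> '<< A x, y >> = '<< x, adj A y >>.
Proof. by move=> /adj_spec[]. Qed.

Lemma adjEr A x y : bop A -> '<< y, A x >> = '<< adj A y, x >>.
Proof. by move=> bA; rewrite innerC adjE // -innerC. Qed.

Lemma adj_uniq A B : bop A ->
  (forall x y, '<< A x, y >> = '<< x, B y >>) -> adj A = B.
Proof.
move=> bA AB; apply/funext => y; apply: inner_inj => x.
by rewrite innerC -adjE // AB -innerC.
Qed.

Lemma adj_add A A' : bop A -> bop A' -> adj (A + A') = adj A + adj A'.
Proof.
move=> bA bA'; apply: adj_uniq; first exact: bop_add.
by move=> x y; rewrite !fctE innerDl innerDr !adjE.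
Qed.

Lemma adj_scale a A : bop A -> adj (a *: A) = Num.conj a *: adj A.
Proof.
move=> bA; apply: adj_uniq; first exact: bop_scale.
by move=> x y; rewrite !fctE innerZl innerZr adjE // conjCK.
Qed.

Lemma adj_zero : adj (0 : V -> W) = 0.
Proof.
apply: adj_uniq; first exact: bop_zero.
by move=> x y; rewrite inner0l inner0r.
Qed.

Lemma adj_sum I (s : seq I) (P : pred I) (G : I -> V -> W) :
  (forall i, bop (G i)) ->
  adj (\sum_(i <- s | P i) G i) = \sum_(i <- s | P i) adj (G i).
Proof.
move=> bG; elim: s => [|i s IH]; first by rewrite !big_nil adj_zero.
rewrite !big_cons; case: ifP => // _; rewrite adj_add ?IH //.
by apply: bop_bigsum.
Qed.

Lemma opnorm_adj_le A : bop A -> opnorm (adj A) <= opnorm A.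
Proof.
move=> bA; apply: opnorm_le; [exact: adj_bop| |exact: opnorm_ge0].
move=> y; have [->|n0] := eqVneq (nrm (adj A y)) 0.
  by rewrite mulr_ge0 ?opnorm_ge0 ?nrm_ge0.
have np : 0 < nrm (adj A y) by rewrite lt_def n0 nrm_ge0.
rewrite -(ler_pM2l np) -expr2 nrm_sqE -adjE //.
apply: le_trans (Re_le_cab _) _; apply: le_trans (cauchy_schwarz _ _) _.
rewrite mulrA ler_wpM2r ?nrm_ge0 // mulrC.
exact: opnorm_nrm.
Qed.

End Adj.

Lemma adjK V W (A : V -> W) : bop A -> adj (adj A) = A.
Proof.
move=> bA; apply: adj_uniq; first exact: adj_bop.
by move=> x y; rewrite innerC -adjE // -innerC.
Qed.

Lemma opnorm_adj V W (A : V -> W) : bop A -> opnorm (adj A) = opnorm A.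
Proof.
move=> bA; apply/eqP; rewrite eq_le opnorm_adj_le //=.
by rewrite -{1}(adjK bA) opnorm_adj_le //; apply: adj_bop.
Qed.

Lemma adj_comp U V W (A : V -> W) (B : U -> V) : bop A -> bop B ->
  adj (A \o B) = adj B \o adj A.
Proof.
move=> bA bB; apply: adj_uniq; first exact: bop_comp.
by move=> x y /=; rewrite !adjE.
Qed.

Lemma adj_id V : adj (idfun : V -> V) = idfun.
Proof. by apply: adj_uniq; first exact: bop_id. Qed.

Lemma nrm_opE V W (A : V -> W) x : bop A ->
  nrm (A x) ^+ 2 = complex.Re '<< adj A (A x), x >>.
Proof. by move=> bA; rewrite nrm_sqE adjE // innerC Re_conj. Qed.

End RieszAdjoint.

(** * Norm limits of operators and extension from dense subspaces *)

Section Completeness.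
Variable R : realType.
Implicit Types U V W : hilbertType R.

Lemma op_cvgP V W (u : nat -> V -> W) (L : V -> W) :
  (opnorm (u N - L) @[N --> \oo] --> (0 : R)) <->
  (forall e : R, 0 < e -> exists N, forall k, (N <= k)%N ->
     `|opnorm (u k - L)| < e).
Proof.
split=> [/cvgrPdist_lt h e /h[N _ hN]|h].
  by exists N => k /hN /=; rewrite sub0r normrN.
apply/cvgrPdist_lt => e /h[N hN]; exists N => // k /hN /=.
by rewrite sub0r normrN.
Qed.

Lemma op_cvg_uniq V W (u : nat -> V -> W) (L L' : V -> W) :
  (forall N, bop (u N)) -> bop L -> bop L' ->
  opnorm (u N - L) @[N --> \oo] --> (0 : R) ->
  opnorm (u N - L') @[N --> \oo] --> (0 : R) -> L = L'.
Proof.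
move=> bu bL bL' /op_cvgP h /op_cvgP h'; apply/funext => x.
apply/subr0_eq/nrm_small => e e0.
have d0 : 0 < e / 2 / (nrm x + 1) by rewrite !divr_gt0 // ltr_wpDl ?nrm_ge0.
have [N hN] := h _ d0; have [M hM] := h' _ d0.
pose k := maxn N M.
have h1 := hN k (leq_maxl _ _); have h2 := hM k (leq_maxr _ _).
have b1 := bop_sub (bu k) bL; have b2 := bop_sub (bu k) bL'.
have g1 := opnorm_nrm x b1; have g2 := opnorm_nrm x b2.
move: h1 h2; rewrite !ger0_norm ?opnorm_ge0 // => h1 h2.
have -> : L x - L' x = (u k - L') x - (u k - L) x.
  by rewrite !fctE opprB addrC subrKA.
apply: le_trans (nrmB _ _) _.
have n0 := nrm_ge0 x.
move: h1 h2; rewrite !ltr_pdivlMr ?ltr_wpDl // => h1 h2.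
have o1 := opnorm_ge0 b1; have o2 := opnorm_ge0 b2.
nra.
Qed.

Lemma oplimE V W (u : nat -> V -> W) (L : V -> W) :
  (forall N, bop (u N)) -> bop L ->
  opnorm (u N - L) @[N --> \oo] --> (0 : R) -> oplim u = L.
Proof.
move=> bu bL uL; have [bl ul] : bop (oplim u) /\
    opnorm (u N - oplim u) @[N --> \oo] --> (0 : R).
  have /(@xgetPex _ (0 : V -> W)) : exists L, bop L /\
    opnorm (u N - L) @[N --> \oo] --> (0 : R) by exists L.
  by [].
exact: (op_cvg_uniq bu).
Qed.

Lemma op_cvg_pt V W (u : nat -> V -> W) (L : V -> W) x :
  (forall N, bop (u N)) -> bop L ->
  opnorm (u N - L) @[N --> \oo] --> (0 : R) -> u N x @[N --> \oo] --> L x.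
Proof.
move=> bu bL uL; apply/cvg_nrm.
apply: (@squeeze_cvgr _ _ _ _ (fun=> 0) (fun N => opnorm (u N - L) * nrm x)).
- near=> N; rewrite nrm_ge0 /=.
  exact: (opnorm_nrm x (bop_sub (bu N) bL)).
- exact: cvg_cst.
- by rewrite -[X in _ --> X](mul0r (nrm x)); apply: cvgM => //; exact: cvg_cst.
Unshelve. all: by end_near.
Qed.

(** The limit is built pointwise. Letting one index tend to infinity in the Cauchy estimate bounds
    the distance to it by a multiple of |x|, which gives both boundedness and norm convergence. *)
Lemma op_cauchy_cvg V W (u : nat -> V -> W) :
  (forall N, bop (u N)) ->
  (forall e : R, 0 < e -> exists N, forall m k, (N <= m)%N -> (N <= k)%N ->
     opnorm (u m - u k) < e) ->
  exists2 L, bop L & opnorm (u N - L) @[N --> \oo] --> (0 : R).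
Proof.
move=> bu uC.
have uCx x e : 0 < e -> exists N, forall m k, (N <= m)%N -> (N <= k)%N ->
    nrm (u m x - u k x) < e.
  move=> e0; have d0 : 0 < e / (nrm x + 1).
    by rewrite !divr_gt0 // ltr_wpDl ?nrm_ge0.
  have [N hN] := uC _ d0; exists N => m k Nm Nk.
  apply: le_lt_trans (opnorm_nrm x (bop_sub (bu m) (bu k))) _.
  have := hN _ _ Nm Nk; rewrite ltr_pdivlMr ?ltr_wpDl ?nrm_ge0 //.
  apply: le_lt_trans; rewrite ler_wpM2l ?lerDl //.
  by apply/opnorm_ge0/bop_sub.
have /choice[L hL] : forall x, exists l : W, u N x @[N --> \oo] --> l.
  by move=> x; apply: nrm_cauchy_cvg => e /(uCx x).
have lL : linear L.
  move=> a x y; apply: (@cvg_uniq _ _ _ \oo _ (fun N => u N (a *: x + y))) => //.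
  have -> : (fun N => u N (a *: x + y)) = (fun N => a *: u N x + u N y).
    by apply/funext => N; rewrite bopD // bopZ.
  by apply: cvgD => //; apply: cvgZr.
have close e : 0 < e -> exists N, forall k x, (N <= k)%N ->
    nrm (u k x - L x) <= e * nrm x.
  move=> e0; have [N hN] := uC _ e0; exists N => k x Nk.
  apply/ler_addgt0Pr => d d0; have /cvg_nrmP/(_ _ d0)[M hM] := hL x.
  pose m := maxn N M.
  have h1 := hM m (leq_maxr _ _); have h2 := hN k m Nk (leq_maxl _ _).
  apply: le_trans (nrm_triangle _ (u m x) _) _.
  rewrite lerD //; last exact: ltW.
  apply: le_trans (opnorm_nrm x (bop_sub (bu k) (bu m))) _.
  by rewrite ler_wpM2r ?nrm_ge0 // ltW.
have bL : bop L.
  have [N /(_ N _ (leqnn N)) hN] := close 1 ltr01.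
  apply: (@bop_bound _ _ _ _ (opnorm (u N) + 1)) => // [|x].
    by rewrite addr_ge0 ?opnorm_ge0.
  have -> : L x = u N x - (u N x - L x) by rewrite opprB addrC subrK.
  apply: le_trans (nrmB _ _) _; rewrite mulrDl lerD //; exact: opnorm_nrm.
exists L => //; apply/op_cvgP => e e0.
have e20 : 0 < e / 2 by rewrite divr_gt0.
have [N hN] := close _ e20; exists N => k Nk.
have bk := bop_sub (bu k) bL.
rewrite ger0_norm ?opnorm_ge0 //.
apply: (@le_lt_trans _ _ (e / 2)); last by rewrite ltr_pdivrMr // ltr_pMr // ltrDl.
by apply: opnorm_le => // [x|]; [exact: hN|exact: ltW].
Qed.

(** The operator is given as a linear relation because its arguments, finite sums of elementary
    tensors or of basis vectors, have many representations. The bound makes the closure [P] of the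
    relation single-valued, and completeness makes it total. *)
Lemma extend_graph V W (G : V -> W -> Prop) (c : R) : 0 <= c ->
  (forall a v w v' w', G v w -> G v' w' -> G (a *: v + v') (a *: w + w')) ->
  (forall v w, G v w -> nrm w <= c * nrm v) ->
  dense [set v | exists w, G v w] ->
  exists A : V -> W, [/\ bop A, forall v w, G v w -> A v = w &
    forall v, nrm (A v) <= c * nrm v].
Proof.
move=> c0 GL Gc Gd.
pose P v w := forall e, 0 < e -> exists v' w',
  [/\ G v' w', nrm (v - v') < e & nrm (w - w') < e].
have GB v w v' w' : G v w -> G v' w' -> G (v - v') (w - w').
  by move=> g g'; have := GL (-1) _ _ _ _ g' g; rewrite !scaleN1r ![- _ + _]addrC.
have Pc v w : P v w -> nrm w <= c * nrm v.
  move=> Pvw; apply/ler_addgt0Pr => e e0.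
  have d0 : 0 < e / (c + 1) by rewrite divr_gt0 // ltr_wpDl.
  have [v' [w' [g vv ww]]] := Pvw _ d0.
  have h1 : nrm w <= nrm (w - w') + nrm w'.
    by apply: le_trans (nrmD _ _); rewrite subrK.
  have h2 : nrm v' <= nrm (v - v') + nrm v.
    by rewrite nrmBC; apply: le_trans (nrmD _ _); rewrite subrK.
  have h3 := Gc _ _ g.
  have h4 : e / (c + 1) * (c + 1) = e by rewrite divfK // gt_eqF // ltr_wpDl.
  have h5 : c * nrm v' <= c * (nrm (v - v') + nrm v) by rewrite ler_wpM2l.
  have h6 : c * nrm (v - v') <= c * (e / (c + 1)) by rewrite ler_wpM2l // ltW.
  move: vv ww h1 h3 h4 h5 h6; move: (e / (c + 1)) => d; nra.
have PL a v w v' w' : P v w -> P v' w' -> P (a *: v + v') (a *: w + w').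
  move=> h h' e e0.
  have d0 : 0 < e / 2 / (cab a + 1).
    by rewrite !divr_gt0 // ltr_wpDl ?cab_ge0.
  have e20 : 0 < e / 2 by rewrite divr_gt0.
  have [x [y [g xv yw]]] := h _ d0; have [x' [y' [g' xv' yw']]] := h' _ e20.
  have bd (Z : hilbertType R) (z z1 z' z1' : Z) :
      nrm (z - z1) < e / 2 / (cab a + 1) -> nrm (z' - z1') < e / 2 ->
      nrm (a *: z + z' - (a *: z1 + z1')) < e.
    move=> q q'; have -> : a *: z + z' - (a *: z1 + z1') =
        a *: (z - z1) + (z' - z1') by rewrite scalerBr opprD addrACA.
    apply: le_lt_trans (nrmD _ _) _; rewrite nrmZ.
    have n0 := nrm_ge0 (z - z1); have a0 := cab_ge0 a.
    move: q; rewrite ltr_pdivlMr ?ltr_wpDl // => q.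
    nra.
  exists (a *: x + x'), (a *: y + y'); split; first exact: GL.
    exact: bd.
  exact: bd.
have Pex v : exists w, P v w.
  have /choice[u hu] : forall k : nat, exists p : V * W, G p.1 p.2 /\
      nrm (v - p.1) < k.+1%:R^-1.
    move=> k; have k0 : 0 < k.+1%:R^-1 :> R by rewrite invr_gt0 ltr0n.
    by have [x [w g] xv] := dense_nrm v Gd k0; exists (x, w).
  have [|w /cvg_nrmP hw] := @nrm_cauchy_cvg _ _ (fun k => (u k).2).
    move=> e e0; have d0 : 0 < e / 2 / (c + 1).
      by rewrite !divr_gt0 // ltr_wpDl.
    have [N hN] := inv_nat_small d0; exists N => m k Nm Nk.
    have [gm um] := hu m; have [gk uk] := hu k.
    have h1 := Gc _ _ (GB _ _ _ _ gm gk).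
    apply: le_lt_trans h1 _.
    have h2 := nrm_triangle (u m).1 v (u k).1; rewrite [nrm (_ - v)]nrmBC in h2.
    have h3 := hN _ Nm; have h4 := hN _ Nk.
    have h6 : e / 2 / (c + 1) * (c + 1) = e / 2.
      by rewrite divfK // gt_eqF // ltr_wpDl.
    have h7 := nrm_ge0 ((u m).1 - (u k).1).
    move: h3 h4 h6 d0; move: (e / 2 / (c + 1)) => d h3 h4 h6 d0.
    have h5 : nrm ((u m).1 - (u k).1) < 2 * d.
      have := lt_trans um h3; have := lt_trans uk h4; lra.
    apply: (@le_lt_trans _ _ (c * (2 * d))); first by rewrite ler_wpM2l // ltW.
    by nra.
  exists w => e e0; have [N hN] := inv_nat_small e0.
  have [M hM] := hw _ e0; pose k := maxn N M; have [gk uk] := hu k.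
  exists (u k).1, (u k).2; split => //.
    by apply: lt_trans uk _; apply: hN; rewrite leq_maxl.
  by rewrite nrmBC; apply: hM; rewrite leq_maxr.
have /choice[A hA] := Pex.
have GP v w : G v w -> P v w.
  by move=> g e e0; exists v, w; rewrite !subrr !nrm0.
have Puniq v w w' : P v w -> P v w' -> w = w'.
  move=> h h'; apply/subr0_eq/nrm_eq0/eqP; rewrite eq_le nrm_ge0 andbT.
  have := Pc _ _ (PL (-1) _ _ _ _ h' h).
  by rewrite !scaleN1r addNr nrm0 mulr0 addrC.
have lA : linear A by move=> a x y; apply: (Puniq _ _ _ (hA _)); apply: PL.
exists A; split.
- by apply: (bop_bound lA c0) => x; apply: Pc.
- by move=> v w /GP; apply: Puniq.
- by move=> v; apply: Pc.
Qed.

End Completeness.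

(** * Hilbert tensor products *)

Section GramSchmidt.
Variable R : realType.
Implicit Types V W : hilbertType R.

(** Only the values below [m] matter; indexing by [nat] lets the family grow without casting
    ordinals. *)
Definition orthon W m (f : nat -> W) : Prop :=
  forall i j, (i < m)%N -> (j < m)%N -> '<< f i, f j >> = (i == j)%:R.

Lemma inner_comb W m (f : nat -> W) (c : nat -> R[i]) j : orthon m f ->
  (j < m)%N -> '<< \sum_(i < m) c i *: f i, f j >> = c j.
Proof.
move=> of_ jm; rewrite inner_suml (bigD1 (Ordinal jm)) //= big1 => [|i ij].
  by rewrite innerZl of_ // eqxx mulr1 addr0.
rewrite innerZl of_ // (_ : (i : nat) == j = false) ?mulr0 //.
by apply: contraNF ij => /eqP ij; apply/eqP/val_inj.
Qed.

Lemma orthon_extend W m (f : nat -> W) y : orthon m f ->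
  (exists c : nat -> R[i], y = \sum_(i < m) c i *: f i) \/
  exists g, [/\ orthon m.+1 g, forall i, (i < m)%N -> g i = f i &
    exists c : nat -> R[i], y = \sum_(i < m.+1) c i *: g i].
Proof.
move=> of_.
pose r := y - \sum_(i < m) '<< y, f i >> *: f i.
have rf j : (j < m)%N -> '<< r, f j >> = 0.
  by move=> jm; rewrite innerBl (inner_comb (fun i => '<< y, f i >>)) // subrr.
have [r0|r0] := eqVneq (nrm r) 0.
  by left; exists (fun i => '<< y, f i >>); apply/subr0_eq/nrm_eq0.
right; exists (fun i => if (i < m)%N then f i else (nrm r)^-1%:C *: r); split.
- move=> i j; rewrite !ltnS => im jm.
  have [im'|mi] := ltnP i m; have [jm'|mj] := ltnP j m.
  + exact: of_.
  + rewrite innerZr innerC rf // conjC0 mulr0.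
    by rewrite (_ : i == j = false) //; apply/ltn_eqF/(leq_trans im').
  + rewrite innerZl rf // mulr0.
    by rewrite (_ : i == j = false) //; apply/gtn_eqF/(leq_trans jm').
  + rewrite innerZl innerZr conjR inner_nrm -!rmorphM /=.
    have -> : i == j by rewrite eqn_leq (leq_trans im) ?(leq_trans jm).
    by rewrite expr2 mulKf // mulVf.
- by move=> i ->.
exists (fun i => if (i < m)%N then '<< y, f i >> else (nrm r)%:C).
rewrite big_ord_recr /= ltnn scalerA -rmorphM /= divff // scale1r.
rewrite (eq_bigr (fun i : 'I_m => '<< y, f i >> *: f i)).
  by rewrite addrC subrK.
by move=> i _; rewrite ltn_ord.
Qed.

Lemma gram_schmidt W (s : seq W) : exists m (f : nat -> W), orthon m f /\
  forall y, y \in s -> exists c : nat -> R[i], y = \sum_(i < m) c i *: f i.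
Proof.
elim: s => [|y s [m [f [of_ fs]]]]; first by exists 0%N, (fun=> 0).
have [yf|[g [og gf yg]]] := orthon_extend y of_.
  by exists m, f; split => // z; rewrite inE => /predU1P[->|/fs].
exists m.+1, g; split=> // z; rewrite inE => /predU1P[->//|/fs[c zc]].
exists (fun i => if (i < m)%N then c i else 0).
rewrite big_ord_recr /= ltnn scale0r addr0 zc; apply: eq_bigr => i _.
by rewrite ltn_ord gf.
Qed.

(** A family of length [m] that cannot be extended spans the space. The families obtained here carry
    the weighted shifts that recover coefficients. *)
Lemma infinite_orthon W : infinite_dimensional W ->
  forall m, exists f : nat -> W, orthon m f.
Proof.
move=> iW; elim=> [|m [f of_]]; first by exists (fun=> 0).
apply: contrapT => nog; apply: iW; exists m, (fun i => f i) => x.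
have [[c ->]|[g [og _ _]]] := orthon_extend x of_; first by exists c.
by exfalso; apply: nog; exists g.
Qed.

Definition bilin V W (Z : lmodType R[i]) (b : V -> W -> Z) : Prop :=
  (forall a x x' y, b (a *: x + x') y = a *: b x y + b x' y) /\
  (forall a x y y', b x (a *: y + y') = a *: b x y + b x y').

Section Bilin.
Variables (V W : hilbertType R) (Z : lmodType R[i]) (b : V -> W -> Z).
Hypothesis bb : bilin b.

Lemma bilinDl x x' y : b (x + x') y = b x y + b x' y.
Proof. by have /(_ 1 x x' y) := bb.1; rewrite !scale1r. Qed.

Lemma bilinDr x y y' : b x (y + y') = b x y + b x y'.
Proof. by have /(_ 1 x y y') := bb.2; rewrite !scale1r. Qed.

Lemma bilin0l y : b 0 y = 0.
Proof. by have /(_ (-1) 0 0 y) := bb.1; rewrite scaler0 addr0 scaleN1r addNr. Qed.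

Lemma bilin0r x : b x 0 = 0.
Proof. by have /(_ (-1) x 0 0) := bb.2; rewrite scaler0 addr0 scaleN1r addNr. Qed.

Lemma bilinZl a x y : b (a *: x) y = a *: b x y.
Proof. by have /(_ a x 0 y) := bb.1; rewrite bilin0l !addr0. Qed.

Lemma bilinZr a x y : b x (a *: y) = a *: b x y.
Proof. by have /(_ a x y 0) := bb.2; rewrite bilin0r !addr0. Qed.
Lemma bilin_sumr I (s : seq I) (P : pred I) (F : I -> W) x :
  b x (\sum_(i <- s | P i) F i) = \sum_(i <- s | P i) b x (F i).
Proof. by elim/big_rec2: _ => [|i z y _ <-]; rewrite ?bilin0r ?bilinDr. Qed.

End Bilin.

Lemma bilin_swap V W (Z : lmodType R[i]) (b : V -> W -> Z) :
  bilin b -> bilin (fun y x => b x y).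
Proof. by case. Qed.

(** Gram-Schmidt on the second factors. The new first factors [x] do not depend on [b], so one
    decomposition serves several bilinear maps, and the common list [L] lets several sums share the
    same orthonormal system. *)
Lemma orthon_decomp W (L : seq W) :
  exists m (f : nat -> W), orthon m f /\
  forall V (s : seq (V * W)), (forall p, p \in s -> p.2 \in L) ->
  exists x : nat -> V, forall (Z : lmodType R[i]) (b : V -> W -> Z), bilin b ->
    \sum_(p <- s) b p.1 p.2 = \sum_(i < m) b (x i) (f i).
Proof.
have [m [f [of_ fs]]] := gram_schmidt L.
exists m, f; split=> // V; elim=> [|p s IH] sL.
  exists (fun=> 0) => Z b bb; rewrite big_nil big1 // => i _.
  exact: bilin0l.
have [|x hx] := IH; first by move=> q qs; apply: sL; rewrite inE qs orbT.
have [|c pc] := fs p.2; first by apply: sL; rewrite inE eqxx.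
exists (fun i => c i *: p.1 + x i) => Z b bb.
rewrite big_cons hx // pc (bilin_sumr bb) -big_split /=; apply: eq_bigr => i _.
by rewrite (bilinDl bb) (bilinZl bb) (bilinZr bb).
Qed.

Lemma bilin_comp V V' W W' (Z : lmodType R[i]) (b : V' -> W' -> Z)
  (A : V -> V') (B : W -> W') : bilin b -> bop A -> bop B ->
  bilin (fun x y => b (A x) (B y)).
Proof.
move=> bb bA bB; split=> [a x x' y|a x y y'].
  by rewrite bopD // bopZ // (bilinDl bb) (bilinZl bb).
by rewrite bopD // bopZ // (bilinDr bb) (bilinZr bb).
Qed.

End GramSchmidt.

(** * Bilinear maps with the inner products of a tensor product *)

Section TensorLike.
Variable R : realType.
Implicit Types V W Z : hilbertType R.

(** Besides [tens] itself this covers the tensor product with its factors exchanged and the map (x,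
    z) -> J x z from which the associator is built. *)
Definition tlike V W Z (b : V -> W -> Z) : Prop := bilin b /\
  forall x x' y y', '<< b x y, b x' y' >> = '<< x, x' >> * '<< y, y' >>.

Lemma tlike_swap V W Z (b : V -> W -> Z) : tlike b -> tlike (fun y x => b x y).
Proof. by move=> [/bilin_swap bb h]; split => // x x' y y'; rewrite h mulrC. Qed.

Lemma nrm_tlike V W Z (b : V -> W -> Z) x y : tlike b ->
  nrm (b x y) = nrm x * nrm y.
Proof.
move=> [_ h]; apply/eqP; rewrite -(@eqrXn2 _ 2) ?mulr_ge0 ?nrm_ge0 //.
by apply/eqP/complexI; rewrite -inner_nrm h !inner_nrm -rmorphM exprMn.
Qed.

Lemma nrm_orthon_sum V W Z (b : V -> W -> Z) m (f : nat -> W) (x : nat -> V) :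
  tlike b -> orthon m f ->
  nrm (\sum_(i < m) b (x i) (f i)) ^+ 2 = \sum_(i < m) nrm (x i) ^+ 2.
Proof.
move=> [_ h] of_; apply: complexI; rewrite -inner_nrm rmorph_sum /=.
rewrite inner_suml; apply: eq_bigr => i _; rewrite inner_sumr (bigD1 i) //=.
rewrite big1 => [|j ji]; rewrite h of_ //.
  by rewrite eqxx mulr1 addr0 inner_nrm.
by rewrite (_ : (i : nat) == j = false) ?mulr0 // eq_sym; apply: negbTE.
Qed.

(** With orthonormal second factors both squared norms become sums of squares over the first
    factors, and the bound on [A] applies term by term. *)
Lemma tlike_op_bound V V' W Z Z' (b : V -> W -> Z) (b' : V' -> W -> Z')
  (A : V -> V') (c : R) (s : seq (V * W)) : tlike b -> tlike b' -> bop A ->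
  0 <= c -> (forall x, nrm (A x) <= c * nrm x) ->
  nrm (\sum_(p <- s) b' (A p.1) p.2) <= c * nrm (\sum_(p <- s) b p.1 p.2).
Proof.
move=> tb tb' bA c0 Ac.
have [m [f [of_ dec]]] := orthon_decomp [seq p.2 | p <- s].
have [|x hx] := dec V s; first by move=> p ps; apply: map_f.
rewrite (hx _ b tb.1) (hx _ (fun x y => b' (A x) y)); last first.
  split=> [a u u' y|a u y y']; first by rewrite bopD // bopZ // tb'.1.1.
  by rewrite tb'.1.2.
rewrite -(@ler_pXn2r _ 2) // ?nnegrE ?mulr_ge0 ?nrm_ge0 //.
rewrite exprMn (nrm_orthon_sum _ tb of_).
rewrite (nrm_orthon_sum (fun i => A (x i)) tb' of_).
rewrite mulr_sumr; apply: ler_sum => i _.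
by rewrite -exprMn ler_pXn2r // ?nnegrE ?mulr_ge0 ?nrm_ge0.
Qed.

End TensorLike.

Section Tensor.
Variables (R : realType) (T : hilbert_tensor R).
Implicit Types U V W Z : hilbertType R.

Local Notation tn := (tens T _ _).

Lemma tens_tlike V W : tlike (tens T V W).
Proof.
split; last exact: tens_inner.
split=> [a x x' y|a x y y']; first by rewrite linearDl linearZl_LR.
by rewrite linearDr linearZr_LR.
Qed.

Lemma tens_bilin V W : bilin (tens T V W).
Proof. by have [] := tens_tlike V W. Qed.

Lemma nrm_tens V W (x : V) (y : W) : nrm (tn x y) = nrm x * nrm y.
Proof. exact/nrm_tlike/tens_tlike. Qed.

Lemma bop_eq_tens V W Z (A B : tprod T V W -> Z) : bop A -> bop B ->
  (forall x y, A (tn x y) = B (tn x y)) -> A = B.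
Proof.
move=> bA bB AB; apply: (bop_eq_dense bA bB (@tens_total _ T V W)) => z [s ->].
by rewrite !bop_sum //; apply: eq_bigr.
Qed.

Lemma tens_inner_inj V W (z z' : tprod T V W) :
  (forall x y, '<< z, tn x y >> = '<< z', tn x y >>) -> z = z'.
Proof.
move=> h; apply/subr0_eq.
have : forall x y, '<< z - z', tn x y >> = 0 by move=> x y; rewrite innerBl h subrr.
move: (z - z') => d {}h; apply/nrm_small => e e0.
have [_ [s ->] ds] := dense_nrm d (@tens_total _ T V W) e0.
have dd : '<< d, d >> = '<< d, d - \sum_(p <- s) tn p.1 p.2 >>.
  by rewrite innerBr inner_sumr big1 ?subr0.
have [->|n0] := eqVneq (nrm d) 0; first exact: ltW.
have np : 0 < nrm d by rewrite lt_def n0 nrm_ge0.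
rewrite -(ler_pM2l np) -expr2 nrm_sqE dd.
apply: le_trans (Re_le_cab _) _; apply: le_trans (cauchy_schwarz _ _) _.
by rewrite ler_wpM2l ?nrm_ge0 // ltW.
Qed.

Lemma extend_tens V W Z (b : V -> W -> Z) (c : R) : bilin b -> 0 <= c ->
  (forall s : seq (V * W),
     nrm (\sum_(p <- s) b p.1 p.2) <= c * nrm (\sum_(p <- s) tn p.1 p.2)) ->
  exists C : tprod T V W -> Z, [/\ bop C, forall x y, C (tn x y) = b x y &
    forall z, nrm (C z) <= c * nrm z].
Proof.
move=> bb c0 hb.
pose G z z' := exists s : seq (V * W), z = \sum_(p <- s) tn p.1 p.2 /\
  z' = \sum_(p <- s) b p.1 p.2.
have [|||C [bC CG Cc]] := @extend_graph _ _ _ G c c0.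
- move=> a v w v' w' [s [-> ->]] [s' [-> ->]].
  exists ([seq (a *: p.1, p.2) | p <- s] ++ s').
  rewrite !big_cat !big_map /= !scaler_sumr; split; congr (_ + _).
    by apply: eq_bigr => p _; rewrite linearZl_LR.
  by apply: eq_bigr => p _; rewrite (bilinZl bb).
- by move=> v w [s [-> ->]].
- have := @tens_total _ T V W; congr dense; apply/seteqP; split=> z /=.
    by move=> [s ->]; exists (\sum_(p <- s) b p.1 p.2), s.
  by move=> [_ [s [-> _]]]; exists s.
exists C; split=> // x y; apply: CG; exists [:: (x, y)].
by rewrite !big_seq1.
Qed.

(** Factored as I ⊗ B after A ⊗ I, so that each factor is bounded by orthonormalising the side on
    which it is the identity. *)
Lemma optens_exists V V' W W' (A : V -> V') (B : W -> W') : bop A -> bop B ->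
  exists C : tprod T V W -> tprod T V' W', [/\ bop C,
    forall x y, C (tn x y) = tn (A x) (B y) &
    forall z, nrm (C z) <= opnorm A * opnorm B * nrm z].
Proof.
move=> bA bB.
have [|||C [bC CE Cc]] :=
    @extend_tens V W (tprod T V' W) (fun x y => tn (A x) y) (opnorm A).
- exact: (bilin_comp (tens_bilin _ _) bA (bop_id W)).
- exact: opnorm_ge0.
- move=> s; apply: tlike_op_bound => //; try exact: tens_tlike.
    exact: opnorm_ge0.
  by move=> x; apply: opnorm_nrm.
have [|||D [bD DE Dc]] :=
    @extend_tens V' W (tprod T V' W') (fun x y => tn x (B y)) (opnorm B).
- exact: (bilin_comp (tens_bilin _ _) (bop_id V') bB).
- exact: opnorm_ge0.
- move=> s.
  have := @tlike_op_bound _ W W' V' (tprod T V' W) (tprod T V' W')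
    (fun y x => tn x y) (fun y x => tn x y) B (opnorm B)
    [seq (p.2, p.1) | p <- s] (tlike_swap (tens_tlike _ _))
    (tlike_swap (tens_tlike _ _)) bB (opnorm_ge0 bB)
    (fun x => opnorm_nrm x bB).
  by rewrite !big_map.
exists (D \o C); split=> [|x y|z] /=; first exact: bop_comp.
  by rewrite CE DE.
apply: le_trans (Dc _) _; rewrite [opnorm A * _]mulrC -mulrA.
by rewrite ler_wpM2l ?opnorm_ge0.
Qed.

Section Optens.
Variables V V' W W' : hilbertType R.
Implicit Types (A : V -> V') (B : W -> W').

Lemma optens_spec A B : bop A -> bop B -> bop (optens T A B) /\
  forall x y, optens T A B (tn x y) = tn (A x) (B y).
Proof.
move=> bA bB; have [C [bC CE _]] := optens_exists bA bB.
have /(@xgetPex _ 0) : exists C : tprod T V W -> tprod T V' W', bop C /\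
  forall x y, C (tn x y) = tn (A x) (B y) by exists C.
by [].
Qed.

Lemma optens_bop A B : bop A -> bop B -> bop (optens T A B).
Proof. by move=> bA bB; have [] := optens_spec bA bB. Qed.

Lemma optensE A B x y : bop A -> bop B ->
  optens T A B (tn x y) = tn (A x) (B y).
Proof. by move=> bA bB; have [] := optens_spec bA bB. Qed.

Lemma optens_uniq A B C : bop A -> bop B -> bop C ->
  (forall x y, C (tn x y) = tn (A x) (B y)) -> optens T A B = C.
Proof.
move=> bA bB bC CE; apply: bop_eq_tens => //; first exact: optens_bop.
by move=> x y; rewrite optensE.
Qed.

Lemma optens_nrm A B z : bop A -> bop B ->
  nrm (optens T A B z) <= opnorm A * opnorm B * nrm z.
Proof.
move=> bA bB; have [C [bC CE Cc]] := optens_exists bA bB.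
by rewrite (optens_uniq bA bB bC CE).
Qed.

Lemma opnorm_optens A B : bop A -> bop B ->
  opnorm (optens T A B) <= opnorm A * opnorm B.
Proof.
move=> bA bB; apply: opnorm_le; [exact: optens_bop| |].
  by move=> z; apply: optens_nrm.
by rewrite mulr_ge0 ?opnorm_ge0.
Qed.

End Optens.

Lemma optens_adj V V' W W' (A : V -> V') (B : W -> W') : bop A -> bop B ->
  adj (optens T A B) = optens T (adj A) (adj B).
Proof.
move=> bA bB; have bD := optens_bop (adj_bop bA) (adj_bop bB).
rewrite (@optens_uniq _ _ _ _ A B (adj (optens T (adj A) (adj B)))) //.
- exact: adjK.
- exact: adj_bop.
move=> x y; apply: tens_inner_inj => x' y'.
rewrite -adjEr // optensE; [|exact: adj_bop..].
by rewrite !tens_inner -!adjE.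
Qed.

Lemma optens_comp U U' V V' W W' (A : V -> V') (B : W -> W') (A' : U -> V)
  (B' : U' -> W) : bop A -> bop B -> bop A' -> bop B' ->
  optens T (A \o A') (B \o B') = optens T A B \o optens T A' B'.
Proof.
move=> bA bB bA' bB'; apply: optens_uniq; try exact: bop_comp.
  by apply: bop_comp; apply: optens_bop.
by move=> x y /=; rewrite !optensE.
Qed.

Lemma optens_id V W : optens T (idfun : V -> V) (idfun : W -> W) = idfun.
Proof. by apply: optens_uniq; rewrite //; apply: bop_id. Qed.

Section OptensLinear.
Variables V V' W W' : hilbertType R.
Implicit Types (A : V -> V') (B : W -> W').

Lemma optensDl A A' B : bop A -> bop A' -> bop B ->
  optens T (A + A') B = optens T A B + optens T A' B.
Proof.
move=> bA bA' bB; apply: optens_uniq => //; first exact: bop_add.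
  by apply: bop_add; apply: optens_bop.
by move=> x y; rewrite !fctE !optensE // linearDl.
Qed.

Lemma optensDr A B B' : bop A -> bop B -> bop B' ->
  optens T A (B + B') = optens T A B + optens T A B'.
Proof.
move=> bA bA' bB; apply: optens_uniq => //; first exact: bop_add.
  by apply: bop_add; apply: optens_bop.
by move=> x y; rewrite !fctE !optensE // linearDr.
Qed.

Lemma optensZl a A B : bop A -> bop B ->
  optens T (a *: A) B = a *: optens T A B.
Proof.
move=> bA bB; apply: optens_uniq => //; first exact: bop_scale.
  by apply: bop_scale; apply: optens_bop.
by move=> x y; rewrite !fctE !optensE // linearZl_LR.
Qed.

Lemma optensZr a A B : bop A -> bop B ->
  optens T A (a *: B) = a *: optens T A B.
Proof.
move=> bA bB; apply: optens_uniq => //; first exact: bop_scale.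
  by apply: bop_scale; apply: optens_bop.
by move=> x y; rewrite !fctE !optensE // linearZr_LR.
Qed.

Lemma optens0l B : bop B -> optens T (0 : V -> V') B = 0.
Proof.
move=> bB; apply: optens_uniq => //; try exact: bop_zero.
by move=> x y; apply/esym/linear0l.
Qed.

Lemma optens0r A : bop A -> optens T A (0 : W -> W') = 0.
Proof.
move=> bB; apply: optens_uniq => //; try exact: bop_zero.
by move=> x y; apply/esym/linear0r.
Qed.

Lemma optens_suml I (s : seq I) (P : pred I) (G : I -> V -> V') B :
  (forall i, bop (G i)) -> bop B ->
  optens T (\sum_(i <- s | P i) G i) B = \sum_(i <- s | P i) optens T (G i) B.
Proof.
move=> bG bB; elim: s => [|i s IH]; first by rewrite !big_nil optens0l.
rewrite !big_cons; case: ifP => // _; rewrite optensDl ?IH //.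
exact: bop_bigsum.
Qed.

Lemma optens_sumr I (s : seq I) (P : pred I) (G : I -> W -> W') A :
  (forall i, bop (G i)) -> bop A ->
  optens T A (\sum_(i <- s | P i) G i) = \sum_(i <- s | P i) optens T A (G i).
Proof.
move=> bG bB; elim: s => [|i s IH]; first by rewrite !big_nil optens0r.
rewrite !big_cons; case: ifP => // _; rewrite optensDr ?IH //.
exact: bop_bigsum.
Qed.

End OptensLinear.

Lemma opnorm_id_le V : opnorm (idfun : V -> V) <= 1.
Proof. by apply: opnorm_le; [exact: bop_id|move=> x; rewrite mul1r|]. Qed.

Lemma opnorm_optens_idl V W W' (B : W -> W') : bop B ->
  opnorm (optens T (idfun : V -> V) B) <= opnorm B.
Proof.
move=> bB; apply: le_trans (opnorm_optens (bop_id V) bB) _.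
by rewrite ler_piMl ?opnorm_ge0 // opnorm_id_le.
Qed.

Lemma opnorm_optens_idr V V' W (A : V -> V') : bop A ->
  opnorm (optens T A (idfun : W -> W)) <= opnorm A.
Proof.
move=> bA; apply: le_trans (opnorm_optens bA (bop_id W)) _.
by rewrite ler_piMr ?opnorm_ge0 // opnorm_id_le.
Qed.

Lemma bop_tensl V W (x : V) : bop (tens T V W x).
Proof.
apply: (@bop_bound _ _ _ _ (nrm x)) => [a y y'||y].
- by rewrite linearDr linearZr_LR.
- exact: nrm_ge0.
- by rewrite nrm_tens.
Qed.

Lemma bop_tensr V W (y : W) : bop (fun x => tens T V W x y).
Proof.
apply: (@bop_bound _ _ _ _ (nrm y)) => [a x x'||x].
- by rewrite linearDl linearZl_LR.
- exact: nrm_ge0.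
- by rewrite nrm_tens mulrC.
Qed.

(** * The associator and its unitarity *)

Section Assoc.
Variables V U W : hilbertType R.

Let J (x : V) := optens T (tens T V U x) (idfun : W -> W).

(** The operators [J x] satisfy J(x')^* J(x) = <x, x'> I, so (x, z) -> J x z has the inner products
    of a tensor product. The estimate for two factors, applied to the identity, then bounds the
    associator without any threefold sum. *)
Lemma tassoc_spec : [/\ bop (tassoc T V U W),
  forall x f h, tassoc T V U W (tn x (tn f h)) = tn (tn x f) h &
  forall z, nrm (tassoc T V U W z) <= nrm z].
Proof.
have bJ x : bop (J x) by apply: optens_bop; [exact: bop_tensl|exact: bop_id].
have JD a x y : J (a *: x + y) = a *: J x + J y.
  rewrite /J -optensZl -?optensDl; try exact: bop_id; try exact: bop_tensl.
    congr (optens T _ _); apply/funext => z.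
    by rewrite !fctE linearDl linearZl_LR.
  by apply: bop_scale; apply: bop_tensl.
have JJ x x' : adj (J x') \o J x = '<< x, x' >> *: idfun.
  rewrite /J optens_adj; [|exact: bop_tensl|exact: bop_id].
  rewrite -optens_comp; try exact: bop_id; try exact: bop_tensl; last 2 first.
  - by apply: adj_bop; exact: bop_tensl.
  - by apply: adj_bop; exact: bop_id.
  rewrite adj_id (_ : adj (tens T V U x') \o tens T V U x = '<< x, x' >> *: idfun).
    by rewrite optensZl ?optens_id; try exact: bop_id.
  apply/funext => u /=; apply: inner_inj => u'.
  by rewrite -adjEr ?tens_inner ?innerZl //; exact: bop_tensl.
have tJ : tlike (fun x z => J x z).
  split=> [|x x' z z'].
    split=> [a x x' z|a x z z']; first by rewrite JD.
    by rewrite bopD // bopZ.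
  rewrite innerC adjE // -innerC.
  by have /(congr1 (fun f => f z)) /= := JJ x x' => ->; rewrite innerZl.
have [|//||C [bC CE Cc]] := @extend_tens V (tprod T U W) _ (fun x z => J x z) 1.
- exact: tJ.1.
- move=> s; rewrite mul1r.
  have := @tlike_op_bound _ V V (tprod T U W) _ _ (tens T V (tprod T U W))
    (fun x z => J x z) idfun 1 s (tens_tlike _ _) tJ (bop_id V) ler01.
  by rewrite mul1r; apply=> x; rewrite mul1r.
have CE' x f h : C (tn x (tn f h)) = tn (tn x f) h.
  rewrite CE /J optensE //; [exact: bop_tensl|exact: bop_id].
suff -> : tassoc T V U W = C.
  by split=> // z; rewrite -[leRHS]mul1r.
have [bt tE] : bop (tassoc T V U W) /\
    forall x f h, tassoc T V U W (tn x (tn f h)) = tn (tn x f) h.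
  have /(@xgetPex _ 0) :
    exists C : tprod T V (tprod T U W) -> tprod T (tprod T V U) W, bop C /\
    forall x f h, C (tn x (tn f h)) = tn (tn x f) h by exists C.
  by [].
apply: bop_eq_tens => // x z.
have bx A : bop A -> bop (fun z => A (tens T V (tprod T U W) x z)).
  by move=> bA; apply: (bop_comp bA (bop_tensl _ x)).
suff : (fun z => tassoc T V U W (tn x z)) = (fun z => C (tn x z)).
  by move/(congr1 (fun f => f z)).
apply: bop_eq_tens; [exact: bx|exact: bx|].
by move=> f h; rewrite tE CE'.
Qed.

Lemma tassoc_bop : bop (tassoc T V U W).
Proof. by have [] := tassoc_spec. Qed.

Lemma tassocE x f h : tassoc T V U W (tn x (tn f h)) = tn (tn x f) h.
Proof. by have [] := tassoc_spec. Qed.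

End Assoc.

Lemma bop_eq_tens3l V U W Z (A B : tprod T (tprod T V U) W -> Z) :
  bop A -> bop B -> (forall x f h, A (tn (tn x f) h) = B (tn (tn x f) h)) ->
  A = B.
Proof.
move=> bA bB AB; apply: bop_eq_tens => // z h.
suff : (fun z => A (tn z h)) = (fun z => B (tn z h)).
  by move/(congr1 (fun f => f z)).
apply: bop_eq_tens => [||x f]; last exact: AB.
- exact: (bop_comp bA (bop_tensr _ h)).
- exact: (bop_comp bB (bop_tensr _ h)).
Qed.

Lemma bop_eq_tens3r V U W Z (A B : tprod T V (tprod T U W) -> Z) :
  bop A -> bop B -> (forall x f h, A (tn x (tn f h)) = B (tn x (tn f h))) ->
  A = B.
Proof.
move=> bA bB AB; apply: bop_eq_tens => // x z.
suff : (fun z => A (tn x z)) = (fun z => B (tn x z)).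
  by move/(congr1 (fun f => f z)).
apply: bop_eq_tens => [||f h]; last exact: AB.
- exact: (bop_comp bA (bop_tensl _ x)).
- exact: (bop_comp bB (bop_tensl _ x)).
Qed.
Lemma tens_inner_inj3r V U W (z z' : tprod T V (tprod T U W)) :
  (forall x f h, '<< z, tn x (tn f h) >> = '<< z', tn x (tn f h) >>) -> z = z'.
Proof.
move=> zz; apply: tens_inner_inj => x u; have b := bop_tensl (tprod T U W) x.
rewrite !(adjEr _ _ b); congr ('<< _, _ >>).
by apply: tens_inner_inj => f h; rewrite -!(adjEr _ _ b).
Qed.

Section AssocUnitary.
Variables V U W : hilbertType R.

Lemma adj_tassocE x f h : adj (tassoc T V U W) (tn (tn x f) h) = tn x (tn f h).
Proof.
have bt := tassoc_bop V U W; rewrite -tassocE.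
apply: tens_inner_inj3r => x' f' h'.
by rewrite -adjEr // !tassocE !tens_inner mulrA.
Qed.

Lemma tassocK : adj (tassoc T V U W) \o tassoc T V U W = idfun.
Proof.
have bt := tassoc_bop V U W.
apply: bop_eq_tens3r; [exact: (bop_comp (adj_bop bt))|exact: bop_id|].
by move=> x f h /=; rewrite tassocE adj_tassocE.
Qed.

Lemma tassocKV : tassoc T V U W \o adj (tassoc T V U W) = idfun.
Proof.
have bt := tassoc_bop V U W.
apply: bop_eq_tens3l; [exact: (bop_comp bt (adj_bop bt))|exact: bop_id|].
by move=> x f h /=; rewrite adj_tassocE tassocE.
Qed.

End AssocUnitary.

Lemma tassoc_optens V V' U U' W W' (A : V -> V') (B : U -> U') (C : W -> W') :
  bop A -> bop B -> bop C ->
  tassoc T V' U' W' \o optens T A (optens T B C) =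
  optens T (optens T A B) C \o tassoc T V U W.
Proof.
move=> bA bB bC; have bt := tassoc_bop V U W; have bt' := tassoc_bop V' U' W'.
have bBC := optens_bop bB bC; have bAB := optens_bop bA bB.
apply: bop_eq_tens3r.
- by apply: bop_comp => //; apply: optens_bop.
- by apply: bop_comp => //; apply: optens_bop.
by move=> x f h /=; rewrite tassocE !optensE // tassocE.
Qed.

End Tensor.

(** * Fock space *)

Section ComplexLimits.
Variable R : realType.

Lemma cvg_cab T (F : set_system T) {FF : Filter F} (u : T -> R[i]) (l : R[i]) :
  u @ F --> (l : R[i]^o) <-> (fun t => cab (u t - l)) @ F --> (0 : R).
Proof.
split=> [/(@cvgrPdist_lt _ (R[i]^o)) h|/cvgrPdist_lt h].
  apply/cvgrPdist_lt => e e0.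
  have e0' : (0 : R[i]) < e%:C by rewrite ltcR.
  near=> t; rewrite sub0r normrN ger0_norm ?cab_ge0 // -cabN opprB -ltcR -cabE.
  by near: t; apply: h.
apply/(@cvgrPdist_lt _ (R[i]^o)) => e e0.
have [r r0 ->] := gtC0_Re e0.
near=> t; rewrite cabE ltcR -cabN opprB.
have -> : cab (u t - l) = `|0 - cab (u t - l)|.
  by rewrite sub0r normrN ger0_norm ?cab_ge0.
by near: t; apply: h.
Unshelve. all: by end_near.
Qed.

(** Being nonnegative in [R[i]] includes being real, so the limit needs a vanishing imaginary part
    as well as a nonnegative real part. *)
Lemma cvgC_ge0 T (F : set_system T) {FF : ProperFilter F} (u : T -> R[i])
  (l : R[i]) : u @ F --> (l : R[i]^o) -> (\forall t \near F, 0 <= u t) -> 0 <= l.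
Proof.
move=> /cvg_cab/cvgrPdist_lt h u0.
have key e : 0 < e -> exists2 z : R[i], 0 <= z & cab (z - l) < e.
  move=> e0; near F => t; exists (u t); first by near: t.
  have -> : cab (u t - l) = `|0 - cab (u t - l)|.
    by rewrite sub0r normrN ger0_norm ?cab_ge0.
  by near: t; apply: h.
have cl (z : R[i]) e : 0 < e -> 0 <= z -> cab (z - l) < e ->
    `|complex.Im l| <= e /\ - e <= complex.Re l.
  move=> e0 z0 zl; have Im0 := ger0_Im z0.
  have Re0 : 0 <= complex.Re z by rewrite -ler0c ge0_ReK.
  have h2 : cab (z - l) ^+ 2 = (complex.Re z - complex.Re l) ^+ 2 +
      complex.Im l ^+ 2.
    apply: complexI; rewrite rmorphXn /= -cabE -add_Re2_Im2 !raddfB /= Im0.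
    by rewrite sub0r sqrrN.
  have h3 := cab_ge0 (z - l).
  have h4 : cab (z - l) ^+ 2 <= e ^+ 2 by rewrite ler_pXn2r ?nnegrE // ltW.
  split.
    have h5 : complex.Im l ^+ 2 <= e ^+ 2.
      by apply: le_trans h4; rewrite h2 lerDr sqr_ge0.
    by rewrite ler_norml; apply/andP; split; nra.
  rewrite lerNl; apply: contraTT isT; rewrite -ltNge => hl.
  exfalso; have h5 : e < complex.Re z - complex.Re l by lra.
  have : e ^+ 2 < (complex.Re z - complex.Re l) ^+ 2.
    by rewrite ltr_pXn2r ?nnegrE ?ltW // (lt_trans e0).
  have := sqr_ge0 (complex.Im l); lra.
rewrite lecE /=; apply/andP; split.
  rewrite -normr_eq0 eq_le normr_ge0 andbT.
  apply/ler_addgt0Pr => e e0; rewrite add0r.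
  by have [z z0 zl] := key _ e0; have [] := cl _ _ e0 z0 zl.
apply/ler_addgt0Pr => e e0; rewrite -lerBlDr sub0r.
by have [z z0 zl] := key _ e0; have [] := cl _ _ e0 z0 zl.
Unshelve. all: by end_near.
Qed.

Lemma dense_seq (V : hilbertType R) (D : set V) (x : V) : dense D ->
  exists2 u : nat -> V, (forall k, D (u k)) & (u @ \oo --> x).
Proof.
move=> dD; have /choice[u hu] : forall k : nat, exists y, D y /\
    nrm (x - y) < k.+1%:R^-1.
  move=> k; have k0 : 0 < k.+1%:R^-1 :> R by rewrite invr_gt0 ltr0n.
  by have [y Dy xy] := dense_nrm x dD k0; exists y.
exists u => [k|]; first by have [] := hu k.
apply/cvg_nrmP => e /inv_nat_small[N hN]; exists N => k Nk.
by rewrite nrmBC; have [_ h] := hu k; apply: lt_trans h (hN _ Nk).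
Qed.

Lemma pos_dense (V : hilbertType R) (A : V -> V) (D : set V) : bop A ->
  dense D -> (forall z, D z -> 0 <= '<< A z, z >>) -> forall z, 0 <= '<< A z, z >>.
Proof.
move=> bA dD h z; have [u Du uz] := dense_seq z dD.
apply: (@cvgC_ge0 _ \oo _ (fun k => '<< A (u k), u k >>)).
  by apply: cvg_inner => //; apply: cvg_bop.
by near=> k; apply: h.
Unshelve. all: by end_near.
Qed.

End ComplexLimits.

(** * Sums over words of a given length *)

Section Words.
Variables (M : nmodType) (n : nat).

Lemma big_tuple0 (G : seq 'I_n -> M) : \sum_(w : 0.-tuple 'I_n) G w = G [::].
Proof.
rewrite (bigD1 [tuple]) //= big1 ?addr0 // => w /negP[].
by apply/eqP/tuple0.
Qed.

Lemma big_tupleS k (G : seq 'I_n -> M) :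
  \sum_(w : k.+1.-tuple 'I_n) G w = \sum_(i < n) \sum_(w : k.-tuple 'I_n) G (i :: w).
Proof.
rewrite pair_big /= (reindex (fun p : 'I_n * k.-tuple 'I_n => [tuple of p.1 :: p.2])) //=.
exists (fun w : k.+1.-tuple 'I_n => (thead w, [tuple of behead w])) => /= [[i w] _|w _].
  by congr (_, _); apply/val_inj.
by rewrite [RHS]tuple_eta.
Qed.

Lemma big_tuple_rev k (G : seq 'I_n -> M) :
  \sum_(w : k.-tuple 'I_n) G w = \sum_(w : k.-tuple 'I_n) G (rev w).
Proof.
rewrite (reindex_inj (h := fun w : k.-tuple 'I_n => [tuple of rev w])) //=.
by move=> v w /(congr1 val) /= /(congr1 rev); rewrite !revK => /val_inj.
Qed.

Lemma big_tuple_rcons k (G : seq 'I_n -> M) :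
  \sum_(w : k.+1.-tuple 'I_n) G w =
  \sum_(i < n) \sum_(w : k.-tuple 'I_n) G (rcons w i).
Proof.
rewrite big_tuple_rev (big_tupleS _ (fun w => G (rev w))).
apply: eq_bigr => i _; rewrite (big_tuple_rev _ (fun w => G (rcons w i))).
by apply: eq_bigr => w _; rewrite rev_cons.
Qed.

End Words.

(** * Creation operators on the word basis *)

Section FockSpace.
Variables (R : realType) (n : nat) (F : fock_space R n).
Implicit Types V W H : hilbertType R.
Implicit Types (w v : seq 'I_n) (i j : 'I_n).

Local Notation e := (fock_e F).

Lemma bop_eq_fock V (A B : F -> V) : bop A -> bop B ->
  (forall w, A (e w) = B (e w)) -> A = B.
Proof.
move=> bA bB AB; apply: (bop_eq_dense bA bB (@fock_total _ _ F)) => z [s ->].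
by rewrite !bop_sum //; apply: eq_bigr => p _; rewrite !bopZ // AB.
Qed.

Lemma fock_inner_inj (z z' : F) :
  (forall w, '<< z, e w >> = '<< z', e w >>) -> z = z'.
Proof.
move=> h; apply/subr0_eq.
have : forall w, '<< z - z', e w >> = 0 by move=> w; rewrite innerBl h subrr.
move: (z - z') => d {}h; apply/nrm_small => r r0.
have [_ [s ->] ds] := dense_nrm d (@fock_total _ _ F) r0.
have dd : '<< d, d >> = '<< d, d - \sum_(p <- s) p.1 *: e p.2 >>.
  by rewrite innerBr inner_sumr big1 ?subr0 // => p _; rewrite innerZr h mulr0.
have [->|n0] := eqVneq (nrm d) 0; first exact: ltW.
have np : 0 < nrm d by rewrite lt_def n0 nrm_ge0.
rewrite -(ler_pM2l np) -expr2 nrm_sqE dd.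
apply: le_trans (Re_le_cab _) _; apply: le_trans (cauchy_schwarz _ _) _.
by rewrite ler_wpM2l ?nrm_ge0 // ltW.
Qed.

(** The isometry e_w -> e_(s w) of an injective [s]. By conversion [creL F i] and [creR F i] are
    instances, with [s] prepending or appending a letter, so one extension argument serves all these
    operators. *)
Definition fmap (s : seq 'I_n -> seq 'I_n) : F -> F :=
  xget 0 [set A | bop A /\ forall w, A (e w) = e (s w)].

Section Fmap.
Variable s : seq 'I_n -> seq 'I_n.
Hypothesis s_inj : injective s.

Lemma fmap_spec : bop (fmap s) /\ forall w, fmap s (e w) = e (s w).
Proof.
pose G (v v' : F) := exists p : seq (R[i] * seq 'I_n),
  v = \sum_(q <- p) q.1 *: e q.2 /\ v' = \sum_(q <- p) q.1 *: e (s q.2).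
have [|||A [bA AG _]] := @extend_graph _ _ _ G 1 ler01.
- move=> a v w v' w' [p [-> ->]] [p' [-> ->]].
  exists ([seq (a * q.1, q.2) | q <- p] ++ p').
  rewrite !big_cat !big_map /= !scaler_sumr; split; congr (_ + _);
  by apply: eq_bigr => q _; rewrite scalerA.
- move=> v w [p [-> ->]]; rewrite mul1r -(@ler_pXn2r _ 2) ?nnegrE ?nrm_ge0 //.
  rewrite !nrm_sqE !inner_suml le_eqVlt; apply/orP; left; apply/eqP.
  congr complex.Re; apply: eq_bigr => q _; rewrite !inner_sumr.
  apply: eq_bigr => q' _; rewrite !innerZl !innerZr !fock_orthonormal.
  by rewrite (inj_eq s_inj).
- have := @fock_total _ _ F; congr dense; apply/seteqP; split=> z /=.
    by move=> [p ->]; exists (\sum_(q <- p) q.1 *: e (s q.2)), p.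
  by move=> [_ [p [-> _]]]; exists p.
have /(@xgetPex _ 0) : exists A, bop A /\ forall w, A (e w) = e (s w).
  exists A; split=> // w; apply: AG; exists [:: (1, w)].
  by rewrite !big_seq1 !scale1r.
by [].
Qed.

Lemma fmap_bop : bop (fmap s). Proof. by have [] := fmap_spec. Qed.

Lemma fmapE w : fmap s (e w) = e (s w). Proof. by have [] := fmap_spec. Qed.

Lemma adj_fmapE w : adj (fmap s) (e (s w)) = e w.
Proof.
apply: fock_inner_inj => v.
by rewrite -adjEr ?fmapE ?fock_orthonormal ?(inj_eq s_inj) //; exact: fmap_bop.
Qed.

Lemma adj_fmap0 w : (forall v, s v != w) -> adj (fmap s) (e w) = 0.
Proof.
move=> sw; apply: fock_inner_inj => v.
rewrite -adjEr ?fmapE ?fock_orthonormal ?inner0l; last exact: fmap_bop.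
by rewrite eq_sym (negbTE (sw v)).
Qed.
End Fmap.

Lemma rcons_injr i : injective (fun w => rcons w i).
Proof. by move=> v w /rcons_inj[]. Qed.

Lemma cons_injr i : injective (cons i).
Proof. by move=> v w []. Qed.

Lemma creL_bop i : bop (creL F i). Proof. exact: (fmap_bop (@cons_injr i)). Qed.

Lemma creLE i w : creL F i (e w) = e (i :: w).
Proof. exact: (fmapE (@cons_injr i)). Qed.

Lemma creR_bop i : bop (creR F i). Proof. exact: (fmap_bop (@rcons_injr i)). Qed.

Lemma creRE i w : creR F i (e w) = e (rcons w i).
Proof. exact: (fmapE (@rcons_injr i)). Qed.

Lemma adj_creRE i j w :
  adj (creR F i) (e (rcons w j)) = if i == j then e w else 0.
Proof.
have [->|ij] := eqVneq i j; first exact: (adj_fmapE (@rcons_injr j)).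
apply: (adj_fmap0 (@rcons_injr i)) => v.
by apply: contraNneq ij => /rcons_inj[_ ->].
Qed.

Lemma adj_creR0 i : adj (creR F i) (e [::]) = 0.
Proof. by apply: (adj_fmap0 (@rcons_injr i)) => -[]. Qed.

Lemma adj_creR_creR i j :
  adj (creR F i) \o creR F j = if i == j then idfun else 0.
Proof.
have b := bop_comp (adj_bop (creR_bop i)) (creR_bop j).
move: b; have [<-|ij] := eqVneq i j => b.
  apply: (bop_eq_fock b) => [|w /=]; first exact: bop_id.
  by rewrite creRE adj_creRE eqxx.
apply: (bop_eq_fock b) => [|w /=]; first exact: bop_zero.
by rewrite creRE adj_creRE (negbTE ij).
Qed.

(** The operator U; conjugation by it exchanges left and right creation operators. *)
Definition flip : F -> F := fmap rev.

Lemma rev_inj : injective (@rev 'I_n). Proof. exact: (can_inj revK). Qed.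

Lemma flip_bop : bop flip. Proof. exact: (fmap_bop rev_inj). Qed.

Lemma flipE w : flip (e w) = e (rev w). Proof. exact: (fmapE rev_inj). Qed.
Lemma adj_flip : adj flip = flip.
Proof.
have b := flip_bop.
apply: bop_eq_fock => //; first exact: adj_bop.
move=> w; rewrite flipE -{1}[w]revK.
exact: (adj_fmapE rev_inj).
Qed.

Section Monom.
Variables (H : hilbertType R) (X : 'I_n -> H -> H).

Lemma monom_bop w : (forall i, bop (X i)) -> bop (monom X w).
Proof. by move=> bX; elim: w => [|i w IH] /=; [exact: bop_id|exact: bop_comp]. Qed.

Lemma monom_cat w v : monom X (w ++ v) = monom X w \o monom X v.
Proof. by elim: w => [|i w IH] //=; rewrite IH. Qed.

Lemma monom_rcons w i : monom X (rcons w i) = monom X w \o X i.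
Proof. by rewrite -cats1 monom_cat. Qed.

Lemma adj_monom_cons i w : (forall i, bop (X i)) ->
  adj (monom X (i :: w)) = adj (monom X w) \o adj (X i).
Proof. by move=> bX /=; rewrite adj_comp //; apply: monom_bop. Qed.

Lemma adj_monom_rcons i w : (forall i, bop (X i)) ->
  adj (monom X (rcons w i)) = adj (X i) \o adj (monom X w).
Proof. by move=> bX; rewrite monom_rcons adj_comp //; apply: monom_bop. Qed.

End Monom.

Local Notation Rw := (monom (creR F)).
Local Notation Sw := (monom (creL F)).

Lemma Rw_bop w : bop (Rw w). Proof. exact: (monom_bop _ creR_bop). Qed.
Lemma Sw_bop w : bop (Sw w). Proof. exact: (monom_bop _ creL_bop). Qed.

(** The last letter of [w] acts first, so the letters of [w] are appended from last to first. The
    reversals of words below originate here. *)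
Lemma RwE w v : Rw w (e v) = e (v ++ rev w).
Proof.
elim: w => [|i w IH] /=; first by rewrite cats0.
by rewrite IH creRE rev_cons rcons_cat.
Qed.

Lemma SwE w v : Sw w (e v) = e (w ++ v).
Proof. by elim: w => [|i w IH] //=; rewrite IH creLE. Qed.

Lemma flip_Sw w : flip \o Sw w \o flip = Rw w.
Proof.
apply: bop_eq_fock; last 2 first.
- exact: Rw_bop.
- by move=> v /=; rewrite flipE SwE flipE rev_cat revK RwE.
exact: (bop_comp (bop_comp flip_bop (Sw_bop w)) flip_bop).
Qed.
(** The relations R_i^* R_j = delta_ij cancel equal first letters of the two words until two letters
    differ or one word is exhausted. This is why Theta^* Theta stays in the closed span of monomials
    and their adjoints. *)
Lemma Rw_adj_mul w v : [\/ adj (Rw w) \o Rw v = 0,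
  exists u, adj (Rw w) \o Rw v = Rw u |
  exists u, adj (Rw w) \o Rw v = adj (Rw u)].
Proof.
elim: w v => [|i w IH] v; first by constructor 2; exists v; rewrite /= adj_id.
case: v => [|j v]; first by constructor 3; exists (i :: w).
have -> : adj (Rw (i :: w)) \o Rw (j :: v) =
    adj (Rw w) \o (adj (creR F i) \o creR F j) \o Rw v.
  by rewrite adj_monom_cons //; exact: creR_bop.
rewrite adj_creR_creR; case: eqP => _; first exact: IH.
constructor 1; apply/funext => z /=; rewrite bop0 //.
by apply: adj_bop; exact: Rw_bop.
Qed.

Lemma Rw_orth w v : size w = size v ->
  adj (Rw w) \o Rw v = if w == v then idfun else 0.
Proof.
elim: w v => [|i w IH] [|j v] //=; first by rewrite adj_id.
move=> [/IH wv]; rewrite adj_comp; [|exact: creR_bop|exact: Rw_bop].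
rewrite -[LHS]/(adj (Rw w) \o (adj (creR F i) \o creR F j) \o Rw v).
rewrite adj_creR_creR eqseq_cons; case: eqP => _ //=.
by apply/funext => z /=; rewrite bop0 //; apply: adj_bop; exact: Rw_bop.
Qed.

Lemma scaled_creR_bop r i : bop (scaled_creR F r i).
Proof. by apply: bop_scale; exact: creR_bop. Qed.

Lemma monom_scaled r w : monom (scaled_creR F r) w = (r ^+ size w)%:C *: Rw w.
Proof.
elim: w => [|i w IH] /=; first by apply/funext => z; rewrite fctE scale1r.
rewrite IH; apply/funext => z; rewrite /scaled_creR !fctE /=.
rewrite bopZ; last exact: creR_bop.
by rewrite scalerA -rmorphM exprS.
Qed.

Lemma sum_creR_adj w :
  (\sum_(i < n) (creR F i \o adj (creR F i))) (e w) =
  if w == [::] then 0 else e w.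
Proof.
rewrite fct_sumE; case/lastP: w => [|w j].
  rewrite eqxx big1 // => i _ /=; rewrite adj_creR0 bop0 //; exact: creR_bop.
have -> : rcons w j == [::] = false by case: w.
rewrite (bigD1 j) //= adj_creRE eqxx creRE big1 ?addr0 // => i ij.
by rewrite adj_creRE (negbTE ij) bop0 //; exact: creR_bop.
Qed.

End FockSpace.

Arguments flip {R n} F _.

Section FockTensor.
Variables (R : realType) (n : nat) (F : fock_space R n) (T : hilbert_tensor R).
Implicit Types E Z : hilbertType R.

Local Notation e := (fock_e F).

Lemma fock_tens_total E : dense [set z : tprod T E F |
  exists s : seq (E * seq 'I_n), z = \sum_(p <- s) tens T E F p.1 (e p.2)].
Proof.
set D := [set z | _].
have D0 : D 0 by exists [::]; rewrite big_nil.
have DD z z' : D z -> D z' -> D (z + z').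
  by move=> [s ->] [s' ->]; exists (s ++ s'); rewrite big_cat.
have De x f r : 0 < r -> exists2 d, D d & nrm (tens T E F x f - d) < r.
  move=> r0; have d0 : 0 < r / (nrm x + 1).
    by rewrite divr_gt0 // ltr_wpDl ?nrm_ge0.
  have [_ [s ->] fs] := dense_nrm f (@fock_total _ _ F) d0.
  exists (tens T E F x (\sum_(p <- s) p.1 *: e p.2)).
    exists [seq (p.1 *: x, p.2) | p <- s].
    rewrite linear_sumr big_map; apply: eq_bigr => p _ /=.
    by rewrite linearZr_LR linearZl_LR.
  rewrite -linearBr nrm_tens; move: fs; rewrite ltr_pdivlMr ?ltr_wpDl ?nrm_ge0 //.
  apply: le_lt_trans; rewrite mulrC ler_wpM2l ?nrm_ge0 //.
  by rewrite lerDl.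
have Ds (s : seq (E * F)) r : 0 < r ->
    exists2 d, D d & nrm (\sum_(p <- s) tens T E F p.1 p.2 - d) < r.
  elim: s r => [|p s IH] r r0; first by exists 0; rewrite // big_nil subr0 nrm0.
  have r2 : 0 < r / 2 by rewrite divr_gt0.
  have [d Dd hd] := IH _ r2; have [d' Dd' hd'] := De p.1 p.2 _ r2.
  exists (d' + d); first exact: DD.
  rewrite big_cons opprD addrACA; apply: le_lt_trans (nrmD _ _) _.
  by rewrite [ltRHS](splitr r) ltrD.
move=> O [z Oz] oO; have /nbhs_ballP[r /= r0 rO] : nbhs z O by apply: open_nbhs_nbhs.
have [q q0 rq] := gtC0_Re r0; have q2 : 0 < q / 2 by rewrite divr_gt0.
have [_ [s ->] zs] := dense_nrm z (@tens_total _ T E F) q2.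
have [d Dd sd] := Ds s _ q2; exists d; split=> //.
apply: rO; rewrite -ball_normE /= rq nrmE ltcR.
apply: le_lt_trans (nrm_triangle _ (\sum_(p <- s) tens T E F p.1 p.2) _) _.
by rewrite [ltRHS](splitr q) ltrD.
Qed.

Lemma bop_eq_fock_tens E Z (A B : tprod T E F -> Z) : bop A -> bop B ->
  (forall x w, A (tens T E F x (e w)) = B (tens T E F x (e w))) -> A = B.
Proof.
move=> bA bB AB; apply: (bop_eq_dense bA bB (@fock_tens_total E)) => z [s ->].
by rewrite !bop_sum //; apply: eq_bigr.
Qed.

Lemma fock_tens_inner_inj E (z z' : tprod T E F) :
  (forall x w, '<< z, tens T E F x (e w) >> = '<< z', tens T E F x (e w) >>) ->
  z = z'.
Proof.
move=> h; apply: tens_inner_inj => x f; have b := bop_tensl T F x.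
rewrite !(adjEr _ _ b); congr ('<< _, _ >>).
by apply: fock_inner_inj => w; rewrite -!(adjEr _ _ b).
Qed.

End FockTensor.

(** * Series of operators and Abel limits *)

Section RealBounds.
Variable R : realType.

Lemma expr_small (q e : R) : 0 <= q < 1 -> 0 < e ->
  exists N, forall k, (N <= k)%N -> q ^+ k < e.
Proof.
move=> /andP[q0 q1] e0.
have /cvgrPdist_lt/(_ e e0)[N _ hN] : (fun k => q ^+ k) @ \oo --> (0 : R).
  by apply: cvg_expr; rewrite ger0_norm.
by exists N => k /hN /=; rewrite sub0r normrN ger0_norm ?exprn_ge0.
Qed.

Lemma limn_esup_le1_bound (u : nat -> R) (s : R) : (forall k, 0 <= u k) ->
  (limn_esup (fun k => (u k `^ (2 * k)%:R^-1)%:E) <= 1)%E -> 1 < s ->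
  exists K, forall k, (K <= k)%N -> u k <= s ^+ (2 * k).
Proof.
move=> u0 hu s1; have : (limn_esup (fun k => (u k `^ (2 * k)%:R^-1)%:E) < s%:E)%E.
  by apply: le_lt_trans hu _; rewrite lte_fin.
move=> /ereal_inf_lt[_ [V [K _ KV] <-] hV].
(* The successor excludes [k = 0], where the exponent [(2 * k)%:R^-1] has the default value 0 and
   the root cannot be undone. *)
exists K.+1 => k Kk.
have /ereal_sup_ubound : [set (u k `^ (2 * k)%:R^-1)%:E%E | k in V]
    (u k `^ (2 * k)%:R^-1)%:E%E by exists k => //; apply: KV; exact: ltnW.
move=> /le_lt_trans/(_ hV); rewrite lte_fin => h.
have k0 : (0 < 2 * k)%N by rewrite muln_gt0 /= (leq_trans _ Kk).
have -> : u k = (u k `^ (2 * k)%:R^-1) ^+ (2 * k).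
  rewrite -powR_mulrn ?powR_ge0 // -powRrM mulVf ?powRr1 //.
  by rewrite pnatr_eq0 -lt0n.
by rewrite lerXn2r ?nnegrE ?powR_ge0 ?ltW // (lt_trans ltr01).
Qed.

(** A constant [C] falls below (1 + e)^(2k) for large k. This serves the Herglotz coefficients,
    whose sums over words of length k are bounded independently of k. *)
Lemma limn_esup_le1 (u : nat -> R) (C : R) : (forall k, 0 <= u k) ->
  (forall k, u k <= C) ->
  (limn_esup (fun k => (u k `^ (2 * k)%:R^-1)%:E) <= 1)%E.
Proof.
move=> u0 uC; apply/lee_addgt0Pr => e e0.
have [N hN] : exists N, forall k, (N <= k)%N -> C <= (1 + e) ^+ (2 * k).
  have e1 : 0 < 1 + e by rewrite addr_gt0.
  have [||M hM] := @expr_small (1 + e)^-1 (`|C| + 1)^-1.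
  - by rewrite invr_ge0 ltW //= invf_lt1 // ltrDl.
  - by rewrite invr_gt0 ltr_wpDl.
  exists M => k Mk; have := hM (2 * k)%N; rewrite (leq_trans Mk) ?leq_pmull //.
  rewrite exprVn ltf_pV2 ?posrE ?ltr_wpDl ?exprn_gt0 ?addr_gt0 // => /(_ isT) h.
  apply: le_trans (ltW h); apply: le_trans (ler_norm _) _.
  by rewrite lerDl.
have e1 : 0 <= 1 + e by rewrite addr_ge0 // ltW.
apply: ge_ereal_inf; exists (ereal_sup [set (u k `^ (2 * k)%:R^-1)%:E%E |
    k in [set k | (N.+1 <= k)%N]]).
  by exists [set k | (N.+1 <= k)%N] => //; exists N.+1.
apply/ereal_supP => _ [k /= Nk <-]; rewrite -EFinD lee_fin.
have k0 : (0 < 2 * k)%N by rewrite muln_gt0 /= (leq_trans _ Nk).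
have -> : 1 + e = ((1 + e) ^+ (2 * k)) `^ (2 * k)%:R^-1.
  rewrite -powR_mulrn // -powRrM mulfV ?powRr1 //.
  by rewrite pnatr_eq0 -lt0n.
apply: ge0_ler_powR; rewrite ?nnegrE ?exprn_ge0 //.
by apply: le_trans (uC k) (hN _ _); exact: ltnW.
Qed.

Lemma geometric_sum_le (q : R) m M : 0 <= q < 1 -> (m <= M)%N ->
  \sum_(m <= k < M) q ^+ k <= q ^+ m / (1 - q).
Proof.
move=> /andP[q0 q1] mM; have q1' : 0 < 1 - q by rewrite subr_gt0.
rewrite ler_pdivlMr //.
suff -> : (\sum_(m <= k < M) q ^+ k) * (1 - q) = q ^+ m - q ^+ M.
  by rewrite gerBl exprn_ge0.
elim: M mM => [|M IH]; first by rewrite leqn0 => /eqP ->; rewrite big_geq // mul0r subrr.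
rewrite leq_eqVlt => /predU1P[->|]; first by rewrite big_geq // mul0r subrr.
rewrite ltnS => mM; rewrite big_nat_recr //= mulrDl IH // exprSr; ring.
Qed.

End RealBounds.

Lemma eq_cvg_seq (V : topologicalType) (u v : nat -> V) (l : V) :
  (forall N, u N = v N) -> u @ \oo --> l -> v @ \oo --> l.
Proof. by move=> uv; have -> : u = v by apply/funext. Qed.

(** * Geometric series of operators and orthogonal series of vectors *)

Section OperatorSeries.
Variable R : realType.
Implicit Types V W : hilbertType R.

Lemma opnorm_sum_le V W (B : nat -> V -> W) m M (c : nat -> R) :
  (forall k, bop (B k)) -> (forall k, (m <= k)%N -> opnorm (B k) <= c k) ->
  opnorm (\sum_(m <= k < M) B k) <= \sum_(m <= k < M) c k.
Proof.
move=> bB Bc; elim: M => [|M IH]; first by rewrite !big_geq // opnorm0.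
have [mM|Mm] := leqP m M; last by rewrite !big_geq // opnorm0.
rewrite !big_nat_recr //=; apply: le_trans (opnorm_add _ _) _ => //.
  exact: bop_bigsum.
by apply: lerD => //; apply: Bc.
Qed.

Lemma opnormN V W (A : V -> W) : opnorm (- A) = opnorm A.
Proof.
rewrite /opnorm; congr (sup (_ @` _)); apply/funext => x.
by rewrite !fctE normrN.
Qed.

Lemma opnormBC V W (A B : V -> W) : opnorm (A - B) = opnorm (B - A).
Proof. by rewrite -opnormN opprB. Qed.

Lemma geometric_op_series V W (B : nat -> V -> W) (q : R) K : 0 <= q < 1 ->
  (forall k, bop (B k)) -> (forall k, (K <= k)%N -> opnorm (B k) <= q ^+ k) ->
  exists2 L, bop L & opnorm (\sum_(k < N) B k - L) @[N --> \oo] --> (0 : R).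
Proof.
move=> q01 bB hB; apply: op_cauchy_cvg => [N|e e0]; first exact: bop_bigsum.
have /andP[q0 q1] := q01; have q1' : 0 < 1 - q by rewrite subr_gt0.
have [N hN] := expr_small q01 (mulr_gt0 e0 q1').
have key m M : (maxn K N <= m)%N -> (m <= M)%N ->
    opnorm (\sum_(k < M) B k - \sum_(k < m) B k) < e.
  rewrite geq_max => /andP[Km Nm] mM.
  rewrite -!(big_mkord xpredT) /= (big_cat_nat (n := m)) //= addrAC subrr add0r.
  apply: le_lt_trans (opnorm_sum_le (c := fun k => q ^+ k) _ bB _) _.
    by move=> k mk; apply: hB; apply: leq_trans Km mk.
  apply: le_lt_trans (geometric_sum_le q01 mM) _.
  by rewrite ltr_pdivrMr // hN.
exists (maxn K N) => m M hm hM; have [mM|Mm] := leqP m M; last first.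
  by apply: key => //; exact: ltnW.
by rewrite opnormBC; apply: key.
Qed.

Lemma pythagoras V (z : nat -> V) m M : (forall i j, i != j -> '<< z i, z j >> = 0) ->
  nrm (\sum_(m <= k < M) z k) ^+ 2 = \sum_(m <= k < M) nrm (z k) ^+ 2.
Proof.
move=> zz; elim: M => [|M IH]; first by rewrite !big_geq // nrm0 expr0n.
have [mM|Mm] := leqP m M; last by rewrite !big_geq // nrm0 expr0n.
rewrite !big_nat_recr //= Re_inner_expand IH.
have -> : '<< z M, \sum_(m <= k < M) z k >> = 0.
  rewrite inner_sumr big_nat_cond big1 // => k /andP[/andP[_ kM] _].
  by apply: zz; rewrite gtn_eqF.
by rewrite mulr0 addr0.
Qed.

Lemma bounded_tail (a : nat -> R) (c : R) : (forall k, 0 <= a k) ->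
  (forall N, \sum_(0 <= k < N) a k <= c) -> forall e : R, 0 < e ->
  exists N, forall M, (N <= M)%N -> \sum_(N <= k < M) a k <= e.
Proof.
move=> a0 ac e e0; pose S := [set \sum_(0 <= k < N) a k | N in [set: nat]].
have hS : has_sup S.
  by split; [exists (\sum_(0 <= k < 0) a k), 0%N|exists c => _ [N _ <-]].
have [_ [N _ <-] hN] := sup_adherent e0 hS.
exists N => M NM; have : \sum_(0 <= k < M) a k <= sup S.
  by apply: ub_le_sup; [case: hS|exists M].
rewrite (big_cat_nat (n := N)) //=; lra.
Qed.

Lemma orth_series_cvg V (z : nat -> V) (c : R) :
  (forall i j, i != j -> '<< z i, z j >> = 0) ->
  (forall N, \sum_(0 <= k < N) nrm (z k) ^+ 2 <= c) ->
  exists l : V, (\sum_(0 <= k < N) z k) @[N --> \oo] --> l.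
Proof.
move=> zz zc; apply: nrm_cauchy_cvg => e e0.
have e2 : 0 < (e / 4) ^+ 2 by rewrite exprn_gt0 // divr_gt0.
have [N hN] := bounded_tail (fun k => sqr_ge0 (nrm (z k))) zc e2.
have e4 : 0 <= e / 4 by rewrite divr_ge0 // ltW.
have key M : (N <= M)%N ->
    nrm (\sum_(0 <= k < M) z k - \sum_(0 <= k < N) z k) <= e / 4.
  move=> NM; rewrite (big_cat_nat (n := N)) //= addrAC subrr add0r.
  rewrite -(@ler_pXn2r _ 2) ?nnegrE ?nrm_ge0 ?e4 //.
  by rewrite pythagoras // hN.
exists N => m M Nm NM; apply: le_lt_trans (nrm_triangle _ (\sum_(0 <= k < N) z k) _) _.
rewrite [X in _ + X]nrmBC; have h1 := key _ Nm; have h2 := key _ NM.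
apply: (@le_lt_trans _ _ (e / 4 + e / 4)); first exact: lerD.
lra.
Qed.

Lemma orth_tail V (y : nat -> V) m b d :
  (forall i j, i != j -> '<< y i, y j >> = 0) ->
  (\sum_(0 <= k < N) y k) @[N --> \oo] --> b -> 0 <= d ->
  (forall M, (m <= M)%N -> \sum_(m <= k < M) nrm (y k) ^+ 2 <= d ^+ 2) ->
  nrm (b - \sum_(0 <= k < m) y k) <= d.
Proof.
move=> yy /cvg_nrmP yb d0 yd; apply/ler_addgt0Pl => e /yb[N hN].
pose M := maxn N m; have mM : (m <= M)%N by rewrite leq_maxr.
apply: le_trans (nrm_triangle _ (\sum_(0 <= k < M) y k) _) _.
rewrite lerD //; first by rewrite nrmBC ltW // hN // leq_maxl.
rewrite (big_cat_nat (n := m)) //= addrAC subrr add0r.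
by rewrite -(@ler_pXn2r _ 2) ?nnegrE ?nrm_ge0 // pythagoras // yd.
Qed.

Lemma bernoulli_le (t : R) k : 0 <= t <= 1 -> 1 - t ^+ k <= k%:R * (1 - t).
Proof.
move=> /andP[t0 t1]; elim: k => [|k IH]; first by rewrite expr0 subrr mul0r.
rewrite exprSr -natr1; have h : 0 <= t ^+ k <= 1.
  by rewrite exprn_ge0 // exprn_ile1.
move: (t ^+ k) (k%:R) IH h => a b IH /andP[a0 a1]; nra.
Qed.

(** Abel's theorem for an orthogonal series. Beyond a fixed degree [N] both series have tails of
    norm at most [e / 4], uniformly in [t] since t^k <= 1; the heads differ by at most [(1 - t) * C]
    by Bernoulli's inequality. *)
Lemma abel_orth V (z : nat -> V) (c : R) (l : V) (g : R -> V) :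
  (forall i j, i != j -> '<< z i, z j >> = 0) ->
  (forall N, \sum_(0 <= k < N) nrm (z k) ^+ 2 <= c) ->
  (\sum_(0 <= k < N) z k) @[N --> \oo] --> l ->
  (forall t, 0 <= t < 1 ->
    (\sum_(0 <= k < N) (t ^+ k)%:C *: z k) @[N --> \oo] --> g t) ->
  g t @[t --> (1 : R)^'-] --> l.
Proof.
move=> zz zc zl gl; apply/cvg_nrm/cvgrPdist_lt => e e0.
have e40 : 0 < e / 4 by rewrite divr_gt0.
have [N hN] := bounded_tail (fun k => sqr_ge0 (nrm (z k))) zc (exprn_gt0 2 e40).
pose C := \sum_(0 <= k < N) k%:R * nrm (z k).
have C0 : 0 <= C by apply: sumr_ge0 => k _; rewrite mulr_ge0 ?nrm_ge0.
have d0 : 0 < e / 4 / (C + 1) by rewrite divr_gt0 // ltr_wpDl.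
near=> t.
have t0 : 0 <= t by apply: ltW; near: t; apply: nbhs_left_gt.
have t1 : t < 1 by near: t; apply: nbhs_left_lt.
have t2 : 1 - e / 4 / (C + 1) < t by near: t; apply: nbhs_left_gt; rewrite gtrBl.
rewrite sub0r normrN ger0_norm ?nrm_ge0 //.
have ht : 0 <= t < 1 by rewrite t0.
have h1 : nrm (l - \sum_(0 <= k < N) z k) <= e / 4 by apply: orth_tail => //; exact: ltW.
have h2 : nrm (g t - \sum_(0 <= k < N) (t ^+ k)%:C *: z k) <= e / 4.
  apply: orth_tail (gl t ht) (ltW e40) _.
    by move=> i j ij; rewrite innerZl innerZr zz // !mulr0.
  move=> M NM; apply: le_trans (hN M NM); apply: ler_sum => k _.
  rewrite nrmZ cabR exprMn ler_piMl ?sqr_ge0 //.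
  by rewrite real_normK ?num_real // exprn_ile1 ?exprn_ge0 ?sqr_ge0 // exprn_ile1 // ltW.
have h3 : nrm (\sum_(0 <= k < N) (t ^+ k)%:C *: z k - \sum_(0 <= k < N) z k) <= e / 4.
  rewrite -sumrB; apply: le_trans (nrm_sum _ _ _) _.
  apply: (@le_trans _ _ ((1 - t) * C)).
    rewrite /C mulr_sumr; apply: ler_sum => k _.
    rewrite -[X in _ - X]scale1r -scalerBl -[1]/(1%:C) -rmorphB nrmZ cabR.
    rewrite mulrA ler_wpM2r ?nrm_ge0 // distrC ger0_norm.
      by rewrite mulrC bernoulli_le // t0 ltW.
    by rewrite subr_ge0 exprn_ile1 // ltW.
  have hC : e / 4 / (C + 1) * (C + 1) = e / 4.
    by rewrite divfK // gt_eqF // ltr_wpDl.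
  have gen (d : R) : 1 - d < t -> 0 < d -> (1 - t) * C <= d * (C + 1) by nra.
  by rewrite -hC gen.
have h4 := nrm_triangle (g t) (\sum_(0 <= k < N) (t ^+ k)%:C *: z k) l.
have h5 := nrm_triangle (\sum_(0 <= k < N) (t ^+ k)%:C *: z k)
  (\sum_(0 <= k < N) z k) l.
rewrite [nrm (_ - l) in X in _ <= _ + X]nrmBC in h5.
apply: le_lt_trans h4 _; apply: le_lt_trans (lerD h2 (le_trans h5 (lerD h3 h1))) _.
lra.
Unshelve. all: by end_near.
Qed.

End OperatorSeries.

(** * Boundary values of free holomorphic functions *)

Section FockSeries.
Variables (R : realType) (n : nat) (F : fock_space R n) (T : hilbert_tensor R).
Variables E Y : hilbertType R.

Local Notation e := (fock_e F).
Local Notation Rw := (monom (creR F)).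
Local Notation Sw := (monom (creL F)).
Local Notation tn := (tens T _ _).

Section Coefficients.
Variable A : seq 'I_n -> E -> Y.
Hypothesis bA : forall w, bop (A w).

Lemma bop_gram k : bop (\sum_(w : k.-tuple 'I_n) (adj (A w) \o A w)).
Proof. by apply: bop_bigsum => w _; apply: bop_comp => //; apply: adj_bop. Qed.
(** Homogeneous part of degree [k], evaluated at the right creation operators. *)
Definition fblock k : tprod T E F -> tprod T Y F :=
  \sum_(w : k.-tuple 'I_n) optens T (A w) (Rw w).

Lemma fblock_bop k : bop (fblock k).
Proof. by apply: bop_bigsum => w _; apply: optens_bop => //; exact: Rw_bop. Qed.

Lemma fblockE k x v : fblock k (tn x (e v)) =
  \sum_(w : k.-tuple 'I_n) tn (A w x) (e (v ++ rev w)).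
Proof.
rewrite /fblock fct_sumE; apply: eq_bigr => w _.
by rewrite optensE ?RwE //; exact: Rw_bop.
Qed.

(* The operators [R_w], [|w| = k], are isometries with orthogonal ranges. *)
Lemma fblock_nrm k z : nrm (fblock k z) ^+ 2 <=
  opnorm (\sum_(w : k.-tuple 'I_n) (adj (A w) \o A w)) * nrm z ^+ 2.
Proof.
have bR w : bop (optens T (idfun : Y -> Y) (Rw w)).
  by apply: optens_bop; [exact: bop_id|exact: Rw_bop].
have bAi w : bop (optens T (A w) (idfun : F -> F)).
  by apply: optens_bop; [exact: bA|exact: bop_id].
pose u w := optens T (A w) (idfun : F -> F) z.
have -> : fblock k z = \sum_(w : k.-tuple 'I_n) optens T (idfun : Y -> Y) (Rw w) (u w).
  rewrite /fblock fct_sumE; apply: eq_bigr => w _; rewrite /u.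
  rewrite -[RHS]/((optens T idfun (Rw w) \o optens T (A w) idfun) z).
  by rewrite -optens_comp //; [exact: bop_id|exact: Rw_bop|exact: bop_id].
have orth (w w' : k.-tuple 'I_n) : '<< optens T (idfun : Y -> Y) (Rw w) (u w),
    optens T (idfun : Y -> Y) (Rw w') (u w') >> =
    if w == w' then '<< u w, u w >> else 0.
  rewrite adjEr // optens_adj; [|exact: bop_id|exact: Rw_bop].
  rewrite -[optens T _ _ (optens T _ _ _)]/((optens T (adj idfun) (adj (Rw w')) \o
    optens T idfun (Rw w)) (u w)).
  rewrite -optens_comp; try exact: adj_bop (bop_id _); try exact: bop_id;
    try exact: adj_bop (Rw_bop _ _); try exact: Rw_bop.
  rewrite adj_id Rw_orth ?size_tuple // eq_sym val_eqE.
  case: eqP => [->|_]; first by rewrite optens_id.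
  by rewrite optens0r ?inner0l //; exact: bop_id.
rewrite nrm_sqE inner_suml.
have -> : \sum_(w : k.-tuple 'I_n) '<< optens T (idfun : Y -> Y) (Rw w) (u w),
    \sum_(w' : k.-tuple 'I_n) optens T (idfun : Y -> Y) (Rw w') (u w') >> =
    '<< optens T (\sum_(w : k.-tuple 'I_n) (adj (A w) \o A w)) (idfun : F -> F) z, z >>.
  rewrite optens_suml; last exact: bop_id; last first.
    by move=> w; apply: bop_comp => //; apply: adj_bop.
  rewrite fct_sumE inner_suml; apply: eq_bigr => w _.
  rewrite inner_sumr (bigD1 w) //= orth eqxx big1 ?addr0; last first.
    by move=> w' ww'; rewrite orth eq_sym (negbTE ww').
  rewrite -[X in optens T _ X]/(idfun \o (idfun : F -> F)).
  rewrite optens_comp //; try exact: bop_id; last by apply: adj_bop.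
  by rewrite /u /= adjEr // optens_adj ?adj_id //; exact: bop_id.
apply: le_trans (Re_le_cab _) _; apply: le_trans (cauchy_schwarz _ _) _.
rewrite expr2 mulrA ler_wpM2r ?nrm_ge0 //.
apply: le_trans (opnorm_nrm _ _) _.
  by apply: optens_bop; [exact: bop_gram|exact: bop_id].
rewrite ler_wpM2r ?nrm_ge0 //; apply: opnorm_optens_idr.
exact: bop_gram.
Qed.

Lemma monom_scaled_sum r k :
  \sum_(w : k.-tuple 'I_n) optens T (A w) (monom (scaled_creR F r) w) =
  (r ^+ k)%:C *: fblock k.
Proof.
rewrite /fblock scaler_sumr; apply: eq_bigr => w _.
by rewrite monom_scaled size_tuple optensZr //; exact: Rw_bop.
Qed.

Lemma fpart_bop r N : bop (\sum_(k < N) \sum_(w : k.-tuple 'I_n)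
  optens T (A w) (monom (scaled_creR F r) w)).
Proof.
apply: bop_bigsum => k _; rewrite monom_scaled_sum.
by apply: bop_scale; exact: fblock_bop.
Qed.

End Coefficients.

Section FreeHol.
Variable A : free_hol n E Y.
Let bA := @coef_bop _ _ _ _ A.

Lemma root_bound r : 0 <= r < 1 -> exists2 q : R, 0 <= q < 1 &
  exists K, forall k, (K <= k)%N ->
  r ^+ (2 * k) * opnorm (\sum_(w : k.-tuple 'I_n) (adj (A w) \o A w)) <= q ^+ (2 * k).
Proof.
move=> /andP[r0 r1]; have r1' : 0 < 1 + r by rewrite ltr_wpDr.
(* Chosen so that [s > 1], as the limsup bound requires, while the ratio [r * s] stays below 1. *)
pose s := 2 / (1 + r).
have s1 : 1 < s by rewrite ltr_pdivlMr // mul1r; lra.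
exists (r * s).
  apply/andP; split; first by rewrite mulr_ge0 // ltW // (lt_trans ltr01).
  by rewrite /s mulrA ltr_pdivrMr //; lra.
have [|K hK] := limn_esup_le1_bound _ (coef_limsup A) s1.
  by move=> k; apply/opnorm_ge0/bop_gram.
by exists K => k Kk; rewrite exprMn ler_wpM2l ?exprn_ge0 // hK.
Qed.

(** By [fblock_nrm] and [root_bound] the block of degree k, scaled by r^k, eventually has norm at
    most q^k. The series thus converges in norm and [fh_eval] is its sum instead of the default
    value. *)
Lemma fh_eval_spec r : 0 <= r < 1 -> bop (fh_eval T A (scaled_creR F r)) /\
  opnorm (\sum_(k < N) \sum_(w : k.-tuple 'I_n)
    optens T (A w) (monom (scaled_creR F r) w) - fh_eval T A (scaled_creR F r))
  @[N --> \oo] --> (0 : R).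
Proof.
move=> r01; have [q q01 [K hK]] := root_bound r01.
have /andP[r0 r1] := r01; have /andP[q0 q1] := q01.
have [||L bL hL] := @geometric_op_series _ _ _
  (fun k => (r ^+ k)%:C *: fblock A k) q K q01.
- by move=> k; apply: bop_scale; apply: fblock_bop.
- move=> k Kk; have bB := fblock_bop bA k.
  apply: opnorm_le; [exact: bop_scale| |exact: exprn_ge0].
  move=> z; rewrite fctE nrmZ cabR ger0_norm ?exprn_ge0 //.
  rewrite -(@ler_pXn2r _ 2) ?nnegrE ?mulr_ge0 ?nrm_ge0 ?exprn_ge0 //.
  rewrite !exprMn -!exprM ![(k * 2)%N]mulnC.
  apply: le_trans (ler_wpM2l _ (fblock_nrm bA k z)) _; first exact: exprn_ge0.
  by rewrite mulrA ler_wpM2r ?sqr_ge0 // hK.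
have hL' : opnorm (\sum_(k < N) \sum_(w : k.-tuple 'I_n)
    optens T (A w) (monom (scaled_creR F r) w) - L) @[N --> \oo] --> (0 : R).
  apply: eq_cvg_seq hL => N; congr (opnorm (_ - _)).
  by apply: eq_bigr => k _; rewrite monom_scaled_sum.
suff -> : fh_eval T A (scaled_creR F r) = L by [].
by apply: oplimE => // N; apply: fpart_bop.
Qed.

Lemma fh_eval_bop r : 0 <= r < 1 -> bop (fh_eval T A (scaled_creR F r)).
Proof. by move=> /fh_eval_spec[]. Qed.

(** Degree [k] part of Theta(R) applied to x ⊗ e_v. Its norm does not depend on [v], and parts of
    different degree are orthogonal, as Abel's theorem requires. *)
Definition tailv x v k : tprod T Y F :=
  \sum_(w : k.-tuple 'I_n) tn (A w x) (e (v ++ rev w)).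

Lemma fh_eval_tens r x v : 0 <= r < 1 ->
  (\sum_(0 <= k < N) (r ^+ k)%:C *: tailv x v k) @[N --> \oo] -->
  fh_eval T A (scaled_creR F r) (tn x (e v)).
Proof.
move=> r01; have [bL hL] := fh_eval_spec r01.
apply: eq_cvg_seq (@op_cvg_pt _ _ _ _ _ (tn x (e v)) (fpart_bop bA r) bL hL) => N /=.
rewrite big_mkord fct_sumE; apply: eq_bigr => k _.
by rewrite monom_scaled_sum // -[LHS]/(_ *: fblock A k (tn x (e v))) fblockE.
Qed.

Lemma tailv_inner x y v k :
  '<< tailv x v k, tailv y v k >> = \sum_(w : k.-tuple 'I_n) '<< A w x, A w y >>.
Proof.
rewrite /tailv inner_suml; apply: eq_bigr => w _.
rewrite inner_sumr (bigD1 w) //= tens_inner fock_orthonormal eqxx mulr1.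
rewrite big1 ?addr0 // => w' ww'; rewrite tens_inner fock_orthonormal.
rewrite eqseq_cat // eqxx (can_eq revK) val_eqE eq_sym (negbTE ww') mulr0 //.
Qed.

Lemma tailv_orth x y v i j : i != j -> '<< tailv x v i, tailv y v j >> = 0.
Proof.
move=> ij; rewrite inner_suml big1 // => w _; rewrite inner_sumr big1 // => w' _.
rewrite tens_inner fock_orthonormal; case: eqP; rewrite ?mulr0 //.
move=> /(congr1 size); rewrite !size_cat !size_rev !size_tuple => /addnI ij'.
by rewrite ij' eqxx in ij.
Qed.

Lemma tailv_nrm x v k :
  nrm (tailv x v k) ^+ 2 = \sum_(w : k.-tuple 'I_n) nrm (A w x) ^+ 2.
Proof.
rewrite nrm_sqE tailv_inner raddf_sum /=.
by apply: eq_bigr => w _; rewrite nrm_sqE.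
Qed.

Section H2.
Variable c : R.
Hypothesis c0 : 0 <= c.
Hypothesis Ac : forall N, ople (\sum_(k < N) \sum_(w : k.-tuple 'I_n) (adj (A w) \o A w))
  (c%:C *: (idfun : E -> E)).

Lemma tailv_bound x v N :
  \sum_(0 <= k < N) nrm (tailv x v k) ^+ 2 <= c * nrm x ^+ 2.
Proof.
rewrite big_mkord -lecR -subr_ge0.
have := Ac N x; congr (0 <= _).
rewrite !fctE innerBl innerZl inner_nrm -rmorphM /=; congr (_ - _).
rewrite fct_sumE inner_suml rmorph_sum /=; apply: eq_bigr => k _.
rewrite tailv_nrm fct_sumE inner_suml rmorph_sum /=; apply: eq_bigr => w _.
by rewrite /= -adjEr ?inner_nrm //; apply: adj_bop.
Qed.

Lemma Gamma_exists : exists2 G : E -> tprod T Y F, bop G &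
  forall x, (\sum_(0 <= k < N) \sum_(w : k.-tuple 'I_n) tn (A w x) (e w))
    @[N --> \oo] --> G x.
Proof.
have ex x : exists l : tprod T Y F, (\sum_(0 <= k < N) tailv x [::] k) @[N --> \oo] --> l.
  apply: orth_series_cvg (tailv_bound x [::]).
  by move=> i j; apply: tailv_orth.
have /choice[G hG] := ex.
have bflip : bop (optens T (idfun : Y -> Y) (flip F)).
  by apply: optens_bop; [exact: bop_id|exact: flip_bop].
have bG : bop G.
  apply: (@bop_bound _ _ _ _ (Num.sqrt c)); last first.
  - move=> x; apply/ler_addgt0Pl => d d0.
    have /cvg_nrmP/(_ d d0)[N /(_ N (leqnn N)) hN] := hG x.
    have -> : G x = \sum_(0 <= k < N) tailv x [::] k - (\sum_(0 <= k < N) tailv x [::] k - G x).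
      by rewrite opprB addrC subrK.
    apply: le_trans (nrmB _ _) _; rewrite addrC lerD ?(ltW hN) //.
    rewrite -(@ler_pXn2r _ 2) ?nnegrE ?mulr_ge0 ?nrm_ge0 ?sqrtr_ge0 //.
    rewrite exprMn sqr_sqrtr // pythagoras ?tailv_bound //.
    by move=> i j; apply: tailv_orth.
  - exact: sqrtr_ge0.
  move=> a x y; apply: (cvg_uniq (hG _)).
  have -> : (fun N => \sum_(0 <= k < N) tailv (a *: x + y) [::] k) =
    (fun N => a *: (\sum_(0 <= k < N) tailv x [::] k) + \sum_(0 <= k < N) tailv y [::] k).
    apply/funext => N; rewrite scaler_sumr -big_split /=; apply: eq_bigr => k _.
    rewrite /tailv scaler_sumr -big_split /=; apply: eq_bigr => w _.
    by rewrite bopD // bopZ // linearDl linearZl_LR.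
  by apply: cvgD; [apply: cvgZr|].
(* The limit built so far carries the vectors [e (rev w)], as [tailv x [::]] does; the flip restores
   [e w]. *)
exists (optens T (idfun : Y -> Y) (flip F) \o G); first exact: bop_comp.
move=> x; apply: eq_cvg_seq (cvg_bop bflip (hG x)) => N; rewrite bop_sum //.
apply: eq_bigr => k _; rewrite /tailv bop_sum //; apply: eq_bigr => w _.
by rewrite optensE ?flipE /= ?revK //; [exact: bop_id|exact: flip_bop].
Qed.

Variable G : E -> tprod T Y F.
Hypothesis bG : bop G.
Hypothesis hG : forall x, (\sum_(0 <= k < N) \sum_(w : k.-tuple 'I_n) tn (A w x) (e w))
    @[N --> \oo] --> G x.

Lemma SwU_bop v : bop (optens T (idfun : Y -> Y) (Sw v \o flip F)).
Proof.
apply: optens_bop; first exact: bop_id.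
by apply: bop_comp; [exact: Sw_bop|exact: flip_bop].
Qed.

Lemma tailv_cvg x v : (\sum_(0 <= k < N) tailv x v k) @[N --> \oo] -->
  optens T (idfun : Y -> Y) (Sw v \o flip F) (G x).
Proof.
apply: eq_cvg_seq (cvg_bop (SwU_bop v) (@hG x)) => N; rewrite bop_sum; last exact: SwU_bop.
apply: eq_bigr => k _; rewrite /tailv bop_sum; last exact: SwU_bop.
apply: eq_bigr => w _; rewrite optensE /= ?flipE ?SwE //; first exact: bop_id.
by apply: bop_comp; [exact: Sw_bop|exact: flip_bop].
Qed.

Lemma fh_eval_radial x v :
  fh_eval T A (scaled_creR F r) (tn x (e v)) @[r --> (1 : R)^'-] -->
  optens T (idfun : Y -> Y) (Sw v \o flip F) (G x).
Proof.
apply: (abel_orth (z := tailv x v)) (tailv_bound x v) (@tailv_cvg x v) _.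
  by move=> i j; apply: tailv_orth.
by move=> t t01; apply: fh_eval_tens.
Qed.

End H2.
End FreeHol.
End FockSeries.

(** * Positivity and the Poisson kernel *)

Section Polarization.
Variable R : realType.
Implicit Types V W Z : hilbertType R.

(** Polarization: x + y gives <Ax, y> = - <Ay, x>, while x + i y gives <Ax, y> = <Ay, x>. *)
Lemma quadratic_eq0 V (A : V -> V) : bop A -> (forall z, '<< A z, z >> = 0) ->
  A = 0.
Proof.
move=> bA h; apply/funext => x; apply: inner_eq0 => y.
have h1 := h (x + y); have h2 := h (x + 'i%C *: y).
rewrite bopD // !innerDl !innerDr !h add0r addr0 in h1.
rewrite bopD // bopZ // !innerDl !innerDr !innerZl !innerZr !h !mulr0 add0r addr0 in h2.
have ci : Num.conj ('i%C : R[i]) = - 'i%C by rewrite complexiE conjCi.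
rewrite ci mulNr in h2.
have : 'i%C * ('<< A y, x >> - '<< A x, y >>) = 0 by rewrite mulrBr addrC.
move=> /eqP; rewrite mulf_eq0 => /orP[/eqP/(congr1 (@complex.Im R))/= /eqP|].
  by rewrite oner_eq0.
rewrite subr_eq0 => /eqP h3; move: h1; rewrite h3 -mulr2n => /eqP.
by rewrite mulrn_eq0 => /eqP.
Qed.

Lemma quadratic_inj V (A B : V -> V) : bop A -> bop B ->
  (forall z, '<< A z, z >> = '<< B z, z >>) -> A = B.
Proof.
move=> bA bB AB; apply/subr0_eq; apply: quadratic_eq0; first exact: bop_sub.
by move=> z; rewrite innerBl AB subrr.
Qed.

Lemma pos_selfadj V (A : V -> V) : bop A -> (forall z, '<< A z, z >> \is Num.real) ->
  adj A = A.
Proof.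
move=> bA rA; apply: quadratic_inj => //; first exact: adj_bop.
by move=> z; rewrite -adjEr // innerC (CrealP (rA z)).
Qed.

Lemma isometry_adjK V W (A : V -> W) : bop A ->
  (forall x, nrm (A x) = nrm x) -> adj A \o A = idfun.
Proof.
move=> bA nA; apply: quadratic_inj; [exact: (bop_comp (adj_bop bA))|exact: bop_id|].
by move=> z /=; rewrite -adjEr // !inner_nrm nA.
Qed.

Lemma cvg_sumC T (G : set_system T) {FG : Filter G} I (s : seq I)
  (u : I -> T -> R[i]) (l : I -> R[i]) :
  (forall i, (fun t => cab (u i t - l i)) @ G --> (0 : R)) ->
  (fun t => cab (\sum_(i <- s) u i t - \sum_(i <- s) l i)) @ G --> (0 : R).
Proof.
move=> ul; apply: (@squeeze_cvgr _ _ _ _ (fun=> 0)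
    (fun t => \sum_(i <- s) cab (u i t - l i))).
- near=> t; rewrite cab_ge0 -sumrB /=.
  elim/big_rec2: _ => [|i x y _ h]; first by rewrite cab0.
  by apply: le_trans (cabD _ _) _; rewrite lerD2l.
- exact: cvg_cst.
elim: s => [|i s IH].
  rewrite (_ : (fun t => _) = fun=> 0); first exact: cvg_cst.
  by apply/funext => t; rewrite big_nil.
rewrite (_ : (fun t => _) = fun t => cab (u i t - l i) +
    \sum_(i <- s) cab (u i t - l i)).
  by rewrite -[X in _ --> X]addr0; apply: cvgD.
by apply/funext => t; rewrite big_cons.
Unshelve. all: by end_near.
Qed.

(** By density the vectors z_i may be taken as finite sums of elementary tensors. A common
    orthonormal system for all their second factors splits the form of [U] into finitely many
    nonnegative forms of [u]. Stating it for [tlike] maps covers amplification on either side. *)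
Lemma pos_ampliation V W Z (b : V -> W -> Z) m (u : 'I_m -> 'I_m -> V -> V)
  (U : 'I_m -> 'I_m -> Z -> Z) : tlike b ->
  dense [set z | exists s : seq (V * W), z = \sum_(p <- s) b p.1 p.2] ->
  (forall i j, bop (u i j)) -> (forall i j, bop (U i j)) ->
  (forall i j x y, U i j (b x y) = b (u i j x) y) ->
  op_positive u -> op_positive U.
Proof.
move=> tb db bu bU Uu pu z.
have /choice[y hy] : forall i : 'I_m, exists y : nat -> Z,
    (forall k, exists s : seq (V * W), y k = \sum_(p <- s) b p.1 p.2) /\
    y @ \oo --> z i.
  by move=> i; have [y Dy yz] := dense_seq (z i) db; exists y.
apply: (@cvgC_ge0 _ _ \oo _ (fun k => \sum_(i < m) \sum_(j < m)
    '<< U i j (y j k), y i k >>)).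
  apply/cvg_cab; apply: cvg_sumC => i; apply: cvg_sumC => j.
  apply/cvg_cab; apply: cvg_inner; last exact: (hy i).2.
  by apply: cvg_bop => //; exact: (hy j).2.
near=> k.
have /choice[s hs] : forall i : 'I_m, exists s : seq (V * W),
    y i k = \sum_(p <- s) b p.1 p.2 by move=> i; exact: (hy i).1.
pose L := flatten [seq [seq p.2 | p <- s i] | i <- enum 'I_m].
have [q [f [of_ dec]]] := orthon_decomp L.
have /choice[x hx] : forall i : 'I_m, exists x : nat -> V,
    forall (Z : lmodType R[i]) (b : V -> W -> Z), bilin b ->
    \sum_(p <- s i) b p.1 p.2 = \sum_(l < q) b (x l) (f l).
  move=> i; apply: dec => p ps; apply/flattenP.
  exists [seq p.2 | p <- s i]; last exact: map_f.
  by apply/mapP; exists i; rewrite ?mem_enum.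
have yx i : y i k = \sum_(l < q) b (x i l) (f l) by rewrite hs (hx i _ b tb.1).
have Uyx i j : '<< U i j (y j k), y i k >> = \sum_(l < q) '<< u i j (x j l), x i l >>.
  rewrite !yx bop_sum // inner_suml; apply: eq_bigr => l _.
  rewrite Uu inner_sumr (bigD1 l) //= tb.2 of_ // eqxx mulr1 big1 ?addr0 //.
  move=> l' ll'; rewrite tb.2 of_ //.
  by rewrite (_ : (l : nat) == l' = false) ?mulr0 // eq_sym; apply: negbTE.
rewrite (eq_bigr (fun i => \sum_(l < q) \sum_(j < m) '<< u i j (x j l), x i l >>)).
  by rewrite exchange_big /=; apply: sumr_ge0 => l _; exact: pu.
by move=> i _; rewrite exchange_big /=; apply: eq_bigr => j _; exact: Uyx.
Unshelve. all: by end_near.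
Qed.

End Polarization.

Section OptensPositive.
Variables (R : realType) (T : hilbert_tensor R).
Implicit Types V W : hilbertType R.

Lemma optensl_positive V W m (u : 'I_m -> 'I_m -> V -> V) :
  (forall i j, bop (u i j)) -> op_positive u ->
  op_positive (fun i j => optens T (u i j) (idfun : W -> W)).
Proof.
move=> bu; apply: (pos_ampliation (b := tens T V W)) => //.
- exact: tens_tlike.
- exact: tens_total.
- by move=> i j; apply: optens_bop => //; exact: bop_id.
- by move=> i j x y; rewrite optensE //; exact: bop_id.
Qed.

Lemma optensr_positive V W m (u : 'I_m -> 'I_m -> V -> V) :
  (forall i j, bop (u i j)) -> op_positive u ->
  op_positive (fun i j => optens T (idfun : W -> W) (u i j)).
Proof.
move=> bu; apply: (pos_ampliation (b := fun x y => tens T W V y x)) => //.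
- by apply: tlike_swap; exact: tens_tlike.
- have := @tens_total _ T W V; congr dense; apply/seteqP.
  split=> z /= [s ->]; exists [seq (p.2, p.1) | p <- s]; rewrite big_map //.
- by move=> i j; apply: optens_bop => //; exact: bop_id.
- by move=> i j x y; rewrite optensE //; exact: bop_id.
Qed.

Lemma optens_ge0 V W (A : V -> V) : bop A -> (forall z, 0 <= '<< A z, z >>) ->
  forall z, 0 <= '<< optens T A (idfun : W -> W) z, z >>.
Proof.
move=> bA A0 z.
have := @optensl_positive V W 1 (fun _ _ => A) (fun _ _ => bA).
rewrite /op_positive => /(_ _ (fun=> z)).
rewrite !big_ord1; apply=> v; rewrite !big_ord1; exact: A0.
Qed.

End OptensPositive.

(** * The Poisson kernel of a pure row contraction *)

Section PoissonKernel.
Variables (R : realType) (n : nat) (F : fock_space R n) (T : hilbert_tensor R).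
Variable H : hilbertType R.
Variables (X : 'I_n -> H -> H) (D : H -> H).
Hypothesis bX : forall i, bop (X i).
Hypothesis bD : bop D.
Hypothesis aD : adj D = D.
Hypothesis DD : D \o D = idfun - \sum_(i < n) (X i \o adj (X i)).

Local Notation e := (fock_e F).
Local Notation tn := (tens T F H).
Let bXw w : bop (monom X w) := monom_bop w bX.

(** Quadratic form of the sum of X_w X_w^* over the words of length [k]. Its convergence to 0 is the
    purity of the row contraction. *)
Definition wsum k h := \sum_(w : k.-tuple 'I_n) nrm (adj (monom X w) h) ^+ 2.

Hypothesis wsum0 : forall h, wsum k h @[k --> \oo] --> (0 : R).

Definition kblock h k : tprod T F H :=
  \sum_(w : k.-tuple 'I_n) tn (e (rev w)) (D (adj (monom X w) h)).

Lemma defect_nrm y : nrm (D y) ^+ 2 = nrm y ^+ 2 - \sum_(i < n) nrm (adj (X i) y) ^+ 2.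
Proof.
rewrite nrm_opE // aD -[D (D y)]/((D \o D) y) DD.
rewrite innerBl raddfB /= -nrm_sqE fct_sumE inner_suml raddf_sum /=; congr (_ - _).
apply: eq_bigr => i _; rewrite nrm_opE; last exact: adj_bop.
by rewrite adjK.
Qed.

(** D^2 = I - sum X_i X_i^* turns the norm into a difference in which a letter has been appended to
    each word, so the sum over degrees telescopes. *)
Lemma kblock_nrm h k : nrm (kblock h k) ^+ 2 = wsum k h - wsum k.+1 h.
Proof.
have -> : nrm (kblock h k) ^+ 2 = \sum_(w : k.-tuple 'I_n) nrm (D (adj (monom X w) h)) ^+ 2.
  rewrite nrm_sqE inner_suml raddf_sum /=; apply: eq_bigr => w _.
  rewrite inner_sumr (bigD1 w) //= tens_inner fock_orthonormal eqxx mul1r.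
  rewrite big1 ?addr0 -?nrm_sqE // => w' ww'.
  rewrite tens_inner fock_orthonormal (can_eq revK) val_eqE eq_sym.
  by rewrite (negbTE ww') mul0r.
rewrite /wsum (big_tuple_rcons _ (fun w => nrm (adj (monom X w) h) ^+ 2)).
rewrite exchange_big /= -sumrB; apply: eq_bigr => w _.
rewrite defect_nrm; congr (_ - _); apply: eq_bigr => i _.
by rewrite adj_monom_rcons.
Qed.

Lemma kblock_orth h h' i j : i != j -> '<< kblock h i, kblock h' j >> = 0.
Proof.
move=> ij; rewrite inner_suml big1 // => w _; rewrite inner_sumr big1 // => w' _.
rewrite tens_inner fock_orthonormal; case: eqP; rewrite ?mul0r //.
move=> /(congr1 size); rewrite !size_rev !size_tuple => ij'.
by rewrite ij' eqxx in ij.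
Qed.

Lemma wsum_0 h : wsum 0 h = nrm h ^+ 2.
Proof.
by rewrite /wsum (big_tuple0 (fun w => nrm (adj (monom X w) h) ^+ 2)) /= adj_id.
Qed.

Lemma kblock_sum h N :
  \sum_(0 <= k < N) nrm (kblock h k) ^+ 2 = nrm h ^+ 2 - wsum N h.
Proof.
elim: N => [|N IH]; first by rewrite big_geq // wsum_0 subrr.
by rewrite big_nat_recr //= IH kblock_nrm addrA subrK.
Qed.

Lemma poisson_kernel_exists : exists2 K : H -> tprod T F H, bop K &
  (forall h, nrm (K h) = nrm h) /\
  forall h, (\sum_(0 <= k < N) kblock h k) @[N --> \oo] --> K h.
Proof.
have ex h : exists l : tprod T F H, (\sum_(0 <= k < N) kblock h k) @[N --> \oo] --> l.
  apply: (orth_series_cvg (c := nrm h ^+ 2)) => [i j|N]; first exact: kblock_orth.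
  rewrite kblock_sum gerBl; apply: sumr_ge0 => w _; exact: sqr_ge0.
have /choice[K hK] := ex.
(* The squared norm of a partial sum is |h|^2 minus [wsum N h], and purity makes the second term
   vanish in the limit. *)
have nK h : nrm (K h) = nrm h.
  apply/eqP; rewrite -(@eqrXn2 _ 2) ?nrm_ge0 //; apply/eqP/complexI.
  rewrite -[LHS]inner_nrm.
  have c1 : '<< \sum_(0 <= k < N) kblock h k, \sum_(0 <= k < N) kblock h k >>
      @[N --> \oo] --> ('<< K h, K h >> : R[i]^o) by apply: cvg_inner.
  have c2 : (fun N => '<< \sum_(0 <= k < N) kblock h k, \sum_(0 <= k < N) kblock h k >>)
      @ \oo --> ((nrm h ^+ 2)%:C : R[i]^o).
    apply/cvg_cab; have := wsum0 h; apply: eq_cvg_seq => N.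
    rewrite inner_nrm pythagoras; last by move=> i j; exact: kblock_orth.
    rewrite kblock_sum -rmorphB /= cabR addrAC subrr add0r normrN ger0_norm //.
    by apply: sumr_ge0 => w _; exact: sqr_ge0.
  exact: (cvg_unique (@norm_hausdorff _ (R[i]^o)) c1 c2).
exists K; last by split.
apply: (@bop_bound _ _ _ _ 1) => // [a x y|x]; last by rewrite nK mul1r.
apply: (cvg_uniq (hK _)).
have : (fun N => a *: (\sum_(0 <= k < N) kblock x k) + \sum_(0 <= k < N) kblock y k)
    @ \oo --> a *: K x + K y by apply: cvgD => //; apply: cvgZr.
apply: eq_cvg_seq => N; rewrite scaler_sumr -big_split /=; apply: eq_bigr => k _.
rewrite /kblock scaler_sumr -big_split /=; apply: eq_bigr => w _.
have bA := adj_bop (bXw w); rewrite (bopD _ _ bA) (bopZ _ _ bA) (bopD _ _ bD) (bopZ _ _ bD).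
by rewrite linearDr linearZr_LR.
Qed.

Variable K : H -> tprod T F H.
Hypothesis bK : bop K.
Hypothesis nK : forall h, nrm (K h) = nrm h.
Hypothesis hK : forall h, (\sum_(0 <= k < N) kblock h k) @[N --> \oo] --> K h.

Lemma poisson_kernelE : defect X = D -> poisson_kernel F T X = K.
Proof.
move=> dD; apply/funext => h; rewrite /poisson_kernel dD.
apply/cvg_lim; first exact: norm_hausdorff.
by have := @hK h; apply: eq_cvg_seq => N; rewrite big_mkord.
Qed.

(** R_i^* removes the last letter of [rev w], which is the first letter of [w], and the adjoint of
    X_(i w) is X_w^* X_i^*. The block of degree k + 1 of K h is thus sent to the block of degree k
    of K X_i^* h. *)
Lemma kernel_intertwine i : K \o adj (X i) =
  optens T (adj (creR F i)) (idfun : H -> H) \o K.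
Proof.
apply/funext => h /=.
have bR : bop (optens T (adj (creR F i)) (idfun : H -> H)).
  by apply: optens_bop; [apply: adj_bop; exact: creR_bop|exact: bop_id].
apply: (cvg_uniq (@hK (adj (X i) h))).
have h1 : optens T (adj (creR F i)) (idfun : H -> H) (\sum_(0 <= k < N) kblock h k)
    @[N --> \oo] --> optens T (adj (creR F i)) (idfun : H -> H) (K h).
  exact: cvg_bop.
(* The index may be shifted because R_i^* annihilates the block of degree 0. *)
rewrite -cvg_shiftS in h1; move: h1; apply: eq_cvg_seq => N /=.
rewrite big_nat_recl // bopD // [X in _ + X]bop_sum //.
have -> : optens T (adj (creR F i)) (idfun : H -> H) (kblock h 0) = 0.
  rewrite /kblock bop_sum //; rewrite big1 // => w _.
  rewrite optensE ?(tuple0 w) /= ?adj_creR0 ?linear0l //; last exact: bop_id.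
  by apply: adj_bop; exact: creR_bop.
rewrite add0r; apply: eq_bigr => k _; rewrite /kblock bop_sum //.
rewrite (big_tupleS _ (fun w => optens T (adj (creR F i)) (idfun : H -> H)
  (tn (e (rev w)) (D (adj (monom X w) h))))) (bigD1 i) //=.
rewrite [X in _ + X]big1 ?addr0.
  apply: eq_bigr => w _; rewrite optensE; [|by apply: adj_bop; exact: creR_bop|exact: bop_id].
  by rewrite rev_cons adj_creRE eqxx adj_comp.
move=> j ji; rewrite big1 // => w _.
rewrite optensE; [|by apply: adj_bop; exact: creR_bop|exact: bop_id].
by rewrite rev_cons adj_creRE eq_sym (negbTE ji) linear0l.
Qed.

(** The adjoint of the intertwining relation moves K^* past one letter at a time, and K^* K = I
    starts the induction. *)
Lemma kernel_monom w : adj K \o optens T (monom (creR F) w) (idfun : H -> H) \o K = monom X w.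
Proof.
have bi := @bop_id R H.
have bR := creR_bop F.
have int i : X i \o adj K = adj K \o optens T (creR F i) (idfun : H -> H).
  have bXi := adj_bop (@bX i); have bRi := adj_bop (bR i).
  have bO : bop (optens T (adj (creR F i)) (idfun : H -> H)) by apply: optens_bop.
  rewrite -{1}[X i]adjK // -adj_comp // kernel_intertwine adj_comp //.
  by rewrite optens_adj // adjK // adj_id.
elim: w => [|i w IH] /=; first by rewrite optens_id; exact: isometry_adjK.
have -> : optens T (creR F i \o monom (creR F) w) (idfun : H -> H) =
    optens T (creR F i) (idfun : H -> H) \o optens T (monom (creR F) w) (idfun : H -> H).
  by rewrite -optens_comp //; exact: Rw_bop.
rewrite -IH; rewrite -[LHS]/((adj K \o optens T (creR F i) (idfun : H -> H)) \o
  optens T (monom (creR F) w) (idfun : H -> H) \o K).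
by rewrite -int.
Qed.

End PoissonKernel.

(** * The row contraction s R: purity and defect operator *)

Section ScaledKernel.
Variables (R : realType) (n : nat) (F : fock_space R n) (T : hilbert_tensor R).
Variable s : R.
Hypothesis s01 : 0 <= s < 1.

Local Notation e := (fock_e F).
Local Notation X := (scaled_creR F s).
Let bX := scaled_creR_bop F s.

Let P : F -> F := fun h => '<< h, e [::] >> *: e [::].

Lemma vacuum_bop : bop P.
Proof.
apply: (@bop_bound _ _ _ _ (nrm (e [::]) * nrm (e [::]))) => [a x y||x].
- by rewrite /P innerDl innerZl scalerDl scalerA.
- by rewrite mulr_ge0 ?nrm_ge0.
- by rewrite nrmZ mulrAC ler_wpM2r ?nrm_ge0 // mulrC cauchy_schwarz.
Qed.

Lemma vacuumE w : P (e w) = if w == [::] then e w else 0.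
Proof.
rewrite /P fock_orthonormal; case: eqP => [->|_]; first by rewrite scale1r.
by rewrite scale0r.
Qed.

Lemma sum_creR_vacuum : \sum_(i < n) (creR F i \o adj (creR F i)) = idfun - P.
Proof.
apply: bop_eq_fock.
- apply: bop_bigsum => i _; apply: bop_comp; first exact: creR_bop.
  by apply: adj_bop; exact: creR_bop.
- by apply: bop_sub; [exact: bop_id|exact: vacuum_bop].
move=> w; rewrite sum_creR_adj -[RHS]/(e w - P (e w)) vacuumE.
by case: eqP => _; rewrite ?subrr ?subr0.
Qed.

Lemma sum_scaled_creR : \sum_(i < n) (X i \o adj (X i)) = (s ^+ 2)%:C *: (idfun - P).
Proof.
rewrite -sum_creR_vacuum scaler_sumr; apply: eq_bigr => i _.
rewrite /scaled_creR adj_scale; last exact: creR_bop.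
rewrite conjR; apply/funext => z; rewrite !fctE /= bopZ; last exact: creR_bop.
by rewrite scalerA -rmorphM.
Qed.

Lemma creR_row_contraction y : \sum_(i < n) nrm (adj (X i) y) ^+ 2 <= s ^+ 2 * nrm y ^+ 2.
Proof.
have -> : \sum_(i < n) nrm (adj (X i) y) ^+ 2 =
    complex.Re '<< (\sum_(i < n) (X i \o adj (X i))) y, y >>.
  rewrite fct_sumE inner_suml raddf_sum; apply: eq_bigr => i _ /=.
  by rewrite nrm_opE ?adjK //; apply: adj_bop.
rewrite sum_scaled_creR -[X in '<< X, _ >>]/((s ^+ 2)%:C *: (y - P y)).
rewrite innerZl innerBl inner_nrm innerZl [ '<< e _, _ >> ]innerC cab_sq.
rewrite -rmorphB -rmorphM /= ler_wpM2l ?sqr_ge0 // gerBl sqr_ge0 //.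
Qed.

(** Each additional letter contributes a factor s^2, by the row bound [creR_row_contraction]. *)
Lemma scaled_wsum_cvg0 h : wsum X k h @[k --> \oo] --> (0 : R).
Proof.
have /andP[s0 s1] := s01.
have w0 k : 0 <= wsum X k h by apply: sumr_ge0 => w _; exact: sqr_ge0.
have wS k : wsum X k h <= (s ^+ 2) ^+ k * nrm h ^+ 2.
  elim: k => [|k IH]; first by rewrite wsum_0 expr0 mul1r.
  apply: (@le_trans _ _ (s ^+ 2 * wsum X k h)); last first.
    by rewrite (exprS (s ^+ 2) k) -mulrA ler_wpM2l ?sqr_ge0.
  rewrite /wsum (big_tuple_rcons _ (fun w => nrm (adj (monom X w) h) ^+ 2)).
  rewrite exchange_big /= mulr_sumr; apply: ler_sum => w _.
  apply: le_trans (creR_row_contraction _); apply: ler_sum => i _.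
  by rewrite adj_monom_rcons.
apply: (@squeeze_cvgr _ _ _ _ (fun=> 0) (fun k => (s ^+ 2) ^+ k * nrm h ^+ 2)).
- by near=> k; rewrite w0 wS.
- exact: cvg_cst.
- rewrite -[X in _ --> X](mul0r (nrm h ^+ 2)); apply: cvgM; last exact: cvg_cst.
  by apply: cvg_expr; rewrite ger0_norm ?sqr_ge0 // exprn_ilt1.
Unshelve. all: by end_near.
Qed.

(* [X X^* = s^2 (I - P)] with [P] the projection onto the vacuum, so that the
   defect operator is [sqrt (1 - s^2) (I - P) + P]. *)
Lemma scaled_defect : [/\ bop (defect X), adj (defect X) = defect X &
  defect X \o defect X = idfun - \sum_(i < n) (X i \o adj (X i))].
Proof.
have /andP[s0 s1] := s01.
have [bD pD D2] : [/\ bop (defect X), ople 0 (defect X) &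
    defect X \o defect X = idfun - \sum_(i < n) (X i \o adj (X i))].
  pose a := Num.sqrt (1 - s ^+ 2).
  have s2 : s ^+ 2 <= 1 by rewrite exprn_ile1 // ltW.
  have a2 : a ^+ 2 = 1 - s ^+ 2 by rewrite sqr_sqrtr // subr_ge0.
  have a0 : 0 <= a by exact: sqrtr_ge0.
  have a1 : a <= 1.
    by rewrite -(@ler_pXn2r _ 2) ?nnegrE // a2 expr1n gerBl sqr_ge0.
  pose D0 : F -> F := a%:C *: idfun + (1 - a)%:C *: P.
  have D0E z : D0 z = a%:C *: z + (1 - a)%:C *: P z by [].
  have bP := vacuum_bop.
  have bD0 : bop D0.
    by apply: bop_add; apply: bop_scale => //; exact: bop_id.
  have : exists D, [/\ bop D, ople 0 D &
      D \o D = idfun - \sum_(i < n) (X i \o adj (X i))].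
    exists D0; split=> // [z|].
      have -> : (D0 - 0) z = D0 z by rewrite subr0.
      rewrite D0E innerDl !innerZl inner_nrm [ '<< e _, _ >> ]innerC.
      rewrite cab_sq -!rmorphM -rmorphD ler0c.
      by rewrite addr_ge0 // mulr_ge0 ?sqr_ge0 // subr_ge0.
    have D0e w : D0 (e w) = if w == [::] then e w else a%:C *: e w.
      rewrite D0E vacuumE; case: eqP => _; last by rewrite scaler0 addr0.
      by rewrite -scalerDl -rmorphD addrC subrK scale1r.
    rewrite sum_scaled_creR; apply: bop_eq_fock.
    - exact: bop_comp.
    - apply: bop_sub; first exact: bop_id.
      by apply: bop_scale; apply: bop_sub => //; exact: bop_id.
    move=> w; rewrite -[RHS]/(e w - (s ^+ 2)%:C *: (e w - P (e w))) vacuumE.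
    rewrite -[LHS]/(D0 (D0 (e w))) D0e; case: eqP => [->|w0].
      by rewrite D0e eqxx subrr scaler0 subr0.
    rewrite bopZ // D0e; case: eqP => // _; rewrite subr0 scalerA -rmorphM -expr2 a2.
    by rewrite rmorphB scalerBl scale1r.
  by move=> /(@xgetPex _ 0).
split=> //; apply: pos_selfadj => // z.
by have := pD z; rewrite subr0 => /ger0_real.
Qed.

End ScaledKernel.

(** * The Poisson transform of a radial operator *)

Section RadialPoisson.
Variables (R : realType) (n : nat) (F : fock_space R n) (T : hilbert_tensor R).
Implicit Types E Y Z : hilbertType R.

Local Notation e := (fock_e F).
Local Notation Rw := (monom (creR F)).
Local Notation tn := (tens T _ _).
Local Notation X := (scaled_creR F).

Definition kern s := poisson_kernel F T (X s).

Lemma kern_spec s : 0 <= s < 1 -> [/\ bop (kern s), adj (kern s) \o kern s = idfun &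
  forall w, adj (kern s) \o optens T (Rw w) (idfun : F -> F) \o kern s = monom (X s) w].
Proof.
move=> s01; have bX := scaled_creR_bop F s.
have [bD aD DD] := scaled_defect F s01.
have w0 := scaled_wsum_cvg0 (F := F) s01.
have [K bK [nK hK]] := poisson_kernel_exists F T bX bD aD DD w0.
have -> : kern s = K by apply: poisson_kernelE hK erefl.
split=> //; first exact: isometry_adjK.
by move=> w; apply: (kernel_monom bX bK nK hK).
Qed.

Definition kernE s E := tassoc T E F F \o optens T (idfun : E -> E) (kern s).
Arguments kernE : clear implicits.

(** The Poisson transform at s R, with separate source and target spaces: the Schwarz inequality
    needs the transform of Theta(tR) itself, which is not an endomorphism. *)
Definition rpois s E Y (u : tprod T E F -> tprod T Y F) :=
  adj (kernE s Y) \o optens T u (idfun : F -> F) \o kernE s E.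

Lemma poissonE s E (u : tprod T E F -> tprod T E F) : poisson (X s) u = rpois s u.
Proof. by []. Qed.

Section FixedScale.
Variable s : R.
Hypothesis s01 : 0 <= s < 1.

Lemma kern_bop : bop (kern s). Proof. by have [] := kern_spec s01. Qed.

Lemma kernE_bop E : bop (kernE s E).
Proof.
apply: bop_comp; first exact: tassoc_bop.
by apply: optens_bop; [exact: bop_id|exact: kern_bop].
Qed.

Lemma adj_kernE E : adj (kernE s E) =
  optens T (idfun : E -> E) (adj (kern s)) \o adj (tassoc T E F F).
Proof.
have bi := @bop_id R E; have bk := kern_bop.
rewrite adj_comp; [|exact: tassoc_bop|exact: optens_bop].
by rewrite optens_adj // adj_id.
Qed.

Lemma kernE_isom E : adj (kernE s E) \o kernE s E = idfun.
Proof.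
have bi := @bop_id R E; have bk := kern_bop; have bk' := adj_bop bk.
have [_ kk _] := kern_spec s01.
rewrite adj_kernE -[LHS]/(optens T idfun (adj (kern s)) \o
  (adj (tassoc T E F F) \o tassoc T E F F) \o optens T idfun (kern s)).
rewrite tassocK -[LHS]/(optens T idfun (adj (kern s)) \o optens T idfun (kern s)).
by rewrite -optens_comp // kk optens_id.
Qed.

Lemma kernE_nrm E z : nrm (kernE s E z) = nrm z.
Proof.
apply/eqP; rewrite -(@eqrXn2 _ 2) ?nrm_ge0 // !nrm_sqE adjE; last exact: kernE_bop.
by rewrite -[adj _ _]/((adj (kernE s E) \o kernE s E) z) kernE_isom.
Qed.

Lemma opnorm_kernE E : opnorm (kernE s E) <= 1.
Proof.
apply: opnorm_le => //; first exact: kernE_bop.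
by move=> z; rewrite kernE_nrm mul1r.
Qed.

Section TwoSpaces.
Variables E Y : hilbertType R.
Implicit Types u v : tprod T E F -> tprod T Y F.

Let bi := @bop_id R F.
Let bKE := kernE_bop E.
Let bKY := adj_bop (kernE_bop Y).

Lemma rpois_bop u : bop u -> bop (rpois s u).
Proof. by move=> bu; exact: (bop_comp (bop_comp bKY (optens_bop T bu bi)) bKE). Qed.

Lemma rpoisD u v : bop u -> bop v -> rpois s (u + v) = rpois s u + rpois s v.
Proof.
move=> bu bv; rewrite /rpois optensDl //; apply/funext => z /=.
exact: (bopD _ _ bKY).
Qed.

Lemma rpoisZ a u : bop u -> rpois s (a *: u) = a *: rpois s u.
Proof.
move=> bu; rewrite /rpois optensZl //; apply/funext => z /=.
exact: (bopZ _ _ bKY).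
Qed.

Lemma rpois0 : rpois s (0 : tprod T E F -> tprod T Y F) = 0.
Proof. by rewrite /rpois optens0l //; apply/funext => z /=; rewrite bop0. Qed.

Lemma rpoisB u v : bop u -> bop v -> rpois s (u - v) = rpois s u - rpois s v.
Proof.
move=> bu bv; have bv' := bop_opp bv.
by rewrite rpoisD // -[in LHS]scaleN1r rpoisZ // scaleN1r.
Qed.

Lemma rpois_sum I (r : seq I) (P : pred I) (G : I -> tprod T E F -> tprod T Y F) :
  (forall i, bop (G i)) ->
  rpois s (\sum_(i <- r | P i) G i) = \sum_(i <- r | P i) rpois s (G i).
Proof.
move=> bG; elim: r => [|i r IH]; first by rewrite !big_nil rpois0.
rewrite !big_cons; case: ifP => // _; rewrite rpoisD ?IH //.
exact: bop_bigsum.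
Qed.

Lemma opnorm_rpois u : bop u -> opnorm (rpois s u) <= opnorm u.
Proof.
move=> bu; have bo : bop (optens T u (idfun : F -> F)) by apply: optens_bop.
apply: opnorm_le; [exact: rpois_bop| |exact: opnorm_ge0].
move=> z; apply: le_trans (opnorm_nrm _ bKY) _.
rewrite opnorm_adj; last exact: kernE_bop.
apply: (@le_trans _ _ (nrm (optens T u (idfun : F -> F) (kernE s E z)))).
  by rewrite ler_piMl ?nrm_ge0 // opnorm_kernE.
apply: le_trans (opnorm_nrm _ bo) _; rewrite kernE_nrm ler_wpM2r ?nrm_ge0 //.
exact: opnorm_optens_idr.
Qed.

(** The associator trades (a ⊗ R_w) ⊗ I for a ⊗ (R_w ⊗ I), and there the kernel compresses R_w ⊗ I
    to the monomial in s R. *)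
Lemma rpois_monom (a : E -> Y) w : bop a ->
  rpois s (optens T a (Rw w)) = optens T a (monom (X s) w).
Proof.
move=> ba; have bw := Rw_bop F w; have bk := kern_bop; have bk' := adj_bop bk.
have b1 := @bop_id R E; have b2 := @bop_id R Y.
have bo : bop (optens T (Rw w) (idfun : F -> F)) by apply: optens_bop.
have [_ _ kw] := kern_spec s01.
rewrite /rpois adj_kernE.
rewrite -[LHS]/(optens T idfun (adj (kern s)) \o adj (tassoc T Y F F) \o
  (optens T (optens T a (Rw w)) idfun \o tassoc T E F F) \o optens T idfun (kern s)).
rewrite -tassoc_optens //.
rewrite -[LHS]/(optens T idfun (adj (kern s)) \o (adj (tassoc T Y F F) \o
  tassoc T Y F F) \o optens T a (optens T (Rw w) idfun) \o optens T idfun (kern s)).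
rewrite tassocK -[LHS]/((optens T idfun (adj (kern s)) \o
  optens T a (optens T (Rw w) idfun)) \o optens T idfun (kern s)).
rewrite -optens_comp // -optens_comp //; last exact: bop_comp.
by rewrite -[in RHS]kw.
Qed.

End TwoSpaces.

Lemma rpois_adj E Y (u : tprod T E F -> tprod T Y F) : bop u ->
  rpois s (adj u) = adj (rpois s u).
Proof.
move=> bu; have bi := @bop_id R F.
have bo : bop (optens T u (idfun : F -> F)) by apply: optens_bop.
have bE := kernE_bop E; have bY := kernE_bop Y; have bY' := adj_bop bY.
rewrite /rpois adj_comp //; last exact: bop_comp.
by rewrite adj_comp // adjK // optens_adj // adj_id.
Qed.

Lemma rpois_ge0 E (u : tprod T E F -> tprod T E F) : bop u ->
  (forall z, 0 <= '<< u z, z >>) -> forall z, 0 <= '<< rpois s u z, z >>.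
Proof.
move=> bu u0 z; rewrite /rpois /= -adjEr; last exact: kernE_bop.
exact: optens_ge0.
Qed.

End FixedScale.

(** The absolute difference of the lengths: subtraction on [nat] is truncated, so one of the two
    terms is 0. *)
Definition wdist (v w : seq 'I_n) := ((size v - size w) + (size w - size v))%N.

(** The rule for the entries is itself the definition, because it is stable under sums, multiples,
    adjoints and norm limits and so has to be checked on monomials only. *)
Definition radial E Y (u : tprod T E F -> tprod T Y F) : Prop :=
  bop u /\ forall s x y v w, 0 <= s < 1 ->
  '<< rpois s u (tn x (e v)), tn y (e w) >> =
  (s ^+ wdist v w)%:C * '<< u (tn x (e v)), tn y (e w) >>.

Section Radial.
Variables E Y : hilbertType R.
Implicit Types u v : tprod T E F -> tprod T Y F.

Lemma radialD u v : radial u -> radial v -> radial (u + v).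
Proof.
move=> [bu ru] [bv rv]; split; first exact: bop_add.
move=> s x y a b s01; rewrite rpoisD //.
by rewrite !fctE !innerDl ru // rv // mulrDr.
Qed.

Lemma radialZ a u : radial u -> radial (a *: u).
Proof.
move=> [bu ru]; split; first exact: bop_scale.
move=> s x y b c s01; rewrite rpoisZ //.
by rewrite !fctE !innerZl ru // mulrCA.
Qed.

Lemma radial0 : radial (0 : tprod T E F -> tprod T Y F).
Proof.
split; first exact: bop_zero.
by move=> s x y a b s01; rewrite rpois0 // inner0l mulr0.
Qed.

Lemma radial_sum I (r : seq I) (P : pred I) (G : I -> tprod T E F -> tprod T Y F) :
  (forall i, P i -> radial (G i)) -> radial (\sum_(i <- r | P i) G i).
Proof.
by move=> rG; elim/big_ind: _ => //; [exact: radial0|exact: radialD].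
Qed.

Lemma radial_monom (a : E -> Y) w : bop a -> radial (optens T a (Rw w)).
Proof.
move=> ba; have bw := Rw_bop F w; split; first exact: optens_bop.
move=> s x y v v' s01; rewrite rpois_monom // monom_scaled optensZr //.
rewrite -[(_ *: _) _]/(_ *: optens T a (Rw w) (tn x (e v))) innerZl optensE //.
rewrite RwE tens_inner fock_orthonormal.
(* A nonzero entry forces v' = v ++ rev w, so the length difference is |w|. *)
case: eqP => [<-|_]; last by rewrite !mulr0.
congr (_ * _); congr (_%:C); congr (_ ^+ _).
by rewrite /wdist size_cat size_rev addKn (eqP (leq_addr _ _)).
Qed.

(** For fixed vectors both sides are continuous in [u] for the operator norm: the transform is
    contractive and the power of [s] is at most 1. *)
Lemma radial_lim u : bop u ->
  (forall d : R, 0 < d -> exists2 a, radial a & opnorm (u - a) < d) -> radial u.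
Proof.
move=> bu ua; split=> // s x y v w s01; have /andP[s0 s1] := s01.
apply/subr0_eq/cab_eq0/eqP; rewrite eq_le cab_ge0 andbT.
set xv := tn x (e v); set yw := tn y (e w).
apply/ler_addgt0Pl => d d0; rewrite addr0.
have c0 : 0 < 2 * (nrm xv * nrm yw) + 1.
  by rewrite ltr_wpDl // mulr_ge0 // mulr_ge0 ?nrm_ge0.
have [a ra au] := ua _ (divr_gt0 d0 c0); have [ba ha] := ra.
have bua := bop_sub bu ba.
have -> : '<< rpois s u xv, yw >> - (s ^+ wdist v w)%:C * '<< u xv, yw >> =
    '<< rpois s (u - a) xv, yw >> - (s ^+ wdist v w)%:C * '<< (u - a) xv, yw >>.
  rewrite rpoisB // -[(_ - _) xv]/(rpois s u xv - rpois s a xv).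
  rewrite -[(u - a) xv]/(u xv - a xv) !innerBl mulrBr ha //.
  by rewrite opprB addrA subrK.
apply: le_trans (cabD _ _) _; rewrite cabN cabM cabR.
have b1 : cab '<< rpois s (u - a) xv, yw >> <= opnorm (u - a) * (nrm xv * nrm yw).
  apply: le_trans (cauchy_schwarz _ _) _; rewrite mulrA ler_wpM2r ?nrm_ge0 //.
  apply: le_trans (opnorm_nrm _ (rpois_bop s01 bua)) _.
  by rewrite ler_wpM2r ?nrm_ge0 // opnorm_rpois.
have b2 : `|s ^+ wdist v w| * cab '<< (u - a) xv, yw >> <= opnorm (u - a) * (nrm xv * nrm yw).
  apply: (@le_trans _ _ (cab '<< (u - a) xv, yw >>)).
    by rewrite ler_piMl ?cab_ge0 // ger0_norm ?exprn_ge0 // exprn_ile1 // ltW.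
  apply: le_trans (cauchy_schwarz _ _) _; rewrite mulrA ler_wpM2r ?nrm_ge0 //.
  exact: opnorm_nrm.
apply: le_trans (lerD b1 b2) _; rewrite -mulr2n -mulr_natl mulrCA.
move: au; rewrite ltr_pdivlMr // => /ltW; apply: le_trans.
by rewrite ler_wpM2l ?opnorm_ge0 // lerDl.
Qed.

End Radial.

Lemma radial_adj E Y (u : tprod T E F -> tprod T Y F) : radial u -> radial (adj u).
Proof.
move=> [bu ru]; split; first exact: adj_bop.
move=> s x y v w s01; rewrite rpois_adj // -!adjEr //; last exact: rpois_bop.
rewrite innerC ru // rmorphM /= conjR -innerC /wdist addnC //.
Qed.

Lemma spaceS_radial E (u : tprod T E F -> tprod T E F) : spaceS u -> radial u.
Proof.
have pol p : polyE p -> radial p.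
  move=> [m [a [b [ba bb ->]]]]; apply: radial_sum => j _.
  have [N [c ->]] := bb j.
  rewrite optens_sumr //; last first.
    by move=> k; apply: bop_bigsum => w _; apply: bop_scale; exact: Rw_bop.
  apply: radial_sum => k _; rewrite optens_sumr //; last first.
    by move=> w; apply: bop_scale; exact: Rw_bop.
  apply: radial_sum => w _; rewrite optensZr //; last exact: Rw_bop.
  by apply: radialZ; apply: radial_monom.
move=> [bu hu]; apply: radial_lim => // d /hu[_ [_ [p pp <-] [q pq ->]] uq].
by exists (adj p + q) => //; apply: radialD; [apply: radial_adj|]; exact: pol.
Qed.

(** By cancellation of letters the product is a^* b tensored with 0, a monomial or the adjoint of a
    monomial. *)
Lemma radial_gram E Y Z (a : E -> Y) (b : Z -> Y) w v : bop a -> bop b ->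
  radial (adj (optens T a (Rw w)) \o optens T b (Rw v)).
Proof.
move=> ba bb; have ba' := adj_bop ba; have bab := bop_comp ba' bb.
have bw := Rw_bop F w; have bv := Rw_bop F v; have bw' := adj_bop bw.
rewrite optens_adj // -optens_comp //.
have [->|[q ->]|[q ->]] := Rw_adj_mul F w v.
- by rewrite optens0r //; exact: radial0.
- exact: radial_monom.
- rewrite -[_ \o b](adjK bab) -optens_adj //; last 2 first.
    exact: adj_bop.
    exact: Rw_bop.
  by apply: radial_adj; apply: radial_monom; exact: adj_bop.
Qed.

End RadialPoisson.

(** * Completely positive maps *)

Section OperatorClosure.
Variable R : realType.
Implicit Types V W : hilbertType R.

Definition oplin V W (A : set (V -> W)) : Prop :=
  A 0 /\ forall (c : R[i]) f g, A f -> A g -> A (c *: f + g).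

Section Oplin.
Variables (V W : hilbertType R) (A : set (V -> W)).
Hypothesis lA : oplin A.

Lemma oplinD f g : A f -> A g -> A (f + g).
Proof. by move=> Af Ag; have := lA.2 1 f g Af Ag; rewrite scale1r. Qed.

Lemma oplinZ c f : A f -> A (c *: f).
Proof. by move=> Af; have := lA.2 c f 0 Af lA.1; rewrite addr0. Qed.

Lemma oplinB f g : A f -> A g -> A (f - g).
Proof. by move=> Af Ag; have := lA.2 (-1) g f Ag Af; rewrite scaleN1r addrC. Qed.

Lemma oplin_sum I (s : seq I) (P : pred I) (G : I -> V -> W) :
  (forall i, P i -> A (G i)) -> A (\sum_(i <- s | P i) G i).
Proof. by move=> AG; elim/big_ind: _ => //; [exact: lA.1|exact: oplinD]. Qed.

Lemma opclosure_sub f : bop f -> A f -> opclosure A f.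
Proof.
move=> bf Af; split=> // d d0; exists f => //.
by rewrite subrr opnorm0.
Qed.

Lemma opclosure_lin : A `<=` @bop R V W -> oplin (opclosure A).
Proof.
move=> AB; split; first by apply: opclosure_sub; [exact: bop_zero|exact: lA.1].
move=> c f g [bf hf] [bg hg]; split.
  by apply: bop_add => //; apply: bop_scale.
move=> d d0; have c0 : 0 < 2 * (cab c + 1) by rewrite mulr_gt0 // ltr_wpDl ?cab_ge0.
have [a Aa fa] := hf _ (divr_gt0 d0 c0).
have [b Ab gb] := hg (d / 2) (divr_gt0 d0 (ltr0Sn _ 1)).
exists (c *: a + b); first exact: lA.2.
have -> : c *: f + g - (c *: a + b) = c *: (f - a) + (g - b).
  by rewrite scalerBr opprD addrACA.
have bfa := bop_sub bf (AB _ Aa); have bgb := bop_sub bg (AB _ Ab).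
apply: le_lt_trans (opnorm_add (bop_scale _ bfa) bgb) _.
rewrite [ltRHS](splitr d); apply: ler_ltD => //.
apply: le_trans (opnorm_scale _ bfa) _.
have o0 := opnorm_ge0 bfa; have cc := cab_ge0 c.
move: fa; rewrite ltr_pdivlMr // => fa; nra.
Qed.

End Oplin.
End OperatorClosure.

(** * The operator system of the right creation operators *)

Section SystemR.
Variables (R : realType) (n : nat) (F : fock_space R n).

Local Notation Rw := (monom (creR F)).

Lemma polyR_bop : @polyR R n F `<=` @bop R F F.
Proof.
move=> _ [N [c ->]]; apply: bop_bigsum => k _; apply: bop_bigsum => w _.
by apply: bop_scale; exact: Rw_bop.
Qed.

(** Pads the coefficients with zeros, so that two polynomials can be added degree by degree. *)
Lemma polyR_widen N M (c : seq 'I_n -> R[i]) : (N <= M)%N ->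
  \sum_(k < N) \sum_(w : k.-tuple 'I_n) c w *: Rw w =
  \sum_(k < M) \sum_(w : k.-tuple 'I_n) (if (size w < N)%N then c w else 0) *: Rw w.
Proof.
move=> NM.
rewrite -(big_mkord xpredT (fun k => \sum_(w : k.-tuple 'I_n) c w *: Rw w)).
rewrite -(big_mkord xpredT (fun k => \sum_(w : k.-tuple 'I_n)
  (if (size w < N)%N then c w else 0) *: Rw w)).
rewrite [RHS](big_cat_nat (n := N)) //= [X in _ = _ + X]big_nat_cond [X in _ = _ + X]big1.
  rewrite addr0; apply: eq_big_nat => k /andP[_ kN].
  by apply: eq_bigr => w _; rewrite size_tuple kN.
move=> k /andP[/andP[Nk _] _]; apply: big1 => w _.
by rewrite size_tuple ltnNge Nk scale0r.
Qed.

Lemma polyR_lin : oplin (@polyR R n F).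
Proof.
split; first by exists 0%N, (fun=> 0); rewrite big_ord0.
move=> a _ _ [N [c ->]] [M [d ->]].
rewrite (polyR_widen c (leq_maxl N M)) (polyR_widen d (leq_maxr N M)).
exists (maxn N M), (fun w => a * (if (size w < N)%N then c w else 0) +
  (if (size w < M)%N then d w else 0)).
rewrite scaler_sumr -big_split /=; apply: eq_bigr => k _.
rewrite scaler_sumr -big_split /=; apply: eq_bigr => w _.
by rewrite scalerA scalerDl.
Qed.

Lemma polyR_monom w : polyR (Rw w).
Proof.
exists (size w).+1, (fun v => (v == w)%:R).
rewrite big_ord_recr /= big1 ?add0r => [|k _]; last first.
  apply: big1 => v _; case: eqP => [vw|_]; last by rewrite scale0r.
  have := congr1 size vw; rewrite size_tuple => kw.
  by have := ltn_ord k; rewrite {1}kw ltnn.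
rewrite (bigD1 (in_tuple w)) //= eqxx scale1r big1 ?addr0 // => v vw.
by rewrite -val_eqE /= in vw; rewrite (negbTE vw) scale0r.
Qed.

Lemma algR_bop f : @algR R n F f -> bop f.
Proof. by case. Qed.

Lemma algR_lin : oplin (@algR R n F).
Proof. by apply: opclosure_lin; [exact: polyR_lin|exact: polyR_bop]. Qed.

Lemma polyR_alg p : polyR p -> @algR R n F p.
Proof. by move=> pp; apply: opclosure_sub => //; exact: polyR_bop. Qed.

Lemma sysR_bop f : sysR F f -> bop f.
Proof.
move=> [_ [a aa <-] [b ab ->]]; apply: bop_add; last exact: algR_bop.
by apply: adj_bop; exact: algR_bop.
Qed.

Lemma sysR_alg f : @algR R n F f -> sysR F f.
Proof.
move=> af; exists 0; last by exists f => //; rewrite add0r.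
by exists 0; [exact: algR_lin.1|exact: adj_zero].
Qed.

Lemma sysR_adj f : sysR F f -> sysR F (adj f).
Proof.
move=> [_ [a aa <-] [b ab ->]]; exists (adj b); first by exists b.
exists a => //; rewrite adj_add; [|by apply: adj_bop; exact: algR_bop|exact: algR_bop].
by rewrite adjK 1?addrC //; exact: algR_bop.
Qed.

Lemma sysR_lin : oplin (sysR F).
Proof.
split; first exact/sysR_alg/algR_lin.1.
move=> c _ _ [_ [a aa <-] [b ab ->]] [_ [a' aa' <-] [b' ab' ->]].
exists (adj (Num.conj c *: a + a')).
  by exists (Num.conj c *: a + a') => //; apply: algR_lin.2.
exists (c *: b + b'); first exact: algR_lin.2.
have ba := algR_bop aa; have ba' := algR_bop aa'.
rewrite adj_add ?adj_scale ?conjCK //; last exact: bop_scale.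
by rewrite scalerDr addrACA.
Qed.

Lemma sysR_monom w : sysR F (Rw w).
Proof. exact/sysR_alg/polyR_alg/polyR_monom. Qed.

Lemma sysR_id : sysR F idfun.
Proof. exact: (sysR_monom [::]). Qed.

End SystemR.

Section RealImaginary.
Variables (R : realType) (n : nat) (F : fock_space R n).

Lemma cab_i : cab ('i%C : R[i]) = 1.
Proof. by apply: complexI; rewrite -cabE complexiE normCi. Qed.

Lemma adj_sub (V W : hilbertType R) (A B : V -> W) : bop A -> bop B ->
  adj (A - B) = adj A - adj B.
Proof.
move=> bA bB; rewrite -scaleN1r adj_add //; last exact: bop_scale.
by rewrite adj_scale // rmorphN rmorph1 scaleN1r.
Qed.

(** Real and imaginary parts: the system contains them because it is closed under adjoints, and
    averaging with the adjoint does not increase the norm. *)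
Lemma selfadj_decomp f : sysR F f -> exists g h,
  [/\ sysR F g, adj g = g & opnorm g <= opnorm f] /\
  [/\ sysR F h, adj h = h & opnorm h <= opnorm f] /\
  f = g + 'i%C *: h /\ adj f = g - 'i%C *: h.
Proof.
move=> sf; have bf := sysR_bop sf; have sf' := sysR_adj sf; have bf' := sysR_bop sf'.
have i2 : 0 <= (2^-1 : R) by rewrite invr_ge0.
have h2 (x : F -> F) : 2^-1%:C *: (x + x) = x.
  rewrite -[X in _ *: (X + X)]scale1r -scalerDl scalerA.
  have -> : 2^-1%:C * (1 + 1) = 1 :> R[i].
    rewrite -(rmorph1 (real_complex R)) -rmorphD -rmorphM /=; congr (_%:C); by field.
  by rewrite scale1r.
exists (2^-1%:C *: (f + adj f)), ((- 'i%C * 2^-1%:C) *: (f - adj f)).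
have bD := bop_add bf bf'; have bB := bop_sub bf bf'.
have sD := oplinD (sysR_lin F) sf sf'; have sB := oplinB (sysR_lin F) sf sf'.
have ii : 'i%C * (- 'i%C * 2^-1%:C) = 2^-1%:C :> R[i].
  by rewrite mulrA mulrN -expr2 sqr_i opprK mul1r.
split; [split|split; [split|split]].
- exact: oplinZ (sysR_lin F) _ _ sD.
- by rewrite adj_scale // conjR adj_add // adjK // [adj f + f]addrC.
- apply: le_trans (opnorm_scale _ bD) _.
  rewrite cabR ger0_norm // ler_pdivrMl //.
  apply: le_trans (opnorm_add bf bf') _.
  by rewrite opnorm_adj // mulr_natl mulr2n.
- exact: oplinZ (sysR_lin F) _ _ sB.
- rewrite adj_scale // adj_sub // adjK // rmorphM /= conjR rmorphN /= complexiE conjCi.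
  by rewrite opprK -[adj f - f]opprB scalerN -scaleNr mulNr.
- apply: le_trans (opnorm_scale _ bB) _.
  rewrite cabM cabN cabR ger0_norm // cab_i mul1r ler_pdivrMl //.
  apply: le_trans (opnorm_add bf (bop_opp bf')) _.
  by rewrite opnormN opnorm_adj // mulr_natl mulr2n.
- by rewrite scalerA ii -scalerDr addrACA subrr addr0 h2.
- by rewrite scalerA ii -scalerBr opprB [f + _]addrC addrACA subrr addr0 h2.
Qed.

End RealImaginary.

(** * Bounds from positivity and uniqueness of completely positive maps *)

Section CompletelyPositive.
Variables (R : realType) (n : nat) (F : fock_space R n) (E : hilbertType R).
Implicit Type mu : (F -> F) -> E -> E.

Local Notation Rw := (monom (creR F)).

Section OneMap.
Variable mu : (F -> F) -> E -> E.
Hypothesis cpmu : cp_linear mu.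

Lemma cp_bop f : sysR F f -> bop (mu f).
Proof. by have [h _ _] := cpmu; exact: h. Qed.

Lemma cp_lin c f g : sysR F f -> sysR F g -> mu (c *: f + g) = c *: mu f + mu g.
Proof. by have [_ h _] := cpmu; exact: h. Qed.

Lemma cp0 : mu 0 = 0.
Proof.
have := cp_lin (-1) (sysR_lin F).1 (sysR_lin F).1.
by rewrite scaler0 addr0 scaleN1r addNr.
Qed.

Lemma cpD f g : sysR F f -> sysR F g -> mu (f + g) = mu f + mu g.
Proof. by move=> sf sg; have := cp_lin 1 sf sg; rewrite !scale1r. Qed.

Lemma cpZ c f : sysR F f -> mu (c *: f) = c *: mu f.
Proof. by move=> sf; have := cp_lin c sf (sysR_lin F).1; rewrite cp0 !addr0. Qed.

Lemma cpB f g : sysR F f -> sysR F g -> mu (f - g) = mu f - mu g.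
Proof.
by move=> sf sg; have := cp_lin (-1) sg sf; rewrite !scaleN1r addrC => ->; rewrite addrC.
Qed.

Lemma cp_sum I (s : seq I) (G : I -> F -> F) : (forall i, sysR F (G i)) ->
  mu (\sum_(i <- s) G i) = \sum_(i <- s) mu (G i).
Proof.
move=> sG; elim: s => [|i s IH]; first by rewrite !big_nil cp0.
rewrite !big_cons cpD ?IH //; apply: oplin_sum => //; exact: sysR_lin.
Qed.

Lemma cp_pos f : sysR F f -> (forall v, 0 <= '<< f v, v >>) ->
  forall x, 0 <= '<< mu f x, x >>.
Proof.
move=> sf f0 x; have [_ _ h] := cpmu.
have := h 1%N (fun _ _ => f) (fun _ _ => sf).
rewrite /op_positive => /(_ _ (fun=> x)); rewrite !big_ord1; apply=> v.
by rewrite !big_ord1.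
Qed.

(** With c = |f| both c I + f and c I - f are positive, so [mu] bounds <mu f x, x> from above and
    below by c <mu I x, x>. *)
Lemma cp_selfadj f x : sysR F f -> adj f = f ->
  '<< mu f x, x >> \is Num.real /\
  cab '<< mu f x, x >> <= opnorm f * cab '<< mu idfun x, x >>.
Proof.
move=> sf af; have bf := sysR_bop sf; set c := opnorm f.
have c0 : 0 <= c by exact: opnorm_ge0.
have fr v : '<< f v, v >> \is Num.real.
  by apply/CrealP; rewrite -innerC [RHS]adjE // af.
have fb v : `|'<< f v, v >>| <= '<< (c%:C *: (idfun : F -> F)) v, v >>.
  rewrite cabE -[(_ *: _) v]/(c%:C *: v) innerZl inner_nrm -rmorphM lecR.
  apply: le_trans (cauchy_schwarz _ _) _; rewrite expr2 mulrA.
  by rewrite ler_wpM2r ?nrm_ge0 // opnorm_nrm.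
have si := sysR_id F; have sci := oplinZ (sysR_lin F) c%:C si.
have p1 : 0 <= '<< mu (c%:C *: idfun + f) x, x >>.
  apply: cp_pos => [|v]; first exact: (oplinD (sysR_lin F) sci sf).
  rewrite -[(_ + _) v]/((c%:C *: (idfun : F -> F)) v + f v) innerDl.
  by have := fb v; rewrite real_ler_norml // => /andP[h _]; rewrite -lerBlDl sub0r.
have p2 : 0 <= '<< mu (c%:C *: idfun - f) x, x >>.
  apply: cp_pos => [|v]; first exact: (oplinB (sysR_lin F) sci sf).
  rewrite -[(_ - _) v]/((c%:C *: (idfun : F -> F)) v - f v) innerBl.
  by have := fb v; rewrite real_ler_norml // => /andP[_ h]; rewrite subr_ge0.
have m0 : 0 <= '<< mu idfun x, x >>.
  by apply: cp_pos => // v; exact: inner_ge0.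
rewrite cpD // cpZ // -[(_ + _) x]/(c%:C *: mu idfun x + mu f x) innerDl innerZl in p1.
rewrite cpB // cpZ // -[(_ - _) x]/(c%:C *: mu idfun x - mu f x) innerBl innerZl in p2.
set q := '<< mu f x, x >> in p1 p2 *; set m := '<< mu idfun x, x >> in m0 p1 p2 *.
have A0 : 0 <= c%:C * m by rewrite mulr_ge0 // ler0c.
have qr : q \is Num.real.
  rewrite -[q](addKr (c%:C * m)) rpredD // ?rpredN ger0_real //.
split=> //; rewrite -lecR -cabE rmorphM /= -cabE (ger0_norm m0).
by rewrite real_ler_norml // -[- _]sub0r lerBlDl p1 -subr_ge0.
Qed.

(** The factor 2 comes from adding the real and the imaginary part. This supplies the continuity
    that [cp_linear] does not state. *)
Lemma cp_bound f x : sysR F f ->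
  cab '<< mu f x, x >> <= 2 * opnorm f * cab '<< mu idfun x, x >>.
Proof.
move=> sf; have [g [h [[sg ag gb] [[sh ah hb] [fE _]]]]] := selfadj_decomp sf.
have [_ h1] := cp_selfadj x sg ag; have [_ h2] := cp_selfadj x sh ah.
have s2 := oplinZ (sysR_lin F) 'i%C sh.
rewrite {1}fE cpD // cpZ // -[(mu g + _) x]/(mu g x + 'i%C *: mu h x).
rewrite innerDl innerZl; apply: le_trans (cabD _ _) _; rewrite cabM cab_i mul1r.
have m0 := cab_ge0 '<< mu idfun x, x >>.
move: (cab '<< mu idfun x, x >>) m0 h1 h2 => m m0 h1 h2.
have h3 : opnorm g * m <= opnorm f * m by rewrite ler_wpM2r.
have h4 : opnorm h * m <= opnorm f * m by rewrite ler_wpM2r.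
lra.
Qed.

Lemma cp_conj f x : sysR F f ->
  '<< mu (adj f) x, x >> = Num.conj '<< mu f x, x >>.
Proof.
move=> sf; have [g [h [[sg ag gb] [[sh ah hb] [fE ->]]]]] := selfadj_decomp sf.
have [r1 _] := cp_selfadj x sg ag; have [r2 _] := cp_selfadj x sh ah.
have s2 := oplinZ (sysR_lin F) 'i%C sh.
rewrite fE cpB // cpD // cpZ //.
rewrite -[(mu g - _) x]/(mu g x - 'i%C *: mu h x).
rewrite -[(mu g + _ *: _) x]/(mu g x + 'i%C *: mu h x).
rewrite innerBl innerDl !innerZl rmorphD rmorphM /= (CrealP r1) (CrealP r2).
by rewrite complexiE conjCi mulNr.
Qed.

End OneMap.

(** Agreement on the adjoints of monomials passes to monomials by [cp_conj], to polynomials by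
    linearity, to their closure by [cp_bound], and to the whole system by [cp_conj] again. Quadratic
    forms suffice, since they determine an operator. *)
Lemma cp_uniq mu mu' : cp_linear mu -> cp_linear mu' ->
  (forall w, mu (adj (Rw w)) = mu' (adj (Rw w))) ->
  forall f, sysR F f -> mu f = mu' f.
Proof.
move=> cm cm' agree f sf; apply: quadratic_inj; [exact: cp_bop|exact: cp_bop|move=> x].
have aM w : '<< mu (Rw w) x, x >> = '<< mu' (Rw w) x, x >>.
  have s1 := sysR_monom F w; have b1 := Rw_bop F w.
  have s2 := sysR_adj s1; rewrite -[Rw w]adjK //.
  by rewrite (cp_conj cm x s2) (cp_conj cm' x s2) agree.
have aP p : polyR p -> '<< mu p x, x >> = '<< mu' p x, x >>.
  have sZ c w : sysR F (c *: Rw w).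
    by apply: oplinZ (sysR_lin F) _ _ _; exact: sysR_monom.
  move=> [N [c ->]]; rewrite !cp_sum //; last 2 first.
  - by move=> k; apply: oplin_sum => //; exact: sysR_lin.
  - by move=> k; apply: oplin_sum => //; exact: sysR_lin.
  rewrite !fct_sumE !inner_suml; apply: eq_bigr => k _.
  rewrite !cp_sum // !fct_sumE !inner_suml; apply: eq_bigr => w _.
  have s1 := sysR_monom F w.
  by rewrite !cpZ // !(innerZl _ (_ x)) aM.
have aA a : @algR R n F a -> '<< mu a x, x >> = '<< mu' a x, x >>.
  move=> aa; have [ba ha] := aa; have sa := sysR_alg aa.
  apply/subr0_eq/cab_eq0/eqP; rewrite eq_le cab_ge0 andbT.
  apply/ler_addgt0Pl => d d0; rewrite addr0.
  set m1 := cab '<< mu idfun x, x >>; set m2 := cab '<< mu' idfun x, x >>.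
  have m10 : 0 <= m1 := cab_ge0 _; have m20 : 0 <= m2 := cab_ge0 _.
  (* The bounds for the two maps cost together 2 (m1 + m2) times |a - p|; the added 1 keeps the
     divisor positive. *)
  have c0 : 0 < 2 * (m1 + m2) + 1 by rewrite ltr_wpDl // mulr_ge0 // addr_ge0.
  have [p pp ap] := ha _ (divr_gt0 d0 c0).
  have sp := sysR_alg (polyR_alg pp); have sap := oplinB (sysR_lin F) sa sp.
  have h1 := cp_bound cm x sap; have h2 := cp_bound cm' x sap.
  have -> : '<< mu a x, x >> - '<< mu' a x, x >> =
      '<< mu (a - p) x, x >> - '<< mu' (a - p) x, x >>.
    rewrite !cpB // -[(mu a - mu p) x]/(mu a x - mu p x).
    rewrite -[(mu' a - mu' p) x]/(mu' a x - mu' p x) !innerBl (aP _ pp).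
    by rewrite opprB addrA subrK.
  apply: le_trans (cabD _ _) _; rewrite cabN; apply: le_trans (lerD h1 h2) _.
  have o0 := opnorm_ge0 (sysR_bop sap).
  move: ap; rewrite ltr_pdivlMr // => ap; rewrite -/m1 -/m2; nra.
move: sf => [_ [a aa <-] [b ab ->]].
have sa := sysR_alg aa; have sb := sysR_alg ab; have sa' := sysR_adj sa.
rewrite !cpD // -[(mu _ + mu _) x]/(mu (adj a) x + mu b x).
rewrite -[(mu' _ + mu' _) x]/(mu' (adj a) x + mu' b x) !innerDl !cp_conj //.
by rewrite (aA _ aa) (aA _ ab).
Qed.

End CompletelyPositive.

(** * Compressions as completely positive maps *)

Section CompressionMap.
Variables (R : realType) (n : nat) (F : fock_space R n) (T : hilbert_tensor R).
Variables (E Y : hilbertType R) (G : E -> tprod T Y F).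
Hypothesis bG : bop G.

Definition cmap (f : F -> F) : E -> E := adj G \o optens T (idfun : Y -> Y) f \o G.

Lemma cmap_inner f x y : bop f ->
  '<< cmap f x, y >> = '<< optens T (idfun : Y -> Y) f (G x), G y >>.
Proof. by move=> bf; rewrite /cmap /= -adjEr. Qed.

Lemma cmap_bop f : bop f -> bop (cmap f).
Proof.
move=> bf; apply: bop_comp => //; apply: bop_comp; first exact: adj_bop.
by apply: optens_bop => //; exact: bop_id.
Qed.

(** The matrix form of [cmap] at the vectors v_i is the form of I ⊗ u at the vectors G v_i, so
    complete positivity reduces to [optensr_positive]. *)
Lemma cmap_cp : cp_linear cmap.
Proof.
have bi := @bop_id R Y; split.
- by move=> f sf; apply: cmap_bop; exact: sysR_bop sf.
- move=> c f g sf sg; have bf := sysR_bop sf; have bg := sysR_bop sg.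
  rewrite /cmap optensDr //; last exact: bop_scale.
  rewrite optensZr //; apply/funext => x /=.
  have ba := adj_bop bG.
  rewrite -[LHS]/(adj G (c *: optens T (idfun : Y -> Y) f (G x) +
    optens T (idfun : Y -> Y) g (G x))).
  by rewrite bopD // bopZ.
- move=> m u su pu v.
  have bu i j : bop (u i j) by exact: sysR_bop (su i j).
  have := @optensr_positive R T F Y m u bu pu (fun i => G (v i)).
  congr (0 <= _); apply: eq_bigr => i _; apply: eq_bigr => j _.
  by rewrite cmap_inner.
Qed.

End CompressionMap.

(** * The Herglotz-Riesz series *)

Section OpspanLinear.
Variables (R : realType) (T : hilbert_tensor R).
Variables V V' W W' : hilbertType R.
Variables (A : set (V -> V')) (B : set (W -> W')).
Hypothesis A_bop : A `<=` @bop R V V'.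
Hypothesis B_bop : B `<=` @bop R W W'.

Lemma opspan_bop : opspan T A B `<=` @bop R _ _.
Proof.
move=> _ [m [a [b [Aa Bb ->]]]]; apply: bop_bigsum => j _.
by apply: optens_bop; [exact: A_bop|exact: B_bop].
Qed.

Lemma opspan_tens a b : A a -> B b -> opspan T A B (optens T a b).
Proof.
move=> Aa Bb; exists 1%N, (fun _ => a), (fun _ => b); split=> //.
by rewrite big_ord1.
Qed.

Lemma opspan_lin : oplin A -> oplin (opspan T A B).
Proof.
move=> lA; split.
  exists 0%N, (fun _ => 0), (fun _ => 0).
  by split=> [[]|[]|]; rewrite ?big_ord0.
move=> c _ _ [m [a [b [Aa Bb ->]]]] [m' [a' [b' [Aa' Bb' ->]]]].
exists (m + m')%N, (fun i => match fintype.split i with inl j => c *: a j | inr j => a' j end),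
  (fun i => match fintype.split i with inl j => b j | inr j => b' j end); split.
- by move=> i; case: (fintype.split i) => j //; exact: oplinZ.
- by move=> i; case: (fintype.split i).
rewrite big_split_ord /= scaler_sumr; congr (_ + _); apply: eq_bigr => j _.
  by rewrite (unsplitK (inl j)) optensZl //; [exact: A_bop|exact: B_bop].
by rewrite (unsplitK (inr j)).
Qed.

End OpspanLinear.

(** * The Neumann series *)

Section Neumann.
Variables (R : realType) (V : hilbertType R) (Z : V -> V).
Hypothesis bZ : bop Z.
Hypothesis Z1 : opnorm Z < 1.

Definition opow k : V -> V := iter k (fun A => Z \o A) idfun.

Lemma opow_bop k : bop (opow k).
Proof. by elim: k => [|k IH]; [exact: bop_id|exact: bop_comp]. Qed.

Lemma opnorm_opow k : opnorm (opow k) <= opnorm Z ^+ k.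
Proof.
elim: k => [|k IH]; first by rewrite expr0 opnorm_id_le.
apply: le_trans (opnorm_comp bZ (opow_bop k)) _.
by rewrite exprS ler_wpM2l // opnorm_ge0.
Qed.

Lemma opow_comm k : opow k \o Z = Z \o opow k.
Proof. by elim: k => [|k IH] //=; rewrite -[LHS]/(Z \o (opow k \o Z)) IH. Qed.

(** For the sum L of the powers, Z L = L - I yields the inverse. It also rewrites (I + Z) L as 2 L -
    I, whose expansion has coefficient 1 in degree 0 and 2 in every other degree. *)
Lemma neumann : exists L, [/\ bop L, opinv (idfun - Z) = L,
  (idfun + Z) \o L = 2%:R *: L - idfun &
  opnorm (\sum_(k < N) opow k - L) @[N --> \oo] --> (0 : R)].
Proof.
have bi := @bop_id R V.
have [||L bL hL] := @geometric_op_series _ _ _ opow (opnorm Z) 0 _ opow_bop.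
- by rewrite opnorm_ge0.
- by move=> k _; exact: opnorm_opow.
have bS N : bop (\sum_(k < N) opow k) by apply: bop_bigsum => k _; exact: opow_bop.
have pt x := @op_cvg_pt _ _ _ _ _ x bS bL hL.
have ZL : Z \o L = L - idfun.
  apply/funext => x /=; apply/esym/subr0_eq.
  have h1 : Z ((\sum_(k < N) opow k) x) @[N --> \oo] --> Z (L x).
    by apply: cvg_bop => //; exact: pt.
  have h2 : ((\sum_(k < N) opow k) x) @[N --> \oo] --> Z (L x) + x.
    rewrite -cvg_shiftS /=.
    have : (fun N => Z ((\sum_(k < N) opow k) x) + x) @ \oo --> Z (L x) + x.
      by apply: cvgD => //; exact: cvg_cst.
    apply: eq_cvg_seq => N; rewrite big_ord_recl addrC !fct_sumE bop_sum //.
  have E : L x = Z (L x) + x := cvg_uniq (pt x) h2.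
  by rewrite -[(L - idfun) x]/(L x - x) {1}E addrK subrr.
have LZ : L \o Z = Z \o L.
  apply/funext => x /=; apply: (cvg_uniq (@pt (Z x))).
  have h1 : Z ((\sum_(k < N) opow k) x) @[N --> \oo] --> Z (L x).
    by apply: cvg_bop => //; exact: pt.
  apply: eq_cvg_seq h1 => N; rewrite !fct_sumE bop_sum //; apply: eq_bigr => k _.
  by rewrite -[LHS]/((Z \o opow k) x) -opow_comm.
exists L; split=> //.
- have r1 : (idfun - Z) \o L = idfun.
    apply/funext => x; rewrite -[LHS]/(L x - (Z \o L) x) ZL.
    by rewrite -[(L - idfun) x]/(L x - x) opprB addrC subrK.
  have r2 : L \o (idfun - Z) = idfun.
    apply/funext => x; rewrite -[LHS]/(L (x - Z x)) bopB // -[L (Z x)]/((L \o Z) x) LZ.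
    by rewrite -[LHS]/(L x - (Z \o L) x) ZL -[(L - idfun) x]/(L x - x) opprB addrC subrK.
  have [bB B1 B2] : [/\ bop (opinv (idfun - Z)),
      (idfun - Z) \o opinv (idfun - Z) = idfun &
      opinv (idfun - Z) \o (idfun - Z) = idfun].
    have /(@xgetPex _ 0) : exists B, [/\ bop B, (idfun - Z) \o B = idfun &
      B \o (idfun - Z) = idfun] by exists L.
    by [].
  apply/funext => x.
  have e1 : (idfun - Z) (L x) = x := congr1 (fun f => f x) r1.
  have e2 : opinv (idfun - Z) ((idfun - Z) (L x)) = L x :=
    congr1 (fun f => f (L x)) B2.
  by rewrite e1 in e2.
- apply/funext => x; rewrite -[LHS]/(L x + (Z \o L) x) ZL.
  rewrite -[RHS]/(2%:R *: L x - x) -[(L - idfun) x]/(L x - x) addrA.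
  by rewrite scaler_nat mulr2n.
Qed.

End Neumann.

(** * The ampliation of mu and the Herglotz kernel *)

Section HerglotzSeries.
Variables (R : realType) (n : nat) (F : fock_space R n) (T : hilbert_tensor R).
Variables (E Y H : hilbertType R) (G : E -> tprod T Y F).
Hypothesis bG : bop G.

Local Notation Rw := (monom (creR F)).
Local Notation mu := (cmap G).

(** Coefficients of I + 2 Z + 2 Z^2 + ... after applying mu, the power Z^k being the sum over |w| =
    k of R_(rev w)^* ⊗ X_w. *)
Definition hcoef (w : seq 'I_n) : E -> E :=
  (if w == [::] then 1 else 2) *: mu (adj (Rw (rev w))).

Lemma hcoef_bop w : bop (hcoef w).
Proof. by apply: bop_scale; apply: cmap_bop => //; apply: adj_bop; exact: Rw_bop. Qed.

Section Ampliation.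

Let GH : tprod T E H -> tprod T Y (tprod T F H) :=
  adj (tassoc T Y F H) \o optens T G (idfun : H -> H).

(** Witness for the existence of mu ⊗ id: a compression by G ⊗ I followed by the inverse associator,
    which separates [Y] from F ⊗ H. The chosen [ampliation] is then known through the properties in
    [is_ampliation]. *)
Definition Mmap (u : tprod T F H -> tprod T F H) : tprod T E H -> tprod T E H :=
  adj GH \o optens T (idfun : Y -> Y) u \o GH.

Lemma Mmap_ampliation : is_ampliation mu Mmap.
Proof.
have bi := @bop_id R H; have bY := @bop_id R Y; have bt := tassoc_bop T Y F H.
have bt' := adj_bop bt; have bGi := optens_bop T bG bi.
have bGH : bop GH by exact: bop_comp.
have bGH' := adj_bop bGH.
have bM u : bop u -> bop (Mmap u).
  by move=> bu; exact: (bop_comp (bop_comp bGH' (optens_bop T bY bu)) bGH).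
split.
- by move=> u [bu _]; exact: bM.
- move=> c u v [bu _] [bv _].
  rewrite /Mmap optensDr //; last exact: bop_scale.
  rewrite optensZr //; apply/funext => x.
  rewrite -[LHS]/(adj GH (c *: optens T (idfun : Y -> Y) u (GH x) +
    optens T (idfun : Y -> Y) v (GH x))).
  by rewrite bopD // bopZ.
- exists (opnorm (adj GH) * opnorm GH) => u [bu _].
  have bo := optens_bop T bY bu.
  apply: le_trans (opnorm_comp (bop_comp bGH' bo) bGH) _.
  rewrite mulrAC ler_wpM2r ?opnorm_ge0 //.
  apply: le_trans (opnorm_comp bGH' bo) _.
  by rewrite ler_wpM2l ?opnorm_ge0 // opnorm_optens_idl.
- move=> f A sf bA; have bf := sysR_bop sf.
  have b1 := optens_bop T bY bf; have b2 := optens_bop T bf bA.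
  rewrite /Mmap /cmap /GH adj_comp // adjK // optens_adj // adj_id.
  have bG' := adj_bop bG; have bGi' := optens_bop T bG' bi.
  rewrite -[LHS]/(optens T (adj G) idfun \o
    ((tassoc T Y F H \o optens T idfun (optens T f A)) \o adj (tassoc T Y F H)) \o
    optens T G idfun).
  rewrite tassoc_optens //.
  rewrite -[X in _ \o X \o _]/(optens T (optens T idfun f) A \o
    (tassoc T Y F H \o adj (tassoc T Y F H))) tassocKV.
  rewrite -[LHS]/((optens T (adj G) idfun \o optens T (optens T idfun f) A) \o
    optens T G idfun).
  by rewrite -!optens_comp //; exact: bop_comp.
Qed.

Lemma ampliation_spec : is_ampliation mu (@ampliation R n F T E H mu).
Proof.
have : exists M, @is_ampliation R n F T E H mu M by exists Mmap; exact: Mmap_ampliation.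
by move=> /(@xgetPex _ 0).
Qed.

End Ampliation.

Variable X : 'I_n -> H -> H.
Hypothesis rX : row_ball X.

Let bX i : bop (X i) := rX.1 i.
Let Z : tprod T F H -> tprod T F H := \sum_(i < n) optens T (adj (creR F i)) (X i).

Let bR i : bop (adj (creR F i)).
Proof. by apply: adj_bop; exact: creR_bop. Qed.

Lemma hZ_bop : bop Z.
Proof. by apply: bop_bigsum => i _; exact: optens_bop. Qed.

(** Since R_i^* R_j = delta_ij, the product Z Z^* collapses to I ⊗ sum X_i X_i^*, so |Z| is at most
    the row norm of X. *)
Lemma hZ_norm : opnorm Z < 1.
Proof.
have bXX : bop (\sum_(i < n) (X i \o adj (X i))).
  by apply: bop_bigsum => i _; apply: bop_comp => //; apply: adj_bop.
have bi := @bop_id R F.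
have ZZ : Z \o adj Z = optens T (idfun : F -> F) (\sum_(i < n) (X i \o adj (X i))).
  rewrite /Z adj_sum; last by move=> i; exact: optens_bop.
  rewrite optens_sumr //; last by move=> i; apply: bop_comp => //; apply: adj_bop.
  apply/funext => z; rewrite /= !fct_sumE; apply: eq_bigr => i _.
  have bO := optens_bop T (bR i) (bX i).
  rewrite bop_sum // (bigD1 i) //= big1 ?addr0 => [|j ji].
    have bRi := creR_bop F i; have bX' := adj_bop (bX i).
    rewrite optens_adj // adjK //.
    rewrite -[LHS]/((optens T (adj (creR F i)) (X i) \o optens T (creR F i) (adj (X i))) z).
    by rewrite -optens_comp // adj_creR_creR eqxx.
  have bRj := creR_bop F j; have bX' := adj_bop (bX j).
  rewrite optens_adj // adjK //.
  rewrite -[LHS]/((optens T (adj (creR F i)) (X i) \o optens T (creR F j) (adj (X j))) z).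
  rewrite -optens_comp // adj_creR_creR eq_sym (negbTE ji) optens0l //.
  exact: bop_comp.
set b := opnorm (\sum_(i < n) (X i \o adj (X i))).
have b1 : Num.sqrt b < 1 by exact: rX.2.
apply: le_lt_trans b1; rewrite -opnorm_adj; last exact: hZ_bop.
apply: opnorm_le; [by apply: adj_bop; exact: hZ_bop| |exact: sqrtr_ge0].
move=> z; rewrite -(@ler_pXn2r _ 2) ?nnegrE ?mulr_ge0 ?nrm_ge0 ?sqrtr_ge0 //.
rewrite exprMn sqr_sqrtr ?opnorm_ge0 // nrm_opE; last by apply: adj_bop; exact: hZ_bop.
rewrite adjK; last exact: hZ_bop.
rewrite -[Z _]/((Z \o adj Z) z) ZZ.
apply: le_trans (Re_le_cab _) _; apply: le_trans (cauchy_schwarz _ _) _.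
rewrite expr2 mulrA ler_wpM2r ?nrm_ge0 //.
apply: le_trans (opnorm_nrm _ (optens_bop T bi bXX)) _.
by rewrite ler_wpM2r ?nrm_ge0 // opnorm_optens_idl.
Qed.

(** Adjoints multiply in the opposite order: R_i^* R_(rev w)^* is the adjoint of R_(rev w) R_i, the
    monomial of rev (i :: w). *)
Lemma opow_hZ k : opow Z k =
  \sum_(w : k.-tuple 'I_n) optens T (adj (Rw (rev w))) (monom X w).
Proof.
have bRw w : bop (adj (Rw w)) by apply: adj_bop; exact: Rw_bop.
have bXw w : bop (monom X w) by exact: monom_bop.
elim: k => [|k IH].
  rewrite (big_tuple0 (fun w => optens T (adj (Rw (rev w))) (monom X w))) /=.
  by rewrite adj_id optens_id.
rewrite (big_tupleS _ (fun w => optens T (adj (Rw (rev w))) (monom X w))).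
rewrite -[LHS]/(Z \o opow Z k) IH; apply/funext => z.
rewrite /Z /= !fct_sumE; apply: eq_bigr => i _; rewrite fct_sumE.
have bO := optens_bop T (bR i) (bX i).
rewrite bop_sum //; apply: eq_bigr => w _.
rewrite -[LHS]/((optens T (adj (creR F i)) (X i) \o
  optens T (adj (Rw (rev w))) (monom X w)) z).
rewrite -optens_comp // rev_cons monom_rcons adj_comp //; first exact: Rw_bop.
exact: creR_bop.
Qed.

Let D := opclosure (opspan T (sysR F) (@bop R H H)).

Let lD : oplin D.
Proof.
have h : opspan T (sysR F) (@bop R H H) `<=` @bop R _ _.
  by apply: opspan_bop => // f; exact: sysR_bop.
apply: opclosure_lin => //; apply: opspan_lin => //; last exact: sysR_lin.
by move=> f; exact: sysR_bop.
Qed.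

Let D_tens f A : sysR F f -> bop A -> D (optens T f A).
Proof.
move=> sf bA; apply: opclosure_sub; first by apply: optens_bop => //; exact: sysR_bop.
exact: opspan_tens.
Qed.

Lemma hpart_bop N : bop (\sum_(k < N) \sum_(w : k.-tuple 'I_n)
  optens T (hcoef w) (monom X w)).
Proof.
apply: bop_bigsum => k _; apply: bop_bigsum => w _.
by apply: optens_bop; [exact: hcoef_bop|exact: monom_bop].
Qed.

(** [herglotz] applies the chosen ampliation [M] to u = 2 L - I, which is only a norm limit of sums
    of elementary tensors. Linearity computes [M] on the partial sums, and the bound of [M] on the
    closed domain [D] carries the result to [u]. *)
Lemma herglotz_spec : bop (herglotz T mu X) /\
  opnorm (\sum_(k < N) \sum_(w : k.-tuple 'I_n) optens T (hcoef w) (monom X w)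
    - herglotz T mu X) @[N --> \oo] --> (0 : R).
Proof.
have [L [bL iL IZL hL]] := neumann hZ_bop hZ_norm.
rewrite /herglotz -/Z iL IZL; have := ampliation_spec.
move: (ampliation mu) => M [bA lA [c cA] tA]; set u := 2%:R *: L - idfun.
have bi := @bop_id R (tprod T F H).
have bu : bop u by apply: bop_sub => //; apply: bop_scale.
have sRw w : sysR F (adj (Rw w)) by apply: sysR_adj; exact: sysR_monom.
have bXw w : bop (monom X w) by exact: monom_bop.
(* Partial sums of I + 2 Z + 2 Z^2 + .... Twice the Neumann partial sum minus the identity is [S N]
   only for positive [N], hence the successors below. *)
pose S N := \sum_(k < N) (if k == 0%N :> nat then 1 else 2%:R) *: opow Z k.
have lO : oplin (opspan T (sysR F) (@bop R H H)).
  by apply: opspan_lin => //; [move=> f; exact: sysR_bop|exact: sysR_lin].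
have OS N : opspan T (sysR F) (@bop R H H) (S N).
  apply: oplin_sum => // k _; apply: oplinZ => //; rewrite opow_hZ.
  by apply: oplin_sum => // w _; exact: opspan_tens.
have bS N : bop (S N).
  apply: bop_bigsum => k _; apply: bop_scale; apply: opow_bop; exact: hZ_bop.
have DS N : D (S N) by apply: opclosure_sub.
have SE N : S N.+1 = 2%:R *: (\sum_(k < N.+1) opow Z k) - idfun.
  rewrite /S !big_ord_recl /= scale1r scalerDr scaler_sumr.
  have -> : \sum_(i < N) (if bump 0 i == 0%N then 1 else 2%:R) *: opow Z (bump 0 i) =
      \sum_(i < N) 2%:R *: opow Z (bump 0 i) by apply: eq_bigr.
  by rewrite addrAC scaler_nat mulr2n addrK.
have Su N : opnorm (S N.+1 - u) <= 2 * opnorm (\sum_(k < N.+1) opow Z k - L).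
  have -> : S N.+1 - u = 2%:R *: (\sum_(k < N.+1) opow Z k - L).
    by rewrite SE /u opprB addrA subrK scalerBr.
  have bB : bop (\sum_(k < N.+1) opow Z k - L).
    apply: bop_sub => //; apply: bop_bigsum => k _; apply: opow_bop; exact: hZ_bop.
  apply: le_trans (opnorm_scale _ bB) _.
  by rewrite -(rmorph_nat (real_complex R)) cabR normr_nat.
have bSL N : bop (\sum_(k < N) opow Z k - L).
  apply: bop_sub => //; apply: bop_bigsum => k _; apply: opow_bop; exact: hZ_bop.
have small d : 0 < d -> exists N0, forall N, (N0 <= N)%N ->
    opnorm (S N.+1 - u) < d.
  move=> d0; have d2 : 0 < d / 2 by rewrite divr_gt0.
  have /op_cvgP/(_ _ d2)[N0 hN] := hL; exists N0 => N NN.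
  have := hN N.+1 (leqW NN); rewrite ger0_norm ?opnorm_ge0 // => h.
  apply: le_lt_trans (Su N) _; lra.
have Du : D u.
  split=> // d d0; have [N /(_ N (leqnn N)) hN] := small _ d0.
  by exists (S N.+1); rewrite // opnormBC.
have MZ a v : D v -> M (a *: v) = a *: M v.
  move=> Dv; have M0 : M 0 = 0.
    have := lA (-1) 0 0 lD.1 lD.1; rewrite scaler0 addr0 scaleN1r addNr.
    by [].
  by have := lA a v 0 Dv lD.1; rewrite M0 !addr0.
have MSum I (r : seq I) (f : I -> tprod T F H -> tprod T F H) :
    (forall i, D (f i)) -> M (\sum_(i <- r) f i) = \sum_(i <- r) M (f i).
  move=> Df; elim: r => [|i r IH].
    by rewrite !big_nil; have := MZ 0 0 lD.1; rewrite !scale0r.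
  rewrite !big_cons -IH -[f i]scale1r lA ?scale1r //; first exact: Df.
  exact: (oplin_sum lD).
have MS N : M (S N) = \sum_(k < N) \sum_(w : k.-tuple 'I_n)
    optens T (hcoef w) (monom X w).
  have Do k : D (opow Z k).
    rewrite opow_hZ; apply: oplin_sum => // w _; exact: D_tens.
  rewrite MSum => [|k]; last exact: oplinZ.
  apply: eq_bigr => k _; rewrite MZ // opow_hZ MSum => [|w]; last exact: D_tens.
  rewrite scaler_sumr; apply: eq_bigr => w _.
  have -> : (k == 0%N :> nat) = (tval w == [::]).
    by rewrite -size_eq0 size_tuple.
  rewrite tA // /hcoef optensZl //; apply: cmap_bop => //.
  by apply: adj_bop; exact: Rw_bop.
split; first exact: bA.
apply/op_cvgP => d d0.
(* The constant of an ampliation comes without a sign, hence the absolute value. *)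
have c0 : 0 < `|c| + 1 by rewrite ltr_wpDl.
have [N0 hN] := small _ (divr_gt0 d0 c0).
exists N0.+1 => -[//|N] NN; rewrite -MS.
have DSu : D (S N.+1 - u) by apply: oplinB.
have -> : M (S N.+1) - M u = M (S N.+1 - u).
  have -> : S N.+1 - u = (-1) *: u + S N.+1 by rewrite scaleN1r addrC.
  by rewrite (lA _ _ _ Du (DS N.+1)) scaleN1r addrC.
rewrite ger0_norm; last by apply: opnorm_ge0; exact: bA.
apply: le_lt_trans (cA _ DSu) _.
have o0 : 0 <= opnorm (S N.+1 - u) by apply: opnorm_ge0; exact: bop_sub.
have := hN N NN; rewrite ltr_pdivlMr //; apply: le_lt_trans.
rewrite mulrC ler_wpM2l //; apply: le_trans (ler_norm c) _; by rewrite lerDl.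
Qed.

End HerglotzSeries.

(** * Norm bounds for sums of A_i^* A_i and Bessel's inequality *)

Section GramBound.
Variables (R : realType) (V W : hilbertType R) (I : finType).

(** For y the value of the sum at x, |y|^2 is the real part of the sum of <A_i x, A_i y>. The
    inequality 2ab <= t a^2 + b^2 / t with t = |y| / |x| balances the two resulting sums and gives
    |y|^2 <= C |x| |y|. *)
Lemma gram_bound (A : I -> V -> W) (C : R) : (forall i, bop (A i)) -> 0 <= C ->
  (forall x, \sum_i nrm (A i x) ^+ 2 <= C * nrm x ^+ 2) ->
  opnorm (\sum_i (adj (A i) \o A i)) <= C.
Proof.
move=> bA C0 AC.
have bP : bop (\sum_i (adj (A i) \o A i)).
  by apply: bop_bigsum => i _; apply: bop_comp => //; apply: adj_bop.
apply: opnorm_le => // x; set y := (\sum_i _) x.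
have [y0|y0] := eqVneq (nrm y) 0; first by rewrite y0 mulr_ge0 ?nrm_ge0.
have yp : 0 < nrm y by rewrite lt_def y0 nrm_ge0.
have xp : 0 < nrm x.
  rewrite lt_def nrm_ge0 andbT; apply: contraNN y0 => /eqP/nrm_eq0 x0.
  by rewrite /y x0 bop0 // nrm0.
have yE : nrm y ^+ 2 = complex.Re (\sum_i '<< A i x, A i y >>).
  rewrite nrm_sqE {1}/y fct_sumE inner_suml; congr complex.Re.
  by apply: eq_bigr => i _ /=; rewrite -adjEr.
have t0 : 0 < nrm y / nrm x by rewrite divr_gt0.
have amgm (t a b : R) : 0 < t -> 2 * (a * b) <= t * a ^+ 2 + b ^+ 2 / t.
  move=> t1; rewrite -subr_ge0.
  have -> : t * a ^+ 2 + b ^+ 2 / t - 2 * (a * b) = (t * a - b) ^+ 2 / t.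
    by field; rewrite gt_eqF.
  by rewrite divr_ge0 ?sqr_ge0 // ltW.
have h : 2 * nrm y ^+ 2 <= nrm y / nrm x * (C * nrm x ^+ 2) +
    (C * nrm y ^+ 2) / (nrm y / nrm x).
  rewrite {1}yE raddf_sum /=.
  apply: (@le_trans _ _ (\sum_i (nrm y / nrm x * nrm (A i x) ^+ 2 +
      nrm (A i y) ^+ 2 / (nrm y / nrm x)))).
    rewrite mulr_sumr; apply: ler_sum => i _; apply: le_trans (amgm _ _ _ t0).
    rewrite ler_wpM2l //; apply: le_trans (Re_le_cab _) _; exact: cauchy_schwarz.
  rewrite big_split /= -mulr_sumr -mulr_suml; apply: lerD.
    by rewrite ler_wpM2l ?AC // ltW.
  by rewrite ler_wpM2r ?AC // invr_ge0 ltW.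
have e1 : nrm y / nrm x * (C * nrm x ^+ 2) = C * nrm x * nrm y.
  by field; rewrite gt_eqF.
have e2 : (C * nrm y ^+ 2) / (nrm y / nrm x) = C * nrm x * nrm y.
  by field; rewrite !gt_eqF.
rewrite e1 e2 in h.
by rewrite -(ler_pM2r yp) -expr2; lra.
Qed.

(** The vector z' = sum B_i B_i^* z is the projection of z onto the sum of the orthogonal ranges, so
    |z'|^2 = <z', z> and Cauchy-Schwarz applies. *)
Lemma bessel_isometries (B : I -> V -> W) (z : W) : (forall i, bop (B i)) ->
  (forall i j, adj (B i) \o B j = if i == j then idfun else 0) ->
  \sum_i nrm (adj (B i) z) ^+ 2 <= nrm z ^+ 2.
Proof.
move=> bB BB; pose z' := \sum_i B i (adj (B i) z).
have s1 : complex.Re '<< z', z >> = \sum_i nrm (adj (B i) z) ^+ 2.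
  rewrite inner_suml raddf_sum /=; apply: eq_bigr => i _.
  by rewrite adjE // -nrm_sqE.
have s2 : nrm z' ^+ 2 = \sum_i nrm (adj (B i) z) ^+ 2.
  rewrite nrm_sqE inner_suml raddf_sum /=; apply: eq_bigr => i _.
  rewrite adjE // /z' bop_sum; last exact: adj_bop.
  rewrite (bigD1 i) //= -[adj (B i) (B i _)]/((adj (B i) \o B i) _) BB eqxx.
  rewrite big1 ?addr0 -?nrm_sqE // => j ji.
  by rewrite -[adj (B i) (B j _)]/((adj (B i) \o B j) _) BB eq_sym (negbTE ji).
have h : nrm z' ^+ 2 <= nrm z' * nrm z.
  by rewrite s2 -s1; apply: le_trans (Re_le_cab _) _; exact: cauchy_schwarz.
have n0 := nrm_ge0 z'; have n1 := nrm_ge0 z.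
rewrite -s2 ler_pXn2r ?nnegrE //.
have [->//|z0] := eqVneq (nrm z') 0.
have zp : 0 < nrm z' by rewrite lt_def z0 n0.
by rewrite -(ler_pM2l zp) -expr2.
Qed.

End GramBound.

(** * The Herglotz series as a free holomorphic function *)

Section HerglotzFunction.
Variables (R : realType) (n : nat) (F : fock_space R n) (T : hilbert_tensor R).
Variables (E Y : hilbertType R) (G : E -> tprod T Y F).
Hypothesis bG : bop G.

Local Notation Rw := (monom (creR F)).

(** Up to a factor at most 2 and the adjoint of G, the vectors hcoef w x are the Bessel coefficients
    of G x along the isometries I ⊗ R_(rev w), whose ranges are orthogonal for |w| = k. The bound is
    therefore independent of k. *)
Lemma hcoef_gram k x : \sum_(w : k.-tuple 'I_n) nrm (hcoef G w x) ^+ 2 <=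
  (2 * opnorm G) ^+ 2 * opnorm G ^+ 2 * nrm x ^+ 2.
Proof.
have bi := @bop_id R Y; have bR w := Rw_bop F w; have bR' w := adj_bop (bR w).
pose B (w : k.-tuple 'I_n) := optens T (idfun : Y -> Y) (Rw (rev w)).
have bB w : bop (B w) by exact: optens_bop.
have bs : \sum_(w : k.-tuple 'I_n) nrm (adj (B w) (G x)) ^+ 2 <= nrm (G x) ^+ 2.
  apply: bessel_isometries => // v w; rewrite /B optens_adj // -optens_comp //; last exact: adj_bop.
  rewrite adj_id Rw_orth ?size_rev ?size_tuple // (can_eq revK) val_eqE.
  by case: eqP => _; rewrite ?optens_id ?optens0r.
apply: (@le_trans _ _ ((2 * opnorm G) ^+ 2 * nrm (G x) ^+ 2)); last first.
  rewrite -mulrA ler_wpM2l ?sqr_ge0 // -exprMn.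
  by rewrite ler_pXn2r ?nnegrE ?mulr_ge0 ?nrm_ge0 ?opnorm_ge0 // opnorm_nrm.
apply: le_trans (ler_wpM2l (sqr_ge0 _) bs); rewrite mulr_sumr.
apply: ler_sum => w _; rewrite -exprMn.
rewrite ler_pXn2r ?nnegrE ?mulr_ge0 ?nrm_ge0 ?opnorm_ge0 //.
rewrite /hcoef -[(_ *: _) x]/(_ *: adj G (optens T idfun (adj (Rw (rev w))) (G x))).
rewrite nrmZ -mulrA; apply: ler_pM; rewrite ?cab_ge0 ?nrm_ge0 //.
  case: ifP => _; first by rewrite -[1]/(1%:C) cabR normr1 ler1n.
  by rewrite -(rmorph_nat (real_complex R)) cabR normr_nat.
apply: le_trans (opnorm_nrm _ (adj_bop bG)) _; rewrite opnorm_adj //.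
by rewrite /B optens_adj // adj_id.
Qed.

Lemma hcoef_limsup : (limn_esup (fun k : nat =>
  (opnorm (\sum_(w : k.-tuple 'I_n) (adj (hcoef G w) \o hcoef G w))
     `^ (2 * k)%:R^-1)%:E) <= 1)%E.
Proof.
have bh w : bop (hcoef G w) by exact: hcoef_bop.
apply: (@limn_esup_le1 _ _ ((2 * opnorm G) ^+ 2 * opnorm G ^+ 2)) => k.
  by apply: opnorm_ge0; exact: bop_gram.
by apply: gram_bound => //; [rewrite mulr_ge0 ?sqr_ge0|exact: hcoef_gram].
Qed.

Definition herglotz_fun : free_hol n E E :=
  FreeHol (fun w => hcoef_bop bG w) hcoef_limsup.

Lemma herglotz_funP (H : hilbertType R) (X : 'I_n -> H -> H) : row_ball X ->
  fh_eval T herglotz_fun X = herglotz T (cmap G) X.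
Proof.
move=> rX; have [bh hh] := herglotz_spec bG rX.
by apply: oplimE => // N; exact: (hpart_bop bG rX).
Qed.

End HerglotzFunction.

(** * Uniqueness of coefficients *)

Section ShiftTuple.
Variables (R : realType) (n : nat) (H : hilbertType R).
Variables (w : seq 'I_n) (f : nat -> H) (c : R).
Local Notation k := (size w).
Hypothesis of_ : orthon k.+1 f.
Hypothesis c0 : 0 < c.

(* Backward shifts along the word [w]: the monomial of a word [v] of length
   [size w] sends [f (size w)] to [c ^+ size w] times [f 0] if [v = w], and to
   0 otherwise. *)
Definition wshift (i : 'I_n) : H -> H := fun h =>
  c%:C *: \sum_(j < k) (if nth i w j == i then '<< h, f j.+1 >> else 0) *: f j.

Lemma orthon_nrm m : (m <= k)%N -> nrm (f m) = 1.
Proof.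
move=> mk; apply/eqP; rewrite -(@eqrXn2 _ 2) ?nrm_ge0 // expr1n; apply/eqP/complexI.
by rewrite -inner_nrm of_ // eqxx.
Qed.

Lemma wshift_nrm i h : nrm (wshift i h) <= c * k%:R * nrm h.
Proof.
rewrite /wshift nrmZ cabR gtr0_norm // -mulrA ler_wpM2l ?(ltW c0) //.
apply: le_trans (nrm_sum _ _ _) _.
apply: (@le_trans _ _ (\sum_(j < k) nrm h)); last first.
  by rewrite sumr_const card_ord mulr_natl.
apply: ler_sum => j _; rewrite nrmZ orthon_nrm ?mulr1; last exact: ltnW.
case: ifP => _; last by rewrite cab0 nrm_ge0.
by apply: le_trans (cauchy_schwarz _ _) _; rewrite orthon_nrm ?mulr1.
Qed.

Lemma wshift_bop i : bop (wshift i).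
Proof.
apply: (@bop_bound _ _ _ _ (c * k%:R)) => [a x y||x]; last exact: wshift_nrm.
  rewrite /wshift scalerA [a * _]mulrC -scalerA -scalerDr; congr (_ *: _).
  rewrite scaler_sumr -big_split /=; apply: eq_bigr => j _.
  case: ifP => _; last by rewrite scale0r scaler0 addr0.
  by rewrite innerDl innerZl scalerDl scalerA.
by rewrite mulr_ge0 // ltW.
Qed.

Lemma wshift0 i : wshift i (f 0) = 0.
Proof.
rewrite /wshift big1 ?scaler0 // => j _.
by rewrite of_ ?ltnS ?ltn_ord //= if_same scale0r.
Qed.

Lemma wshiftS i m : (m < k)%N ->
  wshift i (f m.+1) = if nth i w m == i then c%:C *: f m else 0.
Proof.
move=> mk; rewrite /wshift (bigD1 (Ordinal mk)) //= of_ // eqxx [X in _ + X]big1.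
  by rewrite addr0; case: ifP => _; rewrite ?scale1r // scale0r scaler0.
move=> j jm; rewrite of_ ?ltnS ?ltn_ord // eqSS.
have -> : (m == j :> nat) = false.
  by apply: contraNF jm => /eqP mj; apply/eqP/val_inj.
by rewrite if_same scale0r.
Qed.

(** Each letter lowers the index by one or annihilates, so a word longer than [m] pushes f_m below
    index 0. *)
Lemma monom_wshift_small v m : (m <= k)%N -> (m < size v)%N ->
  monom wshift v (f m) = 0.
Proof.
elim/last_ind: v m => [//|v i IH] m mk; rewrite size_rcons ltnS => mv.
rewrite monom_rcons /=; have b := monom_bop v wshift_bop.
case: m mk mv => [|m] mk mv; first by rewrite wshift0 bop0.
rewrite wshiftS //; case: eqP => _; last by rewrite bop0.
by rewrite bopZ // IH ?scaler0 // ltnW.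
Qed.

Lemma monom_wshift_big v : (k < size v)%N -> monom wshift v = 0.
Proof.
case/lastP: v => [//|v i]; rewrite size_rcons ltnS => kv.
have b := monom_bop v wshift_bop.
apply/funext => h; rewrite monom_rcons /= {2}/wshift bopZ // bop_sum // big1 ?scaler0 //.
move=> j _; rewrite bopZ // monom_wshift_small ?scaler0 //.
  exact: ltnW.
exact: leq_trans (ltn_ord j) kv.
Qed.

(** Induction from the right: the last letter of [v] acts first on f_(m+1) and survives only if it
    is the letter of [w] at position [m]. *)
Lemma monom_wshift_inner v m : (m <= k)%N ->
  '<< monom wshift v (f m), f 0 >> = if v == take m w then (c ^+ m)%:C else 0.
Proof.
elim: m v => [|m IH] v mk.
  rewrite take0; case/lastP: v => [|v i]; first by rewrite eqxx /= of_ // eqxx expr0.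
  rewrite monom_wshift_small ?inner0l ?size_rcons //.
  by case: eqP => // /(congr1 size); rewrite size_rcons.
case/lastP: v => [|v i].
  rewrite /= of_ //=; case: eqP => // /(congr1 size).
  by rewrite size_take; case: ifP => //; case: (w) mk.
rewrite monom_rcons /= wshiftS // (take_nth i) // eqseq_rcons [_ == nth _ _ _]eq_sym.
have b := monom_bop v wshift_bop.
case: eqP => _; last by rewrite andbF bop0 ?inner0l.
rewrite andbT bopZ // innerZl IH; last exact: ltnW.
by case: ifP => _; rewrite ?mulr0 // -rmorphM exprS.
Qed.

Lemma wshift_row_ball : n%:R * (c * k%:R) ^+ 2 < 1 -> row_ball wshift.
Proof.
move=> hc; have c1 : 0 <= c * k%:R by rewrite mulr_ge0 // ltW.
have nW i : opnorm (wshift i) <= c * k%:R.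
  by apply: opnorm_le => //; [exact: wshift_bop|exact: wshift_nrm].
split; first exact: wshift_bop.
rewrite -sqrtr1 ltr_sqrt //; apply: le_lt_trans hc.
have h (s : seq 'I_n) : opnorm (\sum_(i <- s) (wshift i \o adj (wshift i))) <=
    (size s)%:R * (c * k%:R) ^+ 2.
  elim: s => [|i s IH]; first by rewrite big_nil opnorm0 mul0r.
  have b := wshift_bop i; have b' := adj_bop b.
  have -> : (size (i :: s))%:R = (size s)%:R + 1 :> R by rewrite natr1.
  rewrite big_cons mulrDl mul1r addrC; apply: le_trans (opnorm_add _ _) _.
  - by apply: bop_bigsum => j _; apply: bop_comp; [|apply: adj_bop]; exact: wshift_bop.
  - exact: bop_comp.
  apply: lerD; first exact: IH.
   apply: le_trans (opnorm_comp b b') _.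
  by rewrite opnorm_adj // expr2 ler_pM ?opnorm_ge0.
by have := h (enum 'I_n); rewrite size_enum_ord big_enum.
Qed.

End ShiftTuple.

Section CoefficientUniqueness.
Variables (R : realType) (n : nat) (T : hilbert_tensor R).
Variables (E Y H : hilbertType R).

(** By nilpotency the partial sums are constant beyond degree [size w], so the limit is one of them.
    The entry between [f (size w)] and [f 0] then selects the word [w]. *)
Lemma fh_eval_wshift (A : free_hol n E Y) w (f : nat -> H) (c : R) x y :
  orthon (size w).+1 f -> 0 < c ->
  '<< fh_eval T A (wshift w f c) (tens T E H x (f (size w))), tens T Y H y (f 0) >> =
  '<< A w x, y >> * (c ^+ size w)%:C.
Proof.
move=> of_ c0; have bA := @coef_bop _ _ _ _ A.
have bX := wshift_bop of_ c0; have bXv v : bop (monom (wshift w f c) v) := monom_bop v bX.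
set P := fun N : nat => \sum_(k < N) \sum_(v : k.-tuple 'I_n)
  optens T (A v) (monom (wshift w f c) v).
have bP N : bop (P N).
  by apply: bop_bigsum => k _; apply: bop_bigsum => v _; exact: optens_bop.
have PE N : ((size w).+1 <= N)%N -> P N = P (size w).+1.
  move=> wN; rewrite /P -!(big_mkord xpredT (fun k => \sum_(v : k.-tuple 'I_n)
    optens T (A v) (monom (wshift w f c) v))).
  rewrite (big_cat_nat (n := (size w).+1)) //= [X in _ + X]big_nat_cond [X in _ + X]big1 ?addr0 //.
  move=> k /andP[/andP[wk _] _]; apply: big1 => v _.
  by rewrite (monom_wshift_big of_ c0) ?size_tuple // optens0r.
have -> : fh_eval T A (wshift w f c) = P (size w).+1.
  apply: oplimE => //; apply/op_cvgP => e e0; exists (size w).+1 => N wN.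
  by rewrite -/(P N) PE // subrr opnorm0 normr0.
have key k : '<< (\sum_(v : k.-tuple 'I_n) optens T (A v) (monom (wshift w f c) v))
      (tens T E H x (f (size w))), tens T Y H y (f 0) >> =
    \sum_(v : k.-tuple 'I_n) (if tval v == w then '<< A w x, y >> * (c ^+ size w)%:C else 0).
  rewrite fct_sumE inner_suml; apply: eq_bigr => v _.
  rewrite optensE // tens_inner (monom_wshift_inner of_ c0) // take_size.
  by case: eqP => [->|_]; rewrite ?mulr0.
rewrite /P fct_sumE inner_suml big_ord_recr /= big1 ?add0r => [|k _]; last first.
  rewrite key big1 // => v _; case: eqP => // /(congr1 size).
  by rewrite size_tuple => kw; have := ltn_ord k; rewrite {1}kw ltnn.
rewrite key (bigD1 (in_tuple w)) //= eqxx big1 ?addr0 // => v vw.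
by rewrite -val_eqE /= in vw; rewrite (negbTE vw).
Qed.

Lemma free_hol_uniq (A B : free_hol n E Y) : infinite_dimensional H ->
  (forall X : 'I_n -> H -> H, row_ball X -> fh_eval T A X = fh_eval T B X) ->
  forall w, A w = B w.
Proof.
move=> iH AB w; have [f of_] := infinite_orthon iH (size w).+1.
(* Makes c |w| smaller than 1 / (n + 1), hence n (c |w|)^2 < 1, while c is nonzero for the final
   cancellation. *)
pose c : R := (n.+1%:R * (size w).+1%:R)^-1.
have p0 : 0 < n.+1%:R * (size w).+1%:R :> R by rewrite mulr_gt0.
have c0 : 0 < c by rewrite invr_gt0.
have rX : row_ball (wshift w f c).
  apply: wshift_row_ball => //.
  have h1 : c * (size w)%:R < n.+1%:R^-1.
    rewrite /c invfM -mulrA gtr_pMr ?invr_gt0 // mulrC ltr_pdivrMr // mul1r.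
    by rewrite ltr_nat.
  have h2 : 0 <= c * (size w)%:R by rewrite mulr_ge0 // ltW.
  apply: (@le_lt_trans _ _ (n%:R * n.+1%:R^-1 ^+ 2)).
    by rewrite ler_wpM2l // ler_pXn2r ?nnegrE // ltW.
  rewrite exprVn ltr_pdivrMr ?exprn_gt0 // mul1r -natrX ltr_nat.
  by rewrite -[X in (X <= _)%N]expn1 leq_pexp2l.
apply/funext => x; apply: inner_inj => y.
have := fh_eval_wshift A x y of_ c0; rewrite (AB _ rX) (fh_eval_wshift B x y of_ c0).
move=> /esym /mulIf; apply.
by rewrite -[0]/(0%:C) (inj_eq (@complexI R)) expf_neq0 // gt_eqF.
Qed.

End CoefficientUniqueness.

(** * Pluriharmonic majorants *)

Section FockEvaluation.
Variables (R : realType) (n : nat) (F : fock_space R n) (T : hilbert_tensor R).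
Variables E Y : hilbertType R.

Local Notation e := (fock_e F).
Local Notation tn := (tens T _ _).
Local Notation X := (scaled_creR F).

(* [P_s] of a contraction compresses to a contraction, which is the Schwarz
   inequality [P_s[u]^* P_s[u] <= P_s[u^* u]]. *)
Lemma rpois_schwarz (s : R) (u : tprod T E F -> tprod T Y F) z : 0 <= s < 1 -> bop u ->
  (nrm (rpois s u z) ^+ 2)%:C <= '<< rpois s (adj u \o u) z, z >>.
Proof.
move=> s01 bu; have bi := @bop_id R F; have bu' := adj_bop bu.
have bo : bop (optens T u (idfun : F -> F)) by apply: optens_bop.
have bY := kernE_bop F T s01 Y; have bE := kernE_bop F T s01 E.
have -> : '<< rpois s (adj u \o u) z, z >> =
    (nrm (optens T u (idfun : F -> F) (@kernE R n F T s E z)) ^+ 2)%:C.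
  rewrite /rpois /= -adjEr // -[X in optens T _ X]/(idfun \o (idfun : F -> F)).
  by rewrite optens_comp //= -[X in optens T _ X](adj_id F) -optens_adj // -adjEr // inner_nrm.
rewrite lecR ler_pXn2r ?nnegrE ?nrm_ge0 // /rpois /=.
apply: le_trans (opnorm_nrm _ (adj_bop bY)) _.
by rewrite opnorm_adj // ler_piMl ?nrm_ge0 // opnorm_kernE.
Qed.

Lemma radial_adj_suml Z I (s : seq I) (B : I -> tprod T E F -> tprod T Y F)
    (C : tprod T Z F -> tprod T Y F) : (forall i, bop (B i)) ->
  (forall i, radial (adj (B i) \o C)) -> radial (adj (\sum_(i <- s) B i) \o C).
Proof.
move=> bB rB; rewrite adj_sum //.
have -> : (\sum_(i <- s) adj (B i)) \o C = \sum_(i <- s) (adj (B i) \o C).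
  by apply/funext => z /=; rewrite !fct_sumE.
by apply: radial_sum.
Qed.

Lemma radial_adj_sumr Z I (s : seq I) (B : I -> tprod T Z F -> tprod T Y F)
    (C : tprod T E F -> tprod T Y F) : bop C -> (forall i, bop (B i)) ->
  (forall i, radial (adj C \o B i)) -> radial (adj C \o \sum_(i <- s) B i).
Proof.
move=> bC bB rB; have bC' := adj_bop bC.
have -> : adj C \o \sum_(i <- s) B i = \sum_(i <- s) (adj C \o B i).
  by apply/funext => z /=; rewrite !fct_sumE bop_sum.
by apply: radial_sum.
Qed.

Variable A : free_hol n E Y.
Let bA := @coef_bop _ _ _ _ A.

Local Notation Ae r := (fh_eval T A (X r)).
Local Notation Ap r N := (\sum_(k < N) \sum_(w : k.-tuple 'I_n)
  optens T (A w) (monom (X r) w)).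

Lemma fh_approx (r d : R) : 0 <= r < 1 -> 0 < d -> exists N, opnorm (Ae r - Ap r N) < d.
Proof.
move=> r01 d0; have [_ /op_cvgP/(_ d d0)[N /(_ N (leqnn N)) hN]] := fh_eval_spec F T A r01.
by exists N; rewrite opnormBC; apply: le_lt_trans (ler_norm _) hN.
Qed.

(** On partial sums the transform multiplies each monomial by a power of [s]; its contractivity
    carries the identity to the norm limit. *)
Lemma rpois_fh (s r : R) : 0 <= s < 1 -> 0 <= r < 1 -> rpois s (Ae r) = Ae (s * r).
Proof.
move=> s01 r01; have [bL /op_cvgP hL] := fh_eval_spec F T A r01; symmetry.
have bP t N := fpart_bop F T bA t N.
apply: oplimE => [N||]; [exact: bP|exact: rpois_bop|].
apply/op_cvgP => d /hL[N hN]; exists N => k /hN.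
have -> : Ap (s * r) k = rpois s (Ap r k).
  have bm j (w : j.-tuple 'I_n) : bop (optens T (A w) (monom (X r) w)).
    by apply: optens_bop => //; apply: monom_bop; exact: scaled_creR_bop.
  rewrite rpois_sum // => [|j]; last exact: bop_bigsum.
  apply: eq_bigr => j _; rewrite rpois_sum //; apply: eq_bigr => w _.
  have bw := Rw_bop F w.
  rewrite !monom_scaled !optensZr // rpoisZ //; last exact: optens_bop.
  rewrite rpois_monom // monom_scaled optensZr // scalerA -rmorphM /=.
  by rewrite exprMn mulrC.
have bD := bop_sub (bP r k) bL; have bD' := rpois_bop s01 bD.
rewrite -rpoisB // !ger0_norm ?opnorm_ge0 //.
by apply: le_lt_trans; apply: opnorm_rpois => //; exact: bop_sub.
Qed.

(** Theta(rR) is a norm limit of polynomials, so its Gram operator is a norm limit of finite sums of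
    the products handled by [radial_gram]. *)
Lemma radial_fh_gram (r : R) : 0 <= r < 1 -> radial (adj (Ae r) \o Ae r).
Proof.
move=> r01; have bL := fh_eval_bop F T A r01; have bL' := adj_bop bL.
apply: radial_lim => [|d d0]; first exact: bop_comp.
have c0 : 0 < 2 * opnorm (Ae r) + 1 by rewrite ltr_wpDl // mulr_ge0 // opnorm_ge0.
(* The bound 1 keeps the norm of the polynomial below that of [Ae r] plus 1; the second bound makes
   the two error terms add up to less than [d]. *)
pose q := Num.min 1 (d / (2 * opnorm (Ae r) + 1) / 2).
have q0 : 0 < q by rewrite lt_min ltr01 !divr_gt0.
have [N hN] := fh_approx r01 q0.
have bP := fpart_bop F T bA r N; have bP' := adj_bop bP; have bD := bop_sub bL bP.
have hD : opnorm (Ae r - Ap r N) < 1 by rewrite (lt_le_trans hN) // ge_min lexx.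
have hd : opnorm (Ae r - Ap r N) * (2 * opnorm (Ae r) + 1) < d.
  rewrite -ltr_pdivlMr //; apply: (lt_le_trans hN); rewrite ge_min; apply/orP; right.
  by rewrite ler_pdivrMr // ler_peMr ?ler1n // divr_ge0 ?ltW.
exists (adj (Ap r N) \o Ap r N).
  have bm k (w : k.-tuple 'I_n) : bop (optens T (A w) (monom (X r) w)).
    by apply: optens_bop => //; apply: monom_bop; exact: scaled_creR_bop.
  apply: radial_adj_suml => [k|k]; first exact: bop_bigsum.
  apply: radial_adj_suml => // w; apply: radial_adj_sumr => [|j|j].
  - exact: bm.
  - exact: bop_bigsum.
  apply: radial_adj_sumr => // v.
  have bw := Rw_bop F w; have bv := Rw_bop F v.
  rewrite !monom_scaled !optensZr // -!optensZl //.
  by apply: radial_gram; exact: bop_scale.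
have -> : (adj (Ae r) \o Ae r) - (adj (Ap r N) \o Ap r N) =
    (adj (Ae r) \o (Ae r - Ap r N)) + (adj (Ae r - Ap r N) \o Ap r N).
  apply/funext => z; rewrite adj_sub //.
  rewrite -[RHS]/(adj (Ae r) (Ae r z - Ap r N z) +
    (adj (Ae r) (Ap r N z) - adj (Ap r N) (Ap r N z))).
  by rewrite (bopB _ _ bL') addrA subrK.
have bD' := adj_bop bD.
apply: le_lt_trans (opnorm_add _ _) _; [exact: bop_comp|exact: bop_comp|].
apply: le_lt_trans hd; apply: (@le_trans _ _ (opnorm (Ae r) * opnorm (Ae r - Ap r N) +
    opnorm (Ae r - Ap r N) * (opnorm (Ae r) + 1))).
  apply: lerD.
    by apply: le_trans (opnorm_comp _ _) _ => //; rewrite opnorm_adj.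
  apply: le_trans (opnorm_comp _ _) _ => //.
  rewrite opnorm_adj // ler_wpM2l ?opnorm_ge0 //.
  have -> : Ap r N = Ae r + - (Ae r - Ap r N) by rewrite opprB addrC subrK.
  apply: le_trans (opnorm_add _ _) _ => //; first exact: bop_opp.
  by rewrite opnormN lerD2l ltW.
by rewrite le_eqVlt; apply/orP; left; apply/eqP; ring.
Qed.

(** R_q e_v = e_(v rev q), so at most one word contributes: the reversed remainder of [w] after its
    prefix [v]. The series of entries is eventually constant. *)
Lemma fh_entry (r : R) x y v w : 0 <= r < 1 ->
  '<< Ae r (tn x (e v)), tn y (e w) >> =
  if prefix v w then (r ^+ (size w - size v))%:C * '<< A (rev (drop (size v) w)) x, y >>
  else 0.
Proof.
move=> r01; set u := rev (drop (size v) w).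
have uw (q : seq 'I_n) : (v ++ rev q == w) = prefix v w && (q == u).
  rewrite /u; apply/eqP/andP => [<-|[/prefixP[q' ->] /eqP ->]].
    by rewrite prefix_prefix drop_size_cat // revK.
  by rewrite drop_size_cat // revK.
have key k : '<< tailv F T A x v k, tn y (e w) >> =
    \sum_(q : k.-tuple 'I_n) (if prefix v w && (tval q == u) then '<< A u x, y >> else 0).
  rewrite /tailv inner_suml; apply: eq_bigr => q _.
  rewrite tens_inner fock_orthonormal uw.
  by case: andP => [[_ /eqP ->]|_]; rewrite ?mulr1 ?mulr0.
have h : '<< \sum_(0 <= k < N) (r ^+ k)%:C *: tailv F T A x v k, tn y (e w) >>
    @[N --> \oo] --> ('<< Ae r (tn x (e v)), tn y (e w) >> : R[i]^o).
  by apply: cvg_inner; [exact: (@fh_eval_tens R n F T E Y A r x v r01)|exact: cvg_cst].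
set rhs := if _ then _ else _.
suff h' : '<< \sum_(0 <= k < N) (r ^+ k)%:C *: tailv F T A x v k, tn y (e w) >>
    @[N --> \oo] --> (rhs : R[i]^o).
  exact: (cvg_unique (@norm_hausdorff _ R[i]^o) h h').
apply/cvg_cab/cvgrPdist_lt => d d0; exists (size u).+1 => // N /= uN.
suff -> : '<< \sum_(0 <= k < N) (r ^+ k)%:C *: tailv F T A x v k, tn y (e w) >> = rhs.
  by rewrite subrr cab0 subrr normr0.
rewrite /rhs inner_suml.
case: ifP => vw; last first.
  apply/eqP; rewrite big1 // => k _; rewrite innerZl key vw big1 ?mulr0 //.
rewrite (bigD1_seq (size u)) ?iota_uniq ?mem_index_iota //= innerZl key.
rewrite (bigD1 (in_tuple u)) //= vw eqxx big1 => [|q /negbTE qu]; last first.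
  by rewrite -val_eqE /= in qu; rewrite qu.
rewrite addr0 big1 ?addr0 => [|k ku]; last first.
  rewrite innerZl key big1 ?mulr0 // => q _; case: andP => // -[_ /eqP qu].
  by move: ku; rewrite -qu size_tuple eqxx.
by rewrite /u size_rev size_drop.
Qed.

End FockEvaluation.

(** * Real parts and pluriharmonic curves *)

Section RealPart.

Lemma opre_bop (R : realType) (V : hilbertType R) (B : V -> V) : bop B -> bop (opre B).
Proof. by move=> bB; apply: bop_scale; apply: bop_add => //; exact: adj_bop. Qed.

Lemma opre_entry (R : realType) (V : hilbertType R) (B : V -> V) x y : bop B ->
  '<< opre B x, y >> = 2^-1 * ('<< B x, y >> + Num.conj '<< B y, x >>).
Proof.
move=> bB; rewrite -[opre B x]/(2^-1 *: (B x + adj B x)) innerZl innerDl; congr (_ * (_ + _)).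
by rewrite innerC -adjE.
Qed.

Variables (R : realType) (n : nat) (F : fock_space R n) (T : hilbert_tensor R).

Local Notation X := (scaled_creR F).

Lemma opre_fh_space E (W : free_hol n E E) (r : R) : 0 <= r < 1 ->
  spaceS (opre (fh_eval T W (X r))).
Proof.
move=> r01; have bL := fh_eval_bop F T W r01; split; first exact: opre_bop.
move=> d d0; have [N hN] := fh_approx F T W r01 d0.
have bP := fpart_bop F T (@coef_bop _ _ _ _ W) r N.
set P := \sum_(k < N) _ in hN bP.
have bop_lin : oplin (@bop R E E).
  by split=> [|c f g bf bg]; [exact: bop_zero|apply: bop_add => //; exact: bop_scale].
have lin : oplin (@polyE R n F T E) by apply: opspan_lin => //; exact: polyR_bop.
have pP : polyE P.
  apply: oplin_sum => // k _; apply: oplin_sum => // w _.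
  rewrite monom_scaled; apply: opspan_tens; first exact: coef_bop.
  by apply: (oplinZ (polyR_lin F)); exact: polyR_monom.
have c2 : Num.conj (2^-1 : R[i]) = 2^-1.
  by rewrite -(rmorph_nat (real_complex R)) -fmorphV conjR.
exists (opre P).
  exists (adj (2^-1 *: P)); first by exists (2^-1 *: P) => //; exact: oplinZ.
  exists (2^-1 *: P); first exact: oplinZ.
  by rewrite adj_scale // c2 /opre scalerDr addrC.
set L := fh_eval _ _ _ in bL hN *; have bD := bop_sub bL bP; have bD' := adj_bop bD.
have -> : opre L - opre P = 2^-1 *: ((L - P) + adj (L - P)).
  by rewrite /opre -scalerBr adj_sub // opprD addrACA.
apply: le_lt_trans hN; apply: le_trans (opnorm_scale _ _) _; first exact: bop_add.
rewrite -(rmorph_nat (real_complex R)) -fmorphV cabR ger0_norm ?invr_ge0 //.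
rewrite mulrC ler_pdivrMr // mulr_natr mulr2n.
by apply: le_trans (opnorm_add _ _) _ => //; rewrite opnorm_adj.
Qed.

(** Operators in [spaceS] are radial, so the transform at r / t multiplies the entry t^d C by (r /
    t)^d and leaves r^d C. *)
Lemma radial_curve E (h : R -> tprod T E F -> tprod T E F)
    (C : E -> E -> seq 'I_n -> seq 'I_n -> R[i]) :
  (forall r, 0 <= r < 1 -> spaceS (h r)) ->
  (forall r x y v w, 0 <= r < 1 ->
    '<< h r (tens T E F x (fock_e F v)), tens T E F y (fock_e F w) >> =
    (r ^+ wdist v w)%:C * C x y v w) ->
  pluriharmonic_curve h.
Proof.
move=> Sh hE; split=> // r t r0 rt t1; have t0 : 0 < t := le_lt_trans r0 rt.
have r01 : 0 <= r < 1 by rewrite r0 (lt_trans rt).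
have t01 : 0 <= t < 1 by rewrite ltW.
have s01 : 0 <= r / t < 1 by rewrite divr_ge0 ?(ltW t0) // ltr_pdivrMr // mul1r.
have [br _] := Sh r r01; have [bt _] := Sh t t01.
have [_ rad] := spaceS_radial (Sh t t01).
rewrite poissonE; apply: bop_eq_fock_tens => // [|x v]; first exact: rpois_bop.
apply: fock_tens_inner_inj => y w; rewrite rad // !hE //.
by rewrite mulrA -rmorphM -exprMn divfK // gt_eqF.
Qed.

End RealPart.

(** * Matrix entries of the real part of W *)

Section HerglotzEntries.
Variables (R : realType) (n : nat) (F : fock_space R n) (T : hilbert_tensor R).
Variables E Y : hilbertType R.

Local Notation e := (fock_e F).
Local Notation Rw := (monom (creR F)).
Local Notation Sw := (monom (creL F)).
Local Notation tn := (tens T _ _).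
Local Notation X := (scaled_creR F).
Local Notation O v := (optens T (idfun : Y -> Y) (Sw v \o flip F)).

Lemma adj_creL_creL (i j : 'I_n) :
  adj (creL F i) \o creL F j = if i == j then idfun else 0.
Proof.
have b := bop_comp (adj_bop (creL_bop F i)) (creL_bop F j).
have aL k w : adj (creL F i) (e (k :: w)) = if i == k then e w else 0.
  apply: fock_inner_inj => u; rewrite -adjEr; last exact: creL_bop.
  rewrite creLE fock_orthonormal eqseq_cons [k == i]eq_sym.
  by case: eqP => _; rewrite ?inner0l ?fock_orthonormal.
apply: (bop_eq_fock b) => [|w /=].
  by case: ifP => _; [exact: bop_id|exact: bop_zero].
by rewrite creLE aL; case: ifP.
Qed.

Lemma shift_entry_cons i j v w (z z' : tprod T Y F) :
  '<< O (i :: v) z, O (j :: w) z' >> = if i == j then '<< O v z, O w z' >> else 0.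
Proof.
have bi := @bop_id R Y; have bL k := creL_bop F k; have bL' k := adj_bop (bL k).
have bO u : bop (Sw u \o flip F) by apply: bop_comp; [exact: Sw_bop|exact: flip_bop].
have OE k u y : O (k :: u) y = optens T (idfun : Y -> Y) (creL F k) (O u y).
  rewrite -[RHS]/((optens T (idfun : Y -> Y) (creL F k) \o O u) y).
  by rewrite -optens_comp.
have bLk k : bop (optens T (idfun : Y -> Y) (creL F k)) by exact: optens_bop.
rewrite !OE adjEr // optens_adj // adj_id.
rewrite -[optens T _ _ (optens T _ _ _)]/((optens T (idfun : Y -> Y) (adj (creL F j)) \o
  optens T (idfun : Y -> Y) (creL F i)) (O v z)).
rewrite -optens_comp // adj_creL_creL eq_sym; case: eqP => _.
  by rewrite optens_id.
by rewrite optens0r // inner0l.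
Qed.

(** Moving U from the second argument to the first produces U S_v U, which is R_v. *)
Lemma shift_entry_nil v (z z' : tprod T Y F) :
  '<< O v z, O [::] z' >> = '<< optens T (idfun : Y -> Y) (Rw v) z, z' >>.
Proof.
have bi := @bop_id R Y; have bf := flip_bop F; have bS := Sw_bop F v.
have bf' : bop (optens T (idfun : Y -> Y) (flip F)) by exact: optens_bop.
rewrite -[monom _ [::] \o flip F]/(flip F) adjEr // optens_adj // adj_id adj_flip.
rewrite -[optens T _ _ (optens T _ _ _)]/((optens T (idfun : Y -> Y) (flip F) \o O v) z).
by rewrite -optens_comp // -?flip_Sw //; exact: bop_comp.
Qed.

Variable G : E -> tprod T Y F.
Hypothesis bG : bop G.

Lemma cmap_adj_shift v x y :
  '<< cmap G (adj (Rw v)) x, y >> = '<< O [::] (G x), O v (G y) >>.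
Proof.
have bw := Rw_bop F v; have bi := @bop_id R Y.
rewrite cmap_inner //; last exact: adj_bop.
rewrite innerC [RHS]innerC shift_entry_nil; congr (Num.conj _).
have bo : bop (optens T (idfun : Y -> Y) (Rw v)) by exact: optens_bop.
by rewrite [RHS]adjE // optens_adj // adj_id.
Qed.

Variable W : free_hol n E E.
Hypothesis WE : forall w, W w = hcoef G w.

(** Induction on both words: equal first letters are stripped without changing either side, and
    distinct ones make both sides 0. In the base cases either one of the two conjugate terms is
    present with coefficient 2, or both with coefficient 1, against the factor 1/2. *)
Lemma herglotz_entry (r : R) x y v w : 0 <= r < 1 ->
  '<< opre (fh_eval T W (X r)) (tn x (e v)), tn y (e w) >> =
  (r ^+ wdist v w)%:C * '<< O v (G x), O w (G y) >>.
Proof.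
move=> r01; have bL := fh_eval_bop F T W r01.
have conjM (a b : R[i]) : Num.conj (a * b) = Num.conj a * Num.conj b := rmorphM _ a b.
have half (z : R[i]) : 2^-1 * (2 * z) = z by rewrite mulrA mulVf ?mul1r // pnatr_eq0.
rewrite opre_entry // !fh_entry //.
have h0 x' y' : '<< W [::] x', y' >> = '<< O [::] (G x'), O [::] (G y') >>.
  by rewrite WE /hcoef eqxx scale1r cmap_adj_shift.
have hS i u x' y' : '<< W (rev (i :: u)) x', y' >> =
    2 * '<< O [::] (G x'), O (i :: u) (G y') >>.
  rewrite WE /hcoef revK -size_eq0 size_rev.
  by rewrite -[(_ *: _) x']/(2 *: cmap G (adj (Rw (i :: u))) x') innerZl cmap_adj_shift.
elim: v w => [|i v IH] [|j w].
- rewrite prefix0s subnn drop0 h0 h0 expr0 !mul1r -innerC.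
  set c := '<< _, _ >>; have -> : c + c = 2 * c by rewrite mulr_natl mulr2n.
  exact: half.
- by rewrite prefix0s prefixs0 drop0 subn0 hS rmorph0 addr0 mulrCA half.
- rewrite prefix0s prefixs0 drop0 subn0 hS add0r !conjM conjR -innerC.
  have -> : Num.conj (2 : R[i]) = 2 by rewrite -(rmorph_nat (real_complex R)) conjR.
  by rewrite mulrCA half /wdist addn0.
- rewrite shift_entry_cons !prefix_cons [j == i]eq_sym /wdist !subSS.
  case: eqP => _; first exact: IH.
  by rewrite rmorph0 addr0 !mulr0.
Qed.

Lemma pluriharmonic_herglotz :
  pluriharmonic_curve (fun r : R => opre (fh_eval T W (X r))).
Proof.
apply: radial_curve => [r r01|r x y v w r01]; first exact: opre_fh_space.
exact: herglotz_entry.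
Qed.

End HerglotzEntries.

(** * Products and inequalities in complex limits *)

Section ComplexLimitRules.
Variables (R : realType) (I : Type) (F : set_system I).
Context {FF : ProperFilter F}.
Implicit Types (u v : I -> R[i]) (l : R[i]).

Lemma cvgC_near_eq u v l : (\forall t \near F, u t = v t) ->
  u @ F --> (l : R[i]^o) -> v @ F --> (l : R[i]^o).
Proof.
move=> uv ul; apply: cvg_trans ul; apply: near_eq_cvg.
by apply: filterS uv => t ->.
Qed.

Lemma cvgCMl (a : I -> R) (b : R) u l : a @ F --> b -> u @ F --> (l : R[i]^o) ->
  (fun t => (a t)%:C * u t) @ F --> (b%:C * l : R[i]^o).
Proof.
move=> ab /cvg_cab ul; apply/cvg_cab.
apply: (@squeeze_cvgr _ _ _ _ (fun=> 0)
    (fun t => `|a t| * cab (u t - l) + `|a t - b| * cab l)).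
- near=> t; rewrite cab_ge0 /=.
  have -> : (a t)%:C * u t - b%:C * l = (a t)%:C * (u t - l) + (a t - b)%:C * l.
    by rewrite mulrBr rmorphB mulrBl addrA subrK.
  by apply: le_trans (cabD _ _) _; rewrite !cabM !cabR.
- exact: cvg_cst.
have -> : 0 = `|b| * 0 + `|b - b| * cab l :> R by rewrite subrr normr0 mulr0 mul0r addr0.
apply: cvgD; first by apply: cvgM => //; exact: cvg_norm.
by apply: cvgM; [apply: cvg_norm; apply: cvgB => //; exact: cvg_cst|exact: cvg_cst].
Unshelve. all: by end_near.
Qed.

Lemma cvgC_ge u l (a : R[i]) : u @ F --> (l : R[i]^o) ->
  (\forall t \near F, a <= u t) -> a <= l.
Proof.
move=> /cvg_cab ul au; rewrite -subr_ge0.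
apply: (@cvgC_ge0 _ _ F _ (fun t => u t - a)).
  apply/cvg_cab; have -> : (fun t => cab (u t - a - (l - a))) = (fun t => cab (u t - l)) => //.
  by apply/funext => t; rewrite opprB addrA subrK.
by apply: filterS au => t; rewrite subr_ge0.
Qed.

Lemma cvgC_le u l (a : R[i]) : u @ F --> (l : R[i]^o) ->
  (\forall t \near F, u t <= a) -> l <= a.
Proof.
move=> /cvg_cab ul au; rewrite -subr_ge0.
apply: (@cvgC_ge0 _ _ F _ (fun t => a - u t)).
  apply/cvg_cab; have -> : (fun t => cab (a - u t - (a - l))) = (fun t => cab (u t - l)) => //.
  by apply/funext => t; rewrite -cabN; congr cab; ring.
by apply: filterS au => t; rewrite subr_ge0.
Qed.

End ComplexLimitRules.

(** * Boundary limits of the Gram operators and majorants *)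

Section Majorant.
Variables (R : realType) (n : nat) (F : fock_space R n) (T : hilbert_tensor R).
Variables E Y : hilbertType R.
Variable A : free_hol n E Y.

Local Notation e := (fock_e F).
Local Notation Sw := (monom (creL F)).
Local Notation tn := (tens T _ _).
Local Notation X := (scaled_creR F).
Local Notation Ae r := (fh_eval T A (X r)).
Local Notation phi := (fun r : R => adj (Ae r) \o Ae r).
Local Notation O v := (optens T (idfun : Y -> Y) (Sw v \o flip F)).

Lemma near_left1 (r : R) : r < 1 -> \forall t \near (1 : R)^'-, r < t < 1.
Proof.
move=> r1; near=> t; apply/andP; split; near: t; first exact: nbhs_left_gt.
exact: nbhs_left_lt.
Unshelve. all: by end_near.
Qed.

Lemma gram_bop (r : R) : 0 <= r < 1 -> bop (phi r).
Proof.
by move=> r01; have b := fh_eval_bop F T A r01; apply: bop_comp => //; exact: adj_bop.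
Qed.

Lemma gram_inner (r : R) z : 0 <= r < 1 -> '<< phi r z, z >> = (nrm (Ae r z) ^+ 2)%:C.
Proof.
by move=> r01; have b := fh_eval_bop F T A r01; rewrite /= -adjEr ?inner_nrm //; exact: adj_bop.
Qed.

Lemma majorant_H2 (h : R -> tprod T E F -> tprod T E F) :
  pluriharmonic_majorant phi h -> H2_ball A.
Proof.
move=> [[Sh hP] hA].
have z01 : 0 <= (0 : R) < 1 by rewrite lexx ltr01.
have [bh0 _] := Sh 0 z01; set c := opnorm (h 0).
have c0 : 0 <= c by exact: opnorm_ge0.
have fb r x : 0 < r < 1 -> nrm (Ae r (tn x (e [::]))) ^+ 2 <= c * nrm x ^+ 2.
  move=> /andP[r0 r1]; have r01 : 0 <= r < 1 by rewrite ltW.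
  set z := tn x (e [::]).
  have zx : nrm z = nrm x.
    rewrite nrm_tens; suff -> : nrm (e [::]) = 1 by rewrite mulr1.
    apply/eqP; rewrite -(@eqrXn2 _ 2) ?nrm_ge0 // expr1n; apply/eqP/complexI.
    by rewrite -inner_nrm fock_orthonormal eqxx.
  have [bh rad] := spaceS_radial (Sh r r01).
  (* The entry at the vacuum has length difference 0, so the transform preserves it, even at scale
     0, where the factor is [0 ^+ 0 = 1]. *)
  have h0E : '<< h 0 z, z >> = '<< h r z, z >>.
    by rewrite (hP 0 r) // poissonE mul0r rad // expr0 mul1r.
  have := hA r r01 z; rewrite -[(_ - _) z]/(h r z - phi r z) innerBl subr_ge0.
  rewrite gram_inner // -h0E => ub.
  have : nrm (Ae r z) ^+ 2 <= complex.Re '<< h 0 z, z >>.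
    by move: ub; rewrite lecE /= => /andP[].
  move=> /le_trans; apply; apply: le_trans (Re_le_cab _) _.
  apply: le_trans (cauchy_schwarz _ _) _; rewrite -zx expr2 mulrA ler_wpM2r ?nrm_ge0 //.
  exact: opnorm_nrm.
have sb x N : \sum_(0 <= k < N) nrm (tailv F T A x [::] k) ^+ 2 <= c * nrm x ^+ 2.
  set S := \sum_(0 <= k < N) _.
  have S0 : 0 <= S by apply: sumr_ge0 => k _; exact: sqr_ge0.
  (* The terms of the series for Theta(rR)(x ⊗ 1) are orthogonal, and r^(2k) is at least r^(2N) for
     k < N; letting r tend to 1 will remove the factor. *)
  have key r : 0 < r < 1 -> r ^+ (2 * N) * S <= c * nrm x ^+ 2.
    move=> r01'; have /andP[r0 r1] := r01'; have r01 : 0 <= r < 1 by rewrite ltW.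
    apply: le_trans (fb r x r01').
    pose z k := (r ^+ k)%:C *: tailv F T A x [::] k.
    have zz i j : i != j -> '<< z i, z j >> = 0.
      by move=> ij; rewrite innerZl innerZr tailv_orth // !mulr0.
    have zn k : nrm (z k) ^+ 2 = r ^+ (2 * k) * nrm (tailv F T A x [::] k) ^+ 2.
      by rewrite nrmZ cabR ger0_norm ?exprn_ge0 ?(ltW r0) // exprMn -exprM mulnC.
    apply: (@le_trans _ _ (\sum_(0 <= k < N) nrm (z k) ^+ 2)).
      rewrite mulr_sumr; apply: ler_sum_nat => k /andP[_ kN]; rewrite zn.
      rewrite ler_wpM2r ?sqr_ge0 // ler_wiXn2l ?(ltW r0) ?(ltW r1) //.
      by rewrite leq_mul2l (ltnW kN) orbT.
    rewrite -pythagoras // ler_pXn2r ?nnegrE ?nrm_ge0 //.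
    apply/ler_addgt0Pl => d d0.
    have := @fh_eval_tens R n F T E Y A r x [::] r01.
    move=> /cvg_nrmP/(_ d d0)[M hM].
    have := hM (maxn M N) (leq_maxl _ _); set L := Ae r _ => hL.
    apply: (@le_trans _ _ (nrm (\sum_(0 <= k < maxn M N) z k))).
      rewrite -(@ler_pXn2r _ 2) ?nnegrE ?nrm_ge0 // !pythagoras //.
      rewrite [X in _ <= X](big_cat_nat (n := N)) ?leq_maxr //= lerDl.
      by apply: sumr_ge0 => k _; exact: sqr_ge0.
    have -> : \sum_(0 <= k < maxn M N) z k = (\sum_(0 <= k < maxn M N) z k - L) + L.
      by rewrite subrK.
    by apply: le_trans (nrmD _ _) _; rewrite lerD2r ltW.
  have lim : r ^+ (2 * N) * S @[r --> (1 : R)^'-] --> 1 ^+ (2 * N) * S.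
    apply: cvg_at_left_filter; apply: cvgM; last exact: cvg_cst.
    exact: exprn_continuous.
  rewrite -[S]mul1r -[X in X * S](expr1n R (2 * N)).
  apply: cvgr_to_le lim _; apply: filterS (near_left1 (@ltr01 R)) => r; exact: key.
(* [H2_ball] asks for a strictly positive constant, and [c] may be 0. *)
exists (c + 1) => [|N x]; first by rewrite ltr_wpDl.
have -> : '<< ((c + 1)%:C *: (idfun : E -> E) -
    \sum_(k < N) \sum_(w : k.-tuple 'I_n) (adj (A w) \o A w)) x, x >> =
    ((c + 1) * nrm x ^+ 2 - \sum_(0 <= k < N) nrm (tailv F T A x [::] k) ^+ 2)%:C.
  rewrite !fctE innerBl innerZl inner_nrm -rmorphM rmorphB /=; congr (_ - _).
  rewrite big_mkord fct_sumE inner_suml rmorph_sum /=; apply: eq_bigr => k _.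
  rewrite tailv_nrm fct_sumE inner_suml rmorph_sum /=; apply: eq_bigr => w _.
  have bA := coef_bop A w.
  by rewrite /= -adjEr ?inner_nrm //; apply: adj_bop.
rewrite ler0c subr_ge0; apply: le_trans (sb x N) _.
by rewrite ler_wpM2r ?sqr_ge0 // lerDl.
Qed.

Variable c : R.
Hypothesis c0 : 0 <= c.
Hypothesis Ac : forall N, ople (\sum_(k < N) \sum_(w : k.-tuple 'I_n) (adj (A w) \o A w))
  (c%:C *: (idfun : E -> E)).
Variable G : E -> tprod T Y F.
Hypothesis bG : bop G.
Hypothesis hG : forall x, (\sum_(0 <= k < N) \sum_(w : k.-tuple 'I_n) tn (A w x) (e w))
    @[N --> \oo] --> G x.

(** The middle operator [B] lets one limit serve twice: B = I for phi, and B = I ⊗ S_v^* for the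
    equation that defines mu_theta. *)
Lemma gram_entry_cvg (B : tprod T Y F -> tprod T Y F) x y v w : bop B ->
  '<< (adj (Ae r) \o B \o Ae r) (tn x (e v)), tn y (e w) >> @[r --> (1 : R)^'-] -->
  ('<< B (O v (G x)), O w (G y) >> : R[i]^o).
Proof.
move=> bB; have lim u q : Ae r (tn u (e q)) @[r --> (1 : R)^'-] --> O q (G u).
  exact: (fh_eval_radial Ac hG).
have : '<< B (Ae r (tn x (e v))), Ae r (tn y (e w)) >> @[r --> (1 : R)^'-] -->
    ('<< B (O v (G x)), O w (G y) >> : R[i]^o).
  by apply: cvg_inner => //; exact: cvg_bop.
apply: cvgC_near_eq; apply: filterS (near_left1 (@ltr01 R)) => r /andP[r0 r1].
have b : bop (Ae r) by apply: fh_eval_bop; rewrite (ltW r0).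
by rewrite /= -adjEr ?adjK //; exact: adj_bop.
Qed.

(** A finite sum involves finitely many entries. Each of them converges, and its radial factor (r /
    t)^d tends to r^d as t tends to 1. *)
Lemma poisson_gram_cvg (r : R) z : 0 <= r < 1 ->
  (exists s : seq (E * seq 'I_n), z = \sum_(p <- s) tn p.1 (e p.2)) ->
  forall psi : tprod T E F -> tprod T E F, bop psi ->
  (forall x y v w, '<< psi (tn x (e v)), tn y (e w) >> =
    (r ^+ wdist v w)%:C * '<< O v (G x), O w (G y) >>) ->
  '<< rpois (r / t) (phi t) z, z >> @[t --> (1 : R)^'-] --> ('<< psi z, z >> : R[i]^o).
Proof.
move=> r01 [s ->] psi bpsi psiE; have /andP[r0 r1] := r01.
pose ent t p q := ((r / t) ^+ wdist p.2 q.2)%:C *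
  '<< phi t (tn p.1 (e p.2)), tn q.1 (e q.2) >>.
have : \sum_(p <- s) \sum_(q <- s) ent t p q @[t --> (1 : R)^'-] -->
    (\sum_(p <- s) \sum_(q <- s) '<< psi (tn p.1 (e p.2)), tn q.1 (e q.2) >> : R[i]^o).
  apply/cvg_cab; apply: cvg_sumC => p; apply: cvg_sumC => q; apply/cvg_cab; rewrite psiE.
  apply: cvgCMl; last exact: (@gram_entry_cvg idfun _ _ _ _ (bop_id _)).
  have lim : r / t @[t --> (1 : R)^'-] --> r.
    rewrite -[X in _ --> X]divr1; apply: cvgM; first exact: cvg_cst.
    by apply: cvgV; [exact: oner_neq0|apply: cvg_at_left_filter; exact: cvg_id].
  exact: (cvg_comp _ _ lim (@exprn_continuous R _ r)).
have -> : '<< psi (\sum_(p <- s) tn p.1 (e p.2)), \sum_(p <- s) tn p.1 (e p.2) >> =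
    \sum_(p <- s) \sum_(q <- s) '<< psi (tn p.1 (e p.2)), tn q.1 (e q.2) >>.
  by rewrite bop_sum // inner_suml; apply: eq_bigr => p _; rewrite inner_sumr.
apply: cvgC_near_eq; apply: filterS (near_left1 r1) => t /andP[rt t1].
have t0 : 0 < t := le_lt_trans r0 rt.
have t01 : 0 <= t < 1 by rewrite ltW.
have s01 : 0 <= r / t < 1 by rewrite divr_ge0 ?(ltW t0) // ltr_pdivrMr // mul1r.
have [bp rad] := radial_fh_gram F T A t01.
rewrite bop_sum ?inner_suml; last exact: rpois_bop.
by apply: eq_bigr => p _; rewrite inner_sumr; apply: eq_bigr => q _; rewrite rad.
Qed.

Lemma least_majorant (psi : R -> tprod T E F -> tprod T E F) :
  pluriharmonic_curve psi ->
  (forall r x y v w, 0 <= r < 1 -> '<< psi r (tn x (e v)), tn y (e w) >> =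
    (r ^+ wdist v w)%:C * '<< O v (G x), O w (G y) >>) ->
  least_pluriharmonic_majorant phi psi.
Proof.
move=> cpsi psiE; have [Spsi _] := cpsi; split; first split=> // r r01 z.
- have [bpsi _] := Spsi r r01; have bphi := gram_bop r01.
  apply: (@pos_dense _ _ _ _ (bop_sub bpsi bphi) (@fock_tens_total _ _ F T E)) => {}z Dz.
  rewrite -[(_ - _) z]/(psi r z - phi r z) innerBl subr_ge0.
  have lim := poisson_gram_cvg r01 Dz bpsi (fun x y v w => psiE r x y v w r01).
  apply: cvgC_ge lim _; have /andP[r0 r1] := r01.
  apply: filterS (near_left1 r1) => t /andP[rt t1].
  have t0 : 0 < t := le_lt_trans r0 rt.
  have t01 : 0 <= t < 1 by rewrite ltW.
  have s01 : 0 <= r / t < 1 by rewrite divr_ge0 ?(ltW t0) // ltr_pdivrMr // mul1r.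
  rewrite gram_inner //; apply: le_trans (rpois_schwarz z s01 (fh_eval_bop F T A t01)).
  (* The transform at r / t sends Theta(tR) to Theta(rR), so the Schwarz lower bound does not depend
     on t. *)
  have rtt : r / t * t = r by rewrite divfK // gt_eqF.
  have := rpois_fh F T A s01 t01; rewrite rtt => ->; exact: lexx.
move=> h' [[Sh hP] hA] r r01 z.
have [bpsi _] := Spsi r r01; have [bh _] := Sh r r01.
apply: (@pos_dense _ _ _ _ (bop_sub bh bpsi) (@fock_tens_total _ _ F T E)) => {}z Dz.
rewrite -[(_ - _) z]/(h' r z - psi r z) innerBl subr_ge0.
have lim := poisson_gram_cvg r01 Dz bpsi (fun x y v w => psiE r x y v w r01).
apply: cvgC_le lim _; have /andP[r0 r1] := r01.
apply: filterS (near_left1 r1) => t /andP[rt t1].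
have t0 : 0 < t := le_lt_trans r0 rt.
have t01 : 0 <= t < 1 by rewrite ltW.
have s01 : 0 <= r / t < 1 by rewrite divr_ge0 ?(ltW t0) // ltr_pdivrMr // mul1r.
have [bt _] := Sh t t01; have bp := gram_bop t01.
(* Pluriharmonicity writes h'(r) as the same transform of h'(t), so the difference is the transform
   of the positive operator h'(t) - phi(t). *)
rewrite (hP r t) // poissonE -subr_ge0 -innerBl.
rewrite -[rpois _ _ z - rpois _ _ z]/((rpois (r / t) (h' t) - rpois (r / t) (phi t)) z).
rewrite -rpoisB //; apply: rpois_ge0 => //; first exact: bop_sub.
exact: hA.
Qed.

End Majorant.

Theorem theorem2p3 (R : realType) (n : nat) (n_ge1 : (1 <= n)%N)
    (E Y H : hilbertType R) (E_separable : hilbert_separable E)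
    (H_infinite : infinite_dimensional H)
    (T : hilbert_tensor R) (F : fock_space R n) (Theta : free_hol n E Y) :
  let ThetaR (r : R) : tprod T E F -> tprod T Y F :=
    fh_eval T Theta (scaled_creR F r) in
  let phi (r : R) : tprod T E F -> tprod T E F :=
    adj (ThetaR r) \o ThetaR r in
  let one : F := fock_e F [::] in
  let is_mu_theta (mu : (F -> F) -> E -> E) : Prop :=
    cp_linear mu /\
    forall (w : seq 'I_n) (x y : E),
      '<< (adj (ThetaR r)
            \o optens T (idfun : Y -> Y) (adj (monom (creL F) (rev w)))
            \o ThetaR r) (tens T E F x one), tens T E F y one >>
        @[r --> (1 : R)^'-]
        --> ('<< mu (adj (monom (creR F) (rev w))) x, y >> : (R[i])^o) in
  (H2_ball Theta <-> exists h, pluriharmonic_majorant phi h) /\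
  (H2_ball Theta ->
    exists mu_theta : (F -> F) -> E -> E,
    [/\ is_mu_theta mu_theta,
        forall mu', is_mu_theta mu' ->
          forall f, sysR F f -> mu' f = mu_theta f &
        let represents (W : free_hol n E E) : Prop :=
          forall X : 'I_n -> H -> H, row_ball X ->
            fh_eval T W X = herglotz T mu_theta X in
        (exists W, represents W) /\
        (forall W, represents W ->
          least_pluriharmonic_majorant phi
            (fun r => opre (fh_eval T W (scaled_creR F r))))]).
Proof.
move=> ThetaR phi one is_mu_theta.
have main : H2_ball Theta -> exists mu_theta : (F -> F) -> E -> E,
    [/\ is_mu_theta mu_theta,
        forall mu', is_mu_theta mu' ->
          forall f, sysR F f -> mu' f = mu_theta f &
        let represents (W : free_hol n E E) : Prop :=
          forall X : 'I_n -> H -> H, row_ball X ->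
            fh_eval T W X = herglotz T mu_theta X in
        (exists W, represents W) /\
        (forall W, represents W ->
          least_pluriharmonic_majorant phi
            (fun r => opre (fh_eval T W (scaled_creR F r))))].
  move=> [c c0 Ac]; have [G bG hG] := Gamma_exists F T (ltW c0) Ac.
  have mu_lim w x y : '<< (adj (ThetaR r)
            \o optens T (idfun : Y -> Y) (adj (monom (creL F) (rev w)))
            \o ThetaR r) (tens T E F x one), tens T E F y one >>
        @[r --> (1 : R)^'-]
        --> ('<< cmap G (adj (monom (creR F) (rev w))) x, y >> : (R[i])^o).
    have bi := @bop_id R Y; have bS := Sw_bop F (rev w); have bS' := adj_bop bS.
    have bo : bop (optens T (idfun : Y -> Y) (adj (monom (creL F) (rev w)))).
      exact: optens_bop.
    have bU : bop (monom (creL F) [::] \o flip F).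
      by apply: bop_comp; [exact: bop_id|exact: flip_bop].
    have bf := flip_bop F.
    (* The moment of mu_theta is the limit entry at the pair formed by the empty word and rev w,
       with S_(rev w) moved to the other argument as an adjoint. *)
    suff -> : '<< cmap G (adj (monom (creR F) (rev w))) x, y >> =
        '<< optens T (idfun : Y -> Y) (adj (monom (creL F) (rev w)))
            (optens T (idfun : Y -> Y) (monom (creL F) [::] \o flip F) (G x)),
            optens T (idfun : Y -> Y) (monom (creL F) [::] \o flip F) (G y) >>.
      exact: (gram_entry_cvg Ac hG).
    rewrite cmap_adj_shift // -[X in optens T X (adj _)](adj_id Y) -optens_adj // -adjEr //;
      last exact: optens_bop.
    congr '<< _, _ >>.
    rewrite -[RHS]/((optens T (idfun : Y -> Y) (monom (creL F) (rev w)) \o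
      optens T (idfun : Y -> Y) (monom (creL F) [::] \o flip F)) (G y)).
    by rewrite -optens_comp.
  have cpG : cp_linear (cmap G) := cmap_cp bG.
  exists (cmap G); split; first by split.
    move=> mu' [cp' lim']; apply: cp_uniq => // w.
    (* The defining limits are indexed by reversed words, and every word is one. *)
    have ww : w = rev (rev w) by rewrite revK.
    have sw := sysR_adj (sysR_monom F w).
    apply/funext => x; apply: inner_inj => y; rewrite ww.
    exact: (cvg_unique (@norm_hausdorff _ R[i]^o) (lim' (rev w) x y) (mu_lim (rev w) x y)).
  split; first by exists (herglotz_fun bG) => X rX; rewrite herglotz_funP.
  (* The representation constrains W on tuples over [H], whereas the majorant evaluates W at r R on
     the Fock space; the coefficients connect the two. *)
  move=> W WX; have WE w : W w = hcoef G w.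
    apply: (free_hol_uniq (A := W) (B := herglotz_fun bG) (T := T) H_infinite) => X rX.
    by rewrite WX // herglotz_funP.
  apply: (least_majorant Ac hG); first exact: (pluriharmonic_herglotz bG WE).
  by move=> r x y v w r01'; apply: herglotz_entry.
split=> //; split=> [/main[mu [_ _ [[W WX] /(_ W WX)[]]]]|[h]];
  first by exists (fun r => opre (fh_eval T W (scaled_creR F r))).
exact: majorant_H2.
Qed.
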